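(* For every $p_0>2$ there is a bounded domain $\Omega_0$ in $\mathbb{C}^2$ such that, for $p\in(1,\infty)$, the ordinary Bergman projection $\mathbf{B}_{\Omega_0}$ is bounded on $L^p(\Omega_0)$ if and only if $p\in(q_0,p_0)$, where $\frac1{p_0}+\frac1{q_0}=1$.
   Context: For a domain $\Omega\subset\mathbb{C}^n$, $L^p(\Omega)$ is taken with respect to Lebesgue measure, $L^2_a(\Omega)$ is the closed subspace of holomorphic functions in $L^2(\Omega)$, and the ordinary Bergman projection $\mathbf{B}_\Omega:L^2(\Omega)\to L^2_a(\Omega)$ is the orthogonal projection. It is said to be bounded on $L^p(\Omega)$ if there is $C>0$ with $\|\mathbf{B}_{\Omega}f\|_{L^p(\Omega)}\le C\|f\|_{L^p(\Omega)}$ for all $f\in L^2(\Omega)\cap L^p(\Omega)$. *)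

(* Defs.v *)
From HB Require Import structures.
From mathcomp Require Import all_boot all_order all_algebra.
From mathcomp Require Import complex.
From mathcomp Require Import all_classical all_reals all_analysis.

Set Implicit Arguments.
Unset Strict Implicit.
Unset Printing Implicit Defensive.
Import Order.TTheory GRing.Theory Num.Theory.
Import numFieldNormedType.Exports.
Local Open Scope classical_set_scope.
Local Open Scope ring_scope.
Local Open Scope complex_scope.

(* The scalar field is [R[i]], so that [differentiable] below is complex
   differentiability. *)
Definition C2 (R : realType) : normedModType R[i] := (R[i]^o * R[i]^o)%type.

Definition R4 (R : realType) :=
  ((measurableTypeR R * measurableTypeR R) *
   (measurableTypeR R * measurableTypeR R))%type.

(* Measure-theoretic notions on C^2 are transported along this identification
   of R^4 with C^2. *)
Definition C2_of_R4 (R : realType) (x : R4 R) : C2 R :=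
  (x.1.1 +i* x.1.2, x.2.1 +i* x.2.2).

Section lebesgue2.
Variable R : realType.
Local Notation leb := (@lebesgue_measure R).

Definition lebesgue2 : set (measurableTypeR R * measurableTypeR R) -> \bar R :=
  (leb \x leb)%E.
HB.instance Definition _ := Measure.on lebesgue2.

(* The sigma-finite instance of products of measures is masked by the one for
   subprobabilities, hence this explicit instance. *)
Let lebesgue2_sigma_finite : sigma_finite setT lebesgue2.
Proof.
have /sigma_finiteP[F [TF ndF Foo]] := sigma_finiteT leb.
exists (fun n => F n `*` F n).
  rewrite -setXTT TF predeqE => -[x y]; split.
    move=> [/= [n _ Fnx] [k _ Fky]]; exists (maxn n k) => //; split.
    - by move: x Fnx; exact/subsetPset/ndF/leq_maxl.
    - by move: y Fky; exact/subsetPset/ndF/leq_maxr.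
  by move=> [n _ []/= ? ?]; split; exists n.
move=> k; have [? ?] := Foo k.
split; first exact: measurableX.
by rewrite /lebesgue2 product_measure1E// lte_mul_pinfty// ge0_fin_numE.
Qed.

HB.instance Definition _ := Measure_isSigmaFinite.Build _ _ _ lebesgue2
  lebesgue2_sigma_finite.

End lebesgue2.

(* A measure on the Borel sets of R^4. *)
Definition lebesgue4 (R : realType) : {measure set (R4 R) -> \bar R} :=
  (@lebesgue2 R \x @lebesgue2 R)%E.

Section bergman.
Variable R : realType.
Implicit Types (D : set (C2 R)) (f g h : C2 R -> R[i]) (p : R).

Definition is_domain D := [/\ D !=set0, open D & connected D].

Definition holomorphic_on D f :=
  forall z, D z -> differentiable (f : C2 R -> R[i]^o) z.

(* In the following definitions a function on [D] is represented by a function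
   on the whole of C^2, whose values outside [D] are irrelevant. *)

Definition measurable_on D f :=
  measurable_fun (@C2_of_R4 R @^-1` D)
    (fun x => complex.Re (f (C2_of_R4 x)) : measurableTypeR R) /\
  measurable_fun (@C2_of_R4 R @^-1` D)
    (fun x => complex.Im (f (C2_of_R4 x)) : measurableTypeR R).

Definition Lp_norm D p f : \bar R :=
  Lnorm (lebesgue4 R) p%:E
    ((fun x => (ComplexField.Normc.normc (f (C2_of_R4 x)))%:E)
       \_ (@C2_of_R4 R @^-1` D)).

Definition in_Lp D p f := measurable_on D f /\ (Lp_norm D p f < +oo)%E.

Definition bergman_space D f := holomorphic_on D f /\ in_Lp D 2 f.

Definition cintegral D h : R[i] :=
  (\int[lebesgue4 R]_(x in @C2_of_R4 R @^-1` D) complex.Re (h (C2_of_R4 x)))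
  +i*
  (\int[lebesgue4 R]_(x in @C2_of_R4 R @^-1` D) complex.Im (h (C2_of_R4 x))).

Definition L2_inner D f g : R[i] := cintegral D (fun z => f z * conjc (g z)).

Definition is_bergman_projection D f g :=
  bergman_space D g /\
  forall h, bergman_space D h -> L2_inner D (fun z => f z - g z) h = 0.

(* For [f] in L^2(D) such a [g] exists and is unique on [D] (orthogonal
   projection onto a closed subspace); [xget] selects one representative, which
   is arbitrary only outside [D]. *)
Definition bergman_projection D f : C2 R -> R[i] :=
  xget (fun=> 0) [set g | is_bergman_projection D f g].

Definition bergman_bounded_on_Lp D p :=
  exists2 C : R, 0 < C &
    forall f, in_Lp D 2 f -> in_Lp D p f ->
      (Lp_norm D p (bergman_projection D f) <= C%:E * Lp_norm D p f)%E.

End bergman.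

(* Main.v *)
(* The domain is the Hartogs domain { |z| < 1, |w| < |g z| } with
   g z = (1 - z)^a and a = 2 / (p0 - 2).  The map (z, w) |-> (z, w / g z)
   carries the Bergman kernel of the bidisc to it, so the kernel is explicit,
   and L^p norms of functions of z / g z become L^p norms on the disc with the
   weight |1 - z|^(a (2 - p)).

   For q0 < p < p0 the modulus of the kernel passes the Schur test with the
   weight ((1 - |z|^2) (1 - |w/g|^2))^(-s) |1 - z|^(-t) for suitable s and t, by
   Forelli-Rudin type estimates on the disc; projections are recovered from the
   kernel by the reproducing formula, so neither existence of the projection nor
   completeness of the Bergman space is needed.

   For the converse, v(z) / g z is tested, v being a sum of normalised
   indicators of N disjoint discs shrinking to 1; its projection is
   sum_n (1 - z x_n)^(-2) / g z.  If p >= p0 one disc suffices, because 1/g is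
   not in L^p; if p <= q0 the p-th power of the norm of v / g is O(N) while that
   of its projection is at least c N^p. *)
Require Import Defs.
From HB Require Import structures.
From mathcomp Require Import all_boot all_order all_algebra.
From mathcomp Require Import complex ring lra.
From mathcomp Require Import all_classical all_reals all_analysis measurable_realfun.
Set Implicit Arguments.
Unset Strict Implicit.
Unset Printing Implicit Defensive.
Import Order.TTheory GRing.Theory Num.Theory.
Import numFieldNormedType.Exports.
Local Open Scope classical_set_scope.
Local Open Scope ring_scope.
Local Open Scope complex_scope.

(** The fibre over [z] has area proportional to [|1 - z|^(2a)], so [1/g] lies in [L^p] exactly when
    [a (p - 2) < 2]; the value of [a] puts this threshold at [p0]. The same balance governs the
    Schur test: with [q] conjugate to [p], the conditions on [s] and [t] for both exponents are
    compatible exactly when [min (1/p) (1/q) > 1/p0].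

    The obstacle in the reproducing formula is that the holomorphic functions are merely integrable
    and have no boundary values. Hence Cauchy's formula is used only on circles inside the disc. It
    comes from Goursat's theorem applied to a homotopy of circles; averages over rotations and the
    areas of annuli then stand in for polar coordinates, and a difference quotient in a dilation
    parameter produces the squared kernel. On the Hartogs domain slices are integrable only almost
    everywhere, so identities on a fibre are proved under the assumption that the slice is
    integrable.

    Indicators of discs are good test functions because the mean value property, used on the fibre
    and on the base, turns pairing with them into evaluation at a point. Their projections are
    therefore multiples of kernel functions. *)

Local Notation "z ^*" := (conjc z) : ring_scope.

Notation nc := ComplexField.Normc.normc.
Notation Re := complex.Re.
Notation Im := complex.Im.

(** * Moduli, real parts and imaginary parts *)

Section normc.
Context {R : realType}.
Implicit Types (z w : R[i]) (r : R).

Lemma nc_ge0 z : 0 <= nc z.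
Proof. by case: z => a b; exact: sqrtr_ge0. Qed.

Lemma nc0 : nc (0 : R[i]) = 0.
Proof. exact: ComplexField.Normc.normc0. Qed.

Lemma nc1 : nc (1 : R[i]) = 1.
Proof. exact: ComplexField.Normc.normc1. Qed.

Lemma ncM z w : nc (z * w) = nc z * nc w.
Proof. exact: ComplexField.Normc.normcM. Qed.

Lemma ncV z : nc z^-1 = (nc z)^-1.
Proof. exact: ComplexField.Normc.normcV. Qed.

Lemma ncN z : nc (- z) = nc z.
Proof. exact: normcN. Qed.

Lemma ncB z w : nc (z - w) = nc (w - z).
Proof. by rewrite -ncN opprB. Qed.

Lemma ncX z n : nc (z ^+ n) = nc z ^+ n.
Proof. by elim: n => [|n ih]; rewrite ?expr0 ?nc1// !exprS ncM ih. Qed.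

Lemma nc_conj z : nc z^* = nc z.
Proof. by case: z => a b /=; rewrite sqrrN. Qed.

Lemma nc_real r : nc r%:C = `|r|.
Proof. by rewrite /= expr0n/= addr0 sqrtr_sqr. Qed.

Lemma nc_triangle z w : nc (z + w) <= nc z + nc w.
Proof. exact: le_normcD. Qed.

Lemma nc_subadd z w : nc (z - w) <= nc z + nc w.
Proof. by rewrite -(ncN w) nc_triangle. Qed.

Lemma nc_lower z w : nc z - nc w <= nc (z - w).
Proof. by have := nc_triangle (z - w) w; rewrite subrK; lra. Qed.

Lemma nc_eq0 z : (nc z == 0) = (z == 0).
Proof.
apply/eqP/eqP => [|->]; last exact: nc0.
exact: ComplexField.Normc.eq0_normc.
Qed.

Lemma nc_gt0 z : (0 < nc z) = (z != 0).
Proof. by rewrite lt_def nc_ge0 andbT nc_eq0. Qed.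

Lemma sqr_nc z : nc z ^+ 2 = Re z ^+ 2 + Im z ^+ 2.
Proof. by case: z => a b /=; rewrite sqr_sqrtr// addr_ge0 ?sqr_ge0. Qed.

Lemma ReD z w : Re (z + w) = Re z + Re w. Proof. by case: z w => [a b] [c d]. Qed.
Lemma ImD z w : Im (z + w) = Im z + Im w. Proof. by case: z w => [a b] [c d]. Qed.
Lemma ReN z : Re (- z) = - Re z. Proof. by case: z. Qed.
Lemma ImN z : Im (- z) = - Im z. Proof. by case: z. Qed.
Lemma ReM z w : Re (z * w) = Re z * Re w - Im z * Im w.
Proof. by case: z w => [a b] [c d]. Qed.
Lemma ImM z w : Im (z * w) = Re z * Im w + Im z * Re w.
Proof. by case: z w => [a b] [c d]. Qed.
Lemma Re_conj z : Re z^* = Re z. Proof. by case: z. Qed.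
Lemma Im_conj z : Im z^* = - Im z. Proof. by case: z. Qed.
Lemma ReV z : Re z^-1 = Re z / nc z ^+ 2.
Proof. by rewrite sqr_nc; case: z => a b; rewrite /GRing.inv /= ?mulNr. Qed.
Lemma ImV z : Im z^-1 = - Im z / nc z ^+ 2.
Proof. by rewrite sqr_nc; case: z => a b; rewrite /GRing.inv /= ?mulNr. Qed.

Lemma Re_le_nc z : `|Re z| <= nc z.
Proof.
by rewrite -(ler_pXn2r (n:=2))// ?nnegrE ?nc_ge0// sqr_nc real_normK ?num_real// lerDl sqr_ge0.
Qed.

Lemma Im_le_nc z : `|Im z| <= nc z.
Proof.
by rewrite -(ler_pXn2r (n:=2))// ?nnegrE ?nc_ge0// sqr_nc real_normK ?num_real// lerDr sqr_ge0.
Qed.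

Lemma nc_le_ReIm z : nc z <= `|Re z| + `|Im z|.
Proof.
case: z => a b /=; rewrite -[leRHS]ger0_norm ?addr_ge0// -sqrtr_sqr ler_sqrt ?sqr_ge0//.
rewrite sqrrD !real_normK ?num_real// lerD2r lerDl.
by rewrite mulrn_wge0// mulr_ge0.
Qed.

Lemma complex_eq z w : Re z = Re w -> Im z = Im w -> z = w.
Proof. by case: z w => [a b] [c d] /= -> ->. Qed.

Lemma mulc_conj z : z * z^* = (nc z ^+ 2)%:C.
Proof. by apply: complex_eq; rewrite sqr_nc; case: z => a b /=; ring. Qed.

Lemma cconj0 : (0 : R[i])^* = 0.
Proof. by apply: complex_eq => //=; rewrite oppr0. Qed.

Lemma cconj1 : (1 : R[i])^* = 1.
Proof. by apply: complex_eq => //=; rewrite oppr0. Qed.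

Lemma conjcM z w : (z * w)^* = z^* * w^*.
Proof. exact: rmorphM. Qed.

Lemma conjcB z w : (z - w)^* = z^* - w^*.
Proof. exact: rmorphB. Qed.

End normc.

(** * Measurability of complex-valued functions *)

Section Cmeasurable.
Context d (T : measurableType d) {R : realType}.
Implicit Types (f g : T -> R[i]) (A : set T).

(** Shaped like [measurable_on], which unfolds to it on the preimage of a domain under [C2_of_R4],
    so the closure properties below apply there directly. *)
Definition Cmeasurable A f :=
  measurable_fun A (fun x => Re (f x) : measurableTypeR R) /\
  measurable_fun A (fun x => Im (f x) : measurableTypeR R).

Lemma CmeasurableD A f g : Cmeasurable A f -> Cmeasurable A g ->
  Cmeasurable A (fun x => f x + g x).
Proof.
move=> [f1 f2] [g1 g2]; split.
  by under eq_fun do rewrite ReD; exact: measurable_funD.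
by under eq_fun do rewrite ImD; exact: measurable_funD.
Qed.

Lemma CmeasurableN A f : Cmeasurable A f -> Cmeasurable A (fun x => - f x).
Proof.
move=> [f1 f2]; split.
  by under eq_fun do rewrite ReN; exact: measurable_funN.
by under eq_fun do rewrite ImN; exact: measurable_funN.
Qed.

Lemma CmeasurableB A f g : Cmeasurable A f -> Cmeasurable A g ->
  Cmeasurable A (fun x => f x - g x).
Proof. by move=> mf mg; apply: CmeasurableD => //; exact: CmeasurableN. Qed.

Lemma CmeasurableM A f g : Cmeasurable A f -> Cmeasurable A g ->
  Cmeasurable A (fun x => f x * g x).
Proof.
move=> [f1 f2] [g1 g2]; split.
  under eq_fun do rewrite ReM.
  by apply: measurable_funB; apply: measurable_funM.
under eq_fun do rewrite ImM.
by apply: measurable_funD; apply: measurable_funM.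
Qed.

Lemma Cmeasurable_cst A c : Cmeasurable A (fun=> c).
Proof. by split; exact: measurable_cst. Qed.

Lemma Cmeasurable_conj A f : Cmeasurable A f -> Cmeasurable A (fun x => (f x)^*).
Proof.
move=> [f1 f2]; split; first by under eq_fun do rewrite Re_conj.
by under eq_fun do rewrite Im_conj; exact: measurable_funN.
Qed.

Lemma Cmeasurable_real A (r : T -> R) : measurable_fun A r ->
  Cmeasurable A (fun x => (r x)%:C).
Proof. by move=> mr; split => //=; exact: measurable_cst. Qed.

Lemma measurable_sqrt_comp A (r : T -> R) :
  measurable_fun A r -> measurable_fun A (fun x => Num.sqrt (r x)).
Proof.
move=> mr; apply: (measurableT_comp (f := @Num.sqrt R)) => //.
by apply: continuous_measurable_fun; exact: sqrt_continuous.
Qed.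

Lemma measurable_nc A f : Cmeasurable A f -> measurable_fun A (fun x => nc (f x)).
Proof.
move=> [f1 f2].
have -> : (fun x => nc (f x)) = (fun x => Num.sqrt (Re (f x) ^+ 2 + Im (f x) ^+ 2)).
  by apply/funext => x; case: (f x).
by apply: measurable_sqrt_comp; apply: measurable_funD; exact: measurable_funX.
Qed.

(** On nonnegative reals inversion is the real power of exponent -1, also at 0, where both
    conventions give 0. So the zero set needs no separate treatment. *)
Lemma measurable_inv_ge0 A (r : T -> R) : (forall x, 0 <= r x) ->
  measurable_fun A r -> measurable_fun A (fun x => (r x)^-1).
Proof.
move=> r0 mr; under eq_fun do rewrite -powR_inv1//.
exact: (measurableT_comp (measurable_powR (-1))).
Qed.

Lemma CmeasurableV A f : Cmeasurable A f -> Cmeasurable A (fun x => (f x)^-1).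
Proof.
move=> mf; have m2 : measurable_fun A (fun x => (nc (f x) ^+ 2)^-1).
  by apply: measurable_inv_ge0 => [x|]; [exact: sqr_ge0|apply/measurable_funX/measurable_nc].
have [f1 f2] := mf; split.
  by under eq_fun do rewrite ReV; exact: measurable_funM.
under eq_fun do rewrite ImV; apply: measurable_funM => //.
exact: measurable_funN.
Qed.

Lemma CmeasurableX A f n : Cmeasurable A f -> Cmeasurable A (fun x => f x ^+ n).
Proof.
move=> mf; elim: n => [|n ih]; first by under eq_fun do rewrite expr0; exact: Cmeasurable_cst.
by under eq_fun do rewrite exprS; exact: CmeasurableM.
Qed.

Lemma Cmeasurable_sum A I (s : seq I) (F : I -> T -> R[i]) :
  (forall i, Cmeasurable A (F i)) -> Cmeasurable A (fun x => \sum_(i <- s) F i x).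
Proof.
move=> mF; elim: s => [|i s ih].
  by under eq_fun do rewrite big_nil; exact: Cmeasurable_cst.
by under eq_fun do rewrite big_cons; exact: CmeasurableD.
Qed.

Lemma CmeasurableS A B f : measurable B -> A `<=` B -> Cmeasurable B f -> Cmeasurable A f.
Proof. by move=> mB AB [f1 f2]; split; exact: measurable_funS mB AB _. Qed.

Lemma Cmeasurable_eq A f g : {in A, f =1 g} -> Cmeasurable A f -> Cmeasurable A g.
Proof.
move=> fg [f1 f2]; split.
  by move: f1; apply: eq_measurable_fun => x xA; rewrite fg.
by move: f2; apply: eq_measurable_fun => x xA; rewrite fg.
Qed.

End Cmeasurable.

Lemma Cmeasurable_comp d1 d2 (T1 : measurableType d1) (T2 : measurableType d2)
    (R : realType) (A : set T1) (B : set T2) (f : T2 -> R[i]) (h : T1 -> T2) :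
  measurable B -> h @` A `<=` B -> Cmeasurable B f -> measurable_fun A h ->
  Cmeasurable A (fun x => f (h x)).
Proof. by move=> mB hAB [f1 f2] mh; split; [exact: (measurable_comp mB hAB f1 mh)|exact: (measurable_comp mB hAB f2 mh)]. Qed.

(** * Integrals of complex-valued functions *)

Section Cintegral.
Context d (T : measurableType d) {R : realType}.
Variable mu : {measure set T -> \bar R}.
Implicit Types (f g : T -> R[i]) (A : set T) (h : T -> R).

Definition Cintegrable A f :=
  mu.-integrable A (EFin \o (fun x => Re (f x))) /\
  mu.-integrable A (EFin \o (fun x => Im (f x))).

(** The general form of [cintegral], to which it reduces for the measure on R^4; having any measure
    here lets the same rules serve paths, planar discs and the domain. *)
Definition Cint A f : R[i] :=
  (\int[mu]_(x in A) Re (f x)) +i* (\int[mu]_(x in A) Im (f x)).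

Lemma Cintegrable_measurable A f : Cintegrable A f -> Cmeasurable A f.
Proof. by move=> [/measurable_int/measurable_EFinP f1 /measurable_int/measurable_EFinP f2]. Qed.

Lemma le_Cintegrable A f h : measurable A -> Cmeasurable A f ->
  (forall x, A x -> nc (f x) <= h x) ->
  mu.-integrable A (EFin \o h) -> Cintegrable A f.
Proof.
move=> mA [f1 f2] fh ih.
split; apply: (le_integrable _ _ _ ih) => //; try exact/measurable_EFinP.
  move=> x Ax /=; rewrite lee_fin; apply: (le_trans (Re_le_nc _)).
  by rewrite (le_trans (fh _ Ax))// ler_norm.
move=> x Ax /=; rewrite lee_fin; apply: (le_trans (Im_le_nc _)).
by rewrite (le_trans (fh _ Ax))// ler_norm.
Qed.

Lemma integrable_nc A f : measurable A -> Cintegrable A f ->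
  mu.-integrable A (EFin \o (fun x => nc (f x))).
Proof.
move=> mA iF; have mf := Cintegrable_measurable iF; case: iF => i1 i2.
have := integrableD mA (integrable_abse i1) (integrable_abse i2).
apply: le_integrable => //; first exact/measurable_EFinP/measurable_nc.
move=> x Ax /=; rewrite lee_fin (ger0_norm (nc_ge0 _)).
by rewrite (le_trans (nc_le_ReIm _))// ler_norm.
Qed.

Lemma eq_Cint A f g : {in A, f =1 g} -> Cint A f = Cint A g.
Proof.
by move=> fg; congr (_ +i* _); apply: eq_Rintegral => x xA; rewrite fg.
Qed.

Lemma eq_Cintegrable A f g : measurable A -> {in A, f =1 g} ->
  Cintegrable A f -> Cintegrable A g.
Proof.
move=> mA fg [f1 f2]; split.
  by move: f1; apply: eq_integrable => // x xA /=; rewrite fg.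
by move: f2; apply: eq_integrable => // x xA /=; rewrite fg.
Qed.

Lemma CintegrableD A f g : measurable A -> Cintegrable A f -> Cintegrable A g ->
  Cintegrable A (fun x => f x + g x).
Proof.
move=> mA [f1 f2] [g1 g2]; split.
  by have := integrableD mA f1 g1; apply: eq_integrable => // x _ /=; rewrite ReD EFinD.
by have := integrableD mA f2 g2; apply: eq_integrable => // x _ /=; rewrite ImD EFinD.
Qed.

Lemma CintD A f g : measurable A -> Cintegrable A f -> Cintegrable A g ->
  Cint A (fun x => f x + g x) = Cint A f + Cint A g.
Proof.
move=> mA [f1 f2] [g1 g2]; apply: complex_eq; rewrite ?ReD ?ImD /= -RintegralD//.
  by apply: eq_Rintegral => x _; rewrite ReD.
by apply: eq_Rintegral => x _; rewrite ImD.
Qed.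

Lemma CintegrableZ A c f : measurable A -> Cintegrable A f ->
  Cintegrable A (fun x => c * f x).
Proof.
move=> mA iF; apply: (le_Cintegrable (h := fun x => nc c * nc (f x))) => //.
- by apply: CmeasurableM; [exact: Cmeasurable_cst|exact: Cintegrable_measurable].
- by move=> x _; rewrite ncM.
have := integrableZl mA (nc c) (integrable_nc mA iF).
by apply: eq_integrable.
Qed.

Lemma CintZ A c f : measurable A -> Cintegrable A f ->
  Cint A (fun x => c * f x) = c * Cint A f.
Proof.
move=> mA [f1 f2]; apply: complex_eq; rewrite ?ReM ?ImM /=.
  rewrite -!RintegralZl// -RintegralB//; last 2 first.
  - by have := integrableZl mA (Re c) f1; apply: eq_integrable.
  - by have := integrableZl mA (Im c) f2; apply: eq_integrable.
  by apply: eq_Rintegral => x _; rewrite ReM.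
rewrite -!RintegralZl// -RintegralD//; last 2 first.
- by have := integrableZl mA (Re c) f2; apply: eq_integrable.
- by have := integrableZl mA (Im c) f1; apply: eq_integrable.
by apply: eq_Rintegral => x _; rewrite ImM.
Qed.

Lemma CintegrableN A f : measurable A -> Cintegrable A f -> Cintegrable A (fun x => - f x).
Proof.
move=> mA /(CintegrableZ (-1) mA); apply: eq_Cintegrable => // x _.
by rewrite mulN1r.
Qed.

Lemma CintegrableB A f g : measurable A -> Cintegrable A f -> Cintegrable A g ->
  Cintegrable A (fun x => f x - g x).
Proof. by move=> mA iF iG; apply: CintegrableD => //; exact: CintegrableN. Qed.

Lemma CintB A f g : measurable A -> Cintegrable A f -> Cintegrable A g ->
  Cint A (fun x => f x - g x) = Cint A f - Cint A g.
Proof.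
move=> mA iF iG; rewrite CintD//; last exact: CintegrableN.
congr (_ + _); rewrite -mulN1r -CintZ//.
by apply: eq_Cint => x _; rewrite mulN1r.
Qed.

Lemma Cint_conj A f : measurable A -> Cintegrable A f ->
  Cint A (fun x => (f x)^*) = (Cint A f)^*.
Proof.
move=> mA [f1 f2]; apply: complex_eq; rewrite ?Re_conj ?Im_conj /=.
  by apply: eq_Rintegral => x _; rewrite Re_conj.
rewrite -mulN1r -RintegralZl//.
by apply: eq_Rintegral => x _; rewrite Im_conj mulN1r.
Qed.

(* The factor 2 saves a rotation argument and is harmless everywhere below. *)
Lemma nc_Cint_le A f : measurable A -> Cintegrable A f ->
  nc (Cint A f) <= 2 * \int[mu]_(x in A) nc (f x).
Proof.
move=> mA iF; have [f1 f2] := iF; have iN := integrable_nc mA iF.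
apply: (le_trans (nc_le_ReIm _)); rewrite mulr2n mulrDl mul1r /=.
by apply: lerD; apply: (le_trans (le_normr_Rintegral mA _)) => //;
  apply: le_Rintegral => //; try (exact: integrable_norm);
  move=> x _; rewrite ?Re_le_nc ?Im_le_nc.
Qed.

Lemma nc_Cint_lee A f : measurable A -> Cintegrable A f ->
  ((nc (Cint A f))%:E <= 2%:E * \int[mu]_(x in A) (nc (f x))%:E)%E.
Proof.
move=> mA iF; have := nc_Cint_le mA iF; rewrite -lee_fin EFinM /Rintegral fineK//.
exact: integrable_fin_num (integrable_nc mA iF).
Qed.

Lemma Cint_cst A c : measurable A -> Cint A (fun=> c) = c * (fine (mu A))%:C.
Proof.
by move=> mA; apply: complex_eq; rewrite /Cint /= Rintegral_cst// ?ReM ?ImM /=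
  ?mulr0 ?subr0 ?add0r.
Qed.

Lemma Cint_sum A I (s : seq I) (F : I -> T -> R[i]) : measurable A ->
  (forall i, Cintegrable A (F i)) ->
  Cintegrable A (fun x => \sum_(i <- s) F i x) /\
  Cint A (fun x => \sum_(i <- s) F i x) = \sum_(i <- s) Cint A (F i).
Proof.
move=> mA iF; elim: s => [|i s [ih1 ih2]].
  rewrite big_nil; under eq_fun do rewrite big_nil.
  split; first by split; apply: eq_integrable (integrable0 _ _).
  by apply: complex_eq; rewrite /Cint /= Rintegral_cst// mul0r.
rewrite big_cons -ih2; under eq_fun do rewrite big_cons.
by split; [exact: CintegrableD|rewrite CintD].
Qed.

End Cintegral.

(** * Bisection of the unit square *)

Section bisection.
Context {R : realType}.

Lemma sup_nested_itv (u v : nat -> R) :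
  (forall n, u n <= u n.+1) -> (forall n, v n.+1 <= v n) -> (forall n, u n <= v n) ->
  exists x, forall n, u n <= x <= v n.
Proof.
move=> u_incr v_decr uv.
have uvmn m n : u m <= v n.
  have um k : u m <= u (m + k)%N.
    by elim: k => [|k ih]; rewrite ?addn0// addnS (le_trans ih).
  have vn k : v (n + k)%N <= v n.
    by elim: k => [|k ih]; rewrite ?addn0// addnS (le_trans (v_decr _)).
  by rewrite (le_trans (um n))// (le_trans (uv _))// addnC vn.
exists (sup (range u)) => n; apply/andP; split.
  apply: ub_le_sup; last by exists n.
  by exists (v 0%N) => _ [m _ <-].
by apply: ge_sup; [exists (u 0%N), 0%N|move=> _ [m _ <-]].
Qed.

(** If the property failed for the unit square, it would fail for one quarter of it, then for a
    quarter of that, and so on. The failing squares shrink to a point, around which the local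
    hypothesis contradicts their failure. *)
Lemma bisect_square (P : R -> R -> R -> Prop) :
  (forall x y l, 0 < l -> 0 <= x -> x + l <= 1 -> 0 <= y -> y + l <= 1 ->
     P x y (l / 2) -> P (x + l / 2) y (l / 2) ->
     P x (y + l / 2) (l / 2) -> P (x + l / 2) (y + l / 2) (l / 2) -> P x y l) ->
  (forall x0 y0, 0 <= x0 <= 1 -> 0 <= y0 <= 1 -> exists2 d, 0 < d &
     forall x y l, 0 < l < d -> 0 <= x <= x0 -> x0 <= x + l <= 1 ->
       0 <= y <= y0 -> y0 <= y + l <= 1 -> P x y l) ->
  P 0 0 1.
Proof.
move=> Psub Ploc; apply: contrapT => nP.
pose good (s : R * R * R) := [/\ 0 < s.2, 0 <= s.1.1, s.1.1 + s.2 <= 1,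
  0 <= s.1.2 & s.1.2 + s.2 <= 1] /\ ~ P s.1.1 s.1.2 s.2.
pose next (s s' : R * R * R) := good s -> [/\ good s', s'.2 = s.2 / 2,
  s.1.1 <= s'.1.1 /\ s'.1.1 + s'.2 <= s.1.1 + s.2 &
  s.1.2 <= s'.1.2 /\ s'.1.2 + s'.2 <= s.1.2 + s.2].
(* A failing square has a failing quarter. The guard [good s] inside [next] lets the choice function
   be total, so that it can be iterated. *)
have [f fP] : {f & forall s, next s (f s)}.
  apply: choice => -[[x y] l].
  have [g|/asboolP ng] := pselect (good (x, y, l)); last first.
    by exists (x, y, l) => g; exfalso; move/asboolP: ng; exact.
  have [[/= l0 x0 x1 y0 y1] nPs] := g.
  have [c1|c1] := pselect (P x y (l / 2)); last first.
    by exists (x, y, l / 2) => _; do !split => //=; clear - l0 x0 x1 y0 y1; lra.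
  have [c2|c2] := pselect (P (x + l / 2) y (l / 2)); last first.
    by exists (x + l / 2, y, l / 2) => _; do !split => //=; clear - l0 x0 x1 y0 y1; lra.
  have [c3|c3] := pselect (P x (y + l / 2) (l / 2)); last first.
    by exists (x, y + l / 2, l / 2) => _; do !split => //=; clear - l0 x0 x1 y0 y1; lra.
  have [c4|c4] := pselect (P (x + l / 2) (y + l / 2) (l / 2)); last first.
    by exists (x + l / 2, y + l / 2, l / 2) => _; do !split => //=; clear - l0 x0 x1 y0 y1; lra.
  by exfalso; apply: nPs; exact: Psub.
pose s n := iter n f (0, 0, 1).
have gs n : good (s n).
  elim: n => [|n ih]; last by rewrite /s iterS; have [] := fP _ ih.
  by split => //=; split => //=; lra.
have l2 n : (s n).2 = 2^-1 ^+ n.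
  elim: n => [|n ih]; first by rewrite expr0.
  by have [_ + _ _] := fP _ (gs n); rewrite [s n.+1]iterS => ->; rewrite ih exprSr.
have [x0 hx] : exists x, forall n, (s n).1.1 <= x <= (s n).1.1 + (s n).2.
  apply: sup_nested_itv => n.
  - by have [_ _ []] := fP _ (gs n).
  - by have [_ _ []] := fP _ (gs n).
  - by have [[l0 _ _ _ _] _] := gs n; rewrite lerDl ltW.
have [y0 hy] : exists y, forall n, (s n).1.2 <= y <= (s n).1.2 + (s n).2.
  apply: sup_nested_itv => n.
  - by have [_ _ _ []] := fP _ (gs n).
  - by have [_ _ _ []] := fP _ (gs n).
  - by have [[l0 _ _ _ _] _] := gs n; rewrite lerDl ltW.
have [||d d0 dP] := Ploc x0 y0.
- by have := hx 0%N; rewrite /= add0r.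
- by have := hy 0%N; rewrite /= add0r.
have [n nd] : exists n, 2^-1 ^+ n < d.
  have : (2^-1 : R) ^+ n @[n --> \oo] --> (0 : R).
    by apply: cvg_expr; rewrite ger0_norm ?invr_ge0 ?ler0n// invf_lt1 ?ltr0n// ltr1n.
  by move=> /cvgrPdist_lt/(_ d d0)[N _ /(_ N)/= /(_ (leqnn _))];
    rewrite sub0r normrN ger0_norm ?exprn_ge0 ?invr_ge0 ?ler0n//; exists N.
have [[l0 x1 x2 y1 y2] nPn] := gs n.
have /andP[hx1 hx2] := hx n; have /andP[hy1 hy2] := hy n.
by apply: nPn; apply: dP; apply/andP; split => //; rewrite l2.
Qed.

End bisection.

(** * Complex derivatives by first-order expansions *)

Section cderiv.
Context {R : realType}.
Implicit Types (f g : R[i] -> R[i]) (z w l : R[i]).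

(** The expansion replaces the difference quotient: it makes sense at [w = z], and algebraic rules
    reduce to estimates of remainders. *)
Definition cderiv f z l := forall e : R, 0 < e -> exists2 d : R, 0 < d &
  forall w, nc (w - z) < d -> nc (f w - f z - l * (w - z)) <= e * nc (w - z).

Definition ccontinuous_at f z := forall e : R, 0 < e -> exists2 d : R, 0 < d &
  forall w, nc (w - z) < d -> nc (f w - f z) < e.

Lemma cderiv_cst c z : cderiv (fun=> c) z 0.
Proof.
by move=> e e0; exists 1 => // w _; rewrite subrr mul0r subr0 nc0 mulr_ge0 ?nc_ge0// ltW.
Qed.

Lemma cderiv_id z : cderiv id z 1.
Proof.
by move=> e e0; exists 1 => // w _; rewrite mul1r subrr nc0 mulr_ge0 ?nc_ge0// ltW.
Qed.

Lemma cderiv_lipschitz f z l : cderiv f z l -> exists2 d : R, 0 < d &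
  forall w, nc (w - z) < d -> nc (f w - f z) <= (nc l + 1) * nc (w - z).
Proof.
move=> /(_ 1 ltr01)[d d0 H]; exists d => // w wd; have := H w wd.
have := nc_triangle (f w - f z - l * (w - z)) (l * (w - z)).
by rewrite subrK ncM; lra.
Qed.

Lemma cderiv_continuous f z l : cderiv f z l -> ccontinuous_at f z.
Proof.
move=> /cderiv_lipschitz[d d0 H] e e0.
have k0 : 0 < nc l + 1 by have := nc_ge0 l; lra.
exists (Num.min d (e / (nc l + 1))); first by rewrite lt_min d0 divr_gt0.
move=> w; rewrite lt_min => /andP[wd we]; apply: le_lt_trans (H w wd) _.
by rewrite mulrC -ltr_pdivlMr.
Qed.

Lemma cderivD f g z l m : cderiv f z l -> cderiv g z m ->
  cderiv (fun w => f w + g w) z (l + m).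
Proof.
move=> hf hg e e0; have e2 : 0 < e / 2 by lra.
have [d d0 H] := hf _ e2; have [d' d'0 H'] := hg _ e2.
exists (Num.min d d'); first by rewrite lt_min d0.
move=> w; rewrite lt_min => /andP[/H h1 /H' h2].
rewrite (_ : _ - _ = (f w - f z - l * (w - z)) + (g w - g z - m * (w - z))); last by ring.
by apply: (le_trans (nc_triangle _ _)); lra.
Qed.

Lemma cderivM f g z l m : cderiv f z l -> cderiv g z m ->
  cderiv (fun w => f w * g w) z (l * g z + f z * m).
Proof.
move=> hf hg e e0.
(* [A] adds up the coefficients of the three remainders of a product: the two first-order ones, and
   the product of increments, which is small because [w] is also taken within [e / A] of [z]. The
   final 1 keeps [A] positive. *)
pose A := nc (g z) + nc (f z) + (nc l + 1) * (nc m + 1) + 1.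
have A0 : 0 < A.
  have := nc_ge0 (g z); have := nc_ge0 (f z); have := nc_ge0 l; have := nc_ge0 m.
  by rewrite /A => ? ? ? ?; nra.
have eA : 0 < e / A by rewrite divr_gt0.
have [d d0 H] := hf _ eA; have [d' d'0 H'] := hg _ eA.
have [c c0 L] := cderiv_lipschitz hf; have [c' c'0 L'] := cderiv_lipschitz hg.
exists (Num.min (Num.min d d') (Num.min (Num.min c c') (e / A))); first by rewrite !lt_min d0 d'0 c0 c'0.
move=> w; rewrite !lt_min => /and3P[/andP[/H h1 /H' h2] /andP[/L l1 /L' l2] we].
rewrite (_ : _ - _ = (f w - f z - l * (w - z)) * g z + f z * (g w - g z - m * (w - z))
  + (f w - f z) * (g w - g z)); last by ring.
apply: (le_trans (nc_triangle _ _)); apply: (le_trans (lerD (nc_triangle _ _) (lexx _))).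
rewrite !ncM; set t := nc (w - z) in h1 h2 l1 l2 we *.
have t0 : 0 <= t by exact: nc_ge0.
have -> : e * t = e / A * t * nc (g z) + nc (f z) * (e / A * t) +
   (nc l + 1) * (nc m + 1) * (e / A * t) + e / A * t.
  by rewrite -[in LHS](divfK (lt0r_neq0 A0) e) {2}/A; ring.
have h3 : nc (f w - f z) * nc (g w - g z) <= (nc l + 1) * (nc m + 1) * (e / A * t).
  apply: (le_trans (ler_pM (nc_ge0 _) (nc_ge0 _) l1 l2)).
  rewrite mulrACA ler_wpM2l ?mulr_ge0 ?addr_ge0 ?nc_ge0//.
  by rewrite ler_wpM2r// ltW.
have : 0 <= e / A * t by rewrite mulr_ge0// ltW.
have := ler_wpM2r (nc_ge0 (g z)) h1; have := ler_wpM2l (nc_ge0 (f z)) h2.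
lra.
Qed.

Lemma cderivN f z l : cderiv f z l -> cderiv (fun w => - f w) z (- l).
Proof.
move=> hf; have := cderivM (cderiv_cst (-1) z) hf.
rewrite mul0r add0r mulN1r; congr (cderiv _ _ _).
by apply/funext => w; rewrite mulN1r.
Qed.

Lemma cderivB f g z l m : cderiv f z l -> cderiv g z m ->
  cderiv (fun w => f w - g w) z (l - m).
Proof. by move=> hf hg; apply: cderivD => //; exact: cderivN. Qed.

Lemma cderivZ c f z l : cderiv f z l -> cderiv (fun w => c * f w) z (c * l).
Proof.
by move=> hf; have := cderivM (cderiv_cst c z) hf; rewrite mul0r add0r.
Qed.

Lemma cderiv_inv z : z != 0 -> cderiv (fun w => w^-1) z (- z^-1 ^+ 2).
Proof.
move=> z0 e e0; have nz : 0 < nc z by rewrite nc_gt0.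
(* The first bound gives [|w| > |z| / 2]. The second makes the exact remainder [(w - z)^2 / (w z^2)]
   at most [e |w - z|]. *)
pose d := Num.min (nc z / 2) (e * nc z ^+ 3 / 2).
exists d; first by rewrite lt_min !divr_gt0// mulr_gt0// exprn_gt0.
move=> w; rewrite lt_min => /andP[w1 w2].
have nw : nc z / 2 < nc w by have := nc_lower z w; rewrite ncB; lra.
have w0 : w != 0 by rewrite -nc_gt0; lra.
rewrite (_ : _ - _ = (w - z) * (w - z) * (w^-1 * z^-1 ^+ 2)); last first.
  by field; rewrite z0 w0.
rewrite 3!ncM ncX !ncV mulrAC ler_wpM2r ?nc_ge0//.
have h : (nc w)^-1 <= 2 / nc z.
  by rewrite -[leRHS]invrK lef_pV2 ?posrE ?invr_gt0 ?divr_gt0// ?invf_div; lra.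
apply: (@le_trans _ _ ((e * nc z ^+ 3 / 2) * (2 / nc z * (nc z)^-1 ^+ 2))).
  apply: ler_pM.
  - exact: nc_ge0.
  - by rewrite mulr_ge0 ?exprn_ge0// invr_ge0 nc_ge0.
  - exact: ltW.
  - by rewrite ler_wpM2r// exprn_ge0// invr_ge0 nc_ge0.
by rewrite le_eqVlt; apply/orP; left; apply/eqP; field; rewrite gt_eqF.
Qed.

Lemma cderiv_comp f g z l m : cderiv f z l -> cderiv g (f z) m ->
  cderiv (fun w => g (f w)) z (m * l).
Proof.
move=> hf hg e e0; have [c c0 L] := cderiv_lipschitz hf.
have l0 := nc_ge0 l; have m0 := nc_ge0 m.
have e1 : 0 < e / (2 * (nc l + 1)) by rewrite divr_gt0// mulr_gt0//; lra.
have e2 : 0 < e / (2 * (nc m + 1)) by rewrite divr_gt0// mulr_gt0//; lra.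
have [d d0 H] := hg _ e1; have [d' d'0 H'] := hf _ e2.
exists (Num.min (Num.min c d') (d / (nc l + 1))).
  by rewrite !lt_min c0 d'0 divr_gt0//; lra.
move=> w; rewrite !lt_min => /andP[/andP[/L h1 /H' h2]] wd.
have fwd : nc (f w - f z) < d.
  by apply: (le_lt_trans h1); rewrite mulrC -ltr_pdivlMr//; lra.
have h3 := H _ fwd.
rewrite (_ : _ - _ = (g (f w) - g (f z) - m * (f w - f z)) + m * (f w - f z - l * (w - z))); last by ring.
apply: (le_trans (nc_triangle _ _)); rewrite ncM.
set t := nc (w - z) in h1 h2 wd *; have t0 : 0 <= t by exact: nc_ge0.
have h4 : nc (g (f w) - g (f z) - m * (f w - f z)) <= e / 2 * t.
  apply: (le_trans h3); apply: (le_trans (ler_wpM2l (ltW e1) h1)).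
  by rewrite mulrA le_eqVlt; apply/orP; left; apply/eqP; field; lra.
have h5 : nc m * nc (f w - f z - l * (w - z)) <= e / 2 * t.
  apply: (@le_trans _ _ ((nc m + 1) * (e / (2 * (nc m + 1)) * t))).
    by apply: ler_pM => //; rewrite ?nc_ge0//; lra.
  by rewrite mulrA le_eqVlt; apply/orP; left; apply/eqP; field; lra.
by lra.
Qed.

Lemma cderivV f z l : f z != 0 -> cderiv f z l ->
  cderiv (fun w => (f w)^-1) z (- (f z)^-1 ^+ 2 * l).
Proof. by move=> fz hf; apply: (cderiv_comp hf); exact: cderiv_inv. Qed.

End cderiv.

(** * Complex-valued functions of a real variable: derivatives, integrals, fundamental theorem *)

Section paths.
Context {R : realType}.
Local Notation leb := (@lebesgue_measure R).
Implicit Types (f g : R -> R[i]) (x a b : R).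

Definition pderiv f x (l : R[i]) :=
  is_derive x 1 (fun t => Re (f t)) (Re l) /\ is_derive x 1 (fun t => Im (f t)) (Im l).

Definition pcontinuous_at f x := forall e : R, 0 < e ->
  \forall t \near x, nc (f t - f x) < e.

Lemma pcontinuous_ReIm f x : pcontinuous_at f x ->
  {for x, continuous (fun t => Re (f t))} /\ {for x, continuous (fun t => Im (f t))}.
Proof.
move=> H; split; apply/cvgrPdist_lt => e e0; have := H e e0;
  apply: filterS => t; apply: le_lt_trans; rewrite distrC.
  by have := Re_le_nc (f t - f x); rewrite ReD ReN.
by have := Im_le_nc (f t - f x); rewrite ImD ImN.
Qed.

Lemma ReIm_pcontinuous f x : {for x, continuous (fun t => Re (f t))} ->
  {for x, continuous (fun t => Im (f t))} -> pcontinuous_at f x.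
Proof.
move=> /cvgrPdist_lt h1 /cvgrPdist_lt h2 e e0; have e2 : 0 < e / 2 by lra.
near=> t; apply: le_lt_trans (nc_le_ReIm _) _; rewrite ReD ReN ImD ImN.
have : `|Re (f x) - Re (f t)| < e / 2 by near: t; exact: h1.
have : `|Im (f x) - Im (f t)| < e / 2 by near: t; exact: h2.
by rewrite ![`|_ (f x) - _|]distrC; lra.
Unshelve. all: by end_near. Qed.

Lemma pderiv_continuous f x l : pderiv f x l -> pcontinuous_at f x.
Proof.
move=> [[d1 _] [d2 _]]; apply: ReIm_pcontinuous.
  exact: (differentiable_continuous (iffLR (derivable1_diffP _ _) d1)).
exact: (differentiable_continuous (iffLR (derivable1_diffP _ _) d2)).
Qed.

Lemma pcontinuous_cst (c : R[i]) x : pcontinuous_at (fun=> c) x.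
Proof. by move=> e e0; near=> t; rewrite subrr nc0. Unshelve. all: by end_near. Qed.

Lemma pcontinuousD f g x : pcontinuous_at f x -> pcontinuous_at g x ->
  pcontinuous_at (fun t => f t + g t) x.
Proof.
move=> hf hg e e0; have e2 : 0 < e / 2 by lra.
near=> t; rewrite (_ : _ - _ = (f t - f x) + (g t - g x)); last by ring.
apply: le_lt_trans (nc_triangle _ _) _.
have : nc (f t - f x) < e / 2 by near: t; exact: hf.
have : nc (g t - g x) < e / 2 by near: t; exact: hg.
by lra.
Unshelve. all: by end_near. Qed.

Lemma pcontinuousM f g x : pcontinuous_at f x -> pcontinuous_at g x ->
  pcontinuous_at (fun t => f t * g t) x.
Proof.
move=> /pcontinuous_ReIm[f1 f2] /pcontinuous_ReIm[g1 g2]; apply: ReIm_pcontinuous.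
  rewrite /prop_for/continuous_at ReM; under eq_fun do rewrite ReM.
  by apply: cvgB; apply: cvgM.
rewrite /prop_for/continuous_at ImM; under eq_fun do rewrite ImM.
by apply: cvgD; apply: cvgM.
Qed.

Lemma pcontinuousB f g x : pcontinuous_at f x -> pcontinuous_at g x ->
  pcontinuous_at (fun t => f t - g t) x.
Proof.
move=> hf hg; under eq_fun do rewrite -[X in _ + X]mulN1r.
by apply: pcontinuousD => //; apply: pcontinuousM => //; exact: pcontinuous_cst.
Qed.

Lemma pcontinuous_comp (k : R[i] -> R[i]) f x : pcontinuous_at f x ->
  ccontinuous_at k (f x) -> pcontinuous_at (fun t => k (f t)) x.
Proof.
move=> hf hk e e0; have [d d0 H] := hk e e0.
by have := hf d d0; apply: filterS => t /H.
Qed.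

Lemma pderiv_cst (c : R[i]) x : pderiv (fun=> c) x 0.
Proof. by split; apply: is_derive_eq. Qed.

Lemma pderivD f g x l m : pderiv f x l -> pderiv g x m ->
  pderiv (fun t => f t + g t) x (l + m).
Proof.
move=> [f1 f2] [g1 g2]; split.
  by under eq_fun do rewrite ReD; rewrite ReD; apply: is_deriveD.
by under eq_fun do rewrite ImD; rewrite ImD; apply: is_deriveD.
Qed.

Lemma pderivM f g x l m : pderiv f x l -> pderiv g x m ->
  pderiv (fun t => f t * g t) x (l * g x + f x * m).
Proof.
move=> [f1 f2] [g1 g2]; split.
  under eq_fun do rewrite ReM.
  apply: is_derive_eq; rewrite ReD !ReM /GRing.scale/=; ring.
under eq_fun do rewrite ImM.
apply: is_derive_eq; rewrite ImD !ImM /GRing.scale/=; ring.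
Qed.

Lemma pderivZ (c : R[i]) f x l : pderiv f x l -> pderiv (fun t => c * f t) x (c * l).
Proof.
by move=> hf; have := pderivM (pderiv_cst c x) hf; rewrite mul0r add0r.
Qed.

Lemma pderiv_real (r : R -> R) x l : is_derive x 1 r l -> pderiv (fun t => (r t)%:C) x l%:C.
Proof. by move=> h; split => //=; exact: is_derive_cst. Qed.

Lemma Cintegrable_itv f a b : {in `[a, b], forall x, pcontinuous_at f x} ->
  Cintegrable leb `[a, b] f.
Proof.
move=> cf; split; apply: continuous_compact_integrable; try exact: segment_compact.
  by apply: continuous_in_subspaceT => x; rewrite inE => /cf/pcontinuous_ReIm[].
by apply: continuous_in_subspaceT => x; rewrite inE => /cf/pcontinuous_ReIm[].
Qed.

Lemma Cint_itv_split f a b c : a <= b <= c -> {in `[a, c], forall x, pcontinuous_at f x} ->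
  Cint leb `[a, c] f = Cint leb `[a, b] f + Cint leb `[b, c] f.
Proof.
move=> /andP[ab bc] /Cintegrable_itv[f1 f2].
apply: complex_eq; rewrite ?ReD ?ImD /=.
  have := Rintegral_itvB f1 (x := b); rewrite !bnd_simp => /(_ ab bc).
  rewrite [in RHS]Rintegral_itv_obnd_cbnd; first lra.
  by apply: integrableS f1 => //; apply: subset_itvr; rewrite bnd_simp.
have := Rintegral_itvB f2 (x := b); rewrite !bnd_simp => /(_ ab bc).
rewrite [in RHS]Rintegral_itv_obnd_cbnd; first lra.
by apply: integrableS f2 => //; apply: subset_itvr; rewrite bnd_simp.
Qed.

Lemma FTC2_real (F f : R -> R) a b : a < b -> (forall x, x \in `[a, b] -> is_derive x 1 F (f x)) ->
  {in `[a, b], forall x, {for x, continuous f}} ->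
  \int[leb]_(x in `[a, b]) f x = F b - F a.
Proof.
move=> ab dF cf; rewrite /Rintegral (@continuous_FTC2 _ f F a b)//.
- by apply: continuous_in_subspaceT => x; rewrite inE => /cf.
- have cF x : x \in `[a, b] -> {for x, continuous F}.
    move=> /dF[dFx _]; apply: differentiable_continuous.
    by apply/derivable1_diffP.
  split.
  + by move=> x /subset_itv_oo_cc/dF[].
  + by apply: cvg_at_right_filter; apply: cF; rewrite in_itv/= lexx ltW.
  + by apply: cvg_at_left_filter; apply: cF; rewrite in_itv/= lexx ltW.
- by move=> x /subset_itv_oo_cc/dF[_ <-]; rewrite derive1E.
Qed.

Lemma Cint_FTC F f a b : a < b -> {in `[a, b], forall x, pderiv F x (f x)} ->
  {in `[a, b], forall x, pcontinuous_at f x} ->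
  Cint leb `[a, b] f = F b - F a.
Proof.
move=> ab dF cf; apply: complex_eq; rewrite ?ReD ?ImD ?ReN ?ImN /=.
  apply: (FTC2_real (F := fun x => Re (F x))) => //.
    by move=> x /dF[].
  by move=> x /cf/pcontinuous_ReIm[].
apply: (FTC2_real (F := fun x => Im (F x))) => //.
  by move=> x /dF[].
by move=> x /cf/pcontinuous_ReIm[].
Qed.

Lemma Cint_itv_bound f a b M : a <= b -> {in `[a, b], forall x, pcontinuous_at f x} ->
  {in `[a, b], forall x, nc (f x) <= M} ->
  nc (Cint leb `[a, b] f) <= 2 * (M * (b - a)).
Proof.
move=> ab cf fM; have iF := Cintegrable_itv cf.
apply: (le_trans (nc_Cint_le _ iF)) => //; rewrite ler_pM2l//.
have -> : M * (b - a) = \int[leb]_(x in `[a, b]) M.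
  rewrite Rintegral_cst//= lebesgue_measure_itv/= lte_fin.
  have [//|ba] := ltP a b; have -> : a = b by apply/eqP; rewrite eq_le ab.
  by rewrite subrr !mulr0.
apply: le_Rintegral => //.
- exact: integrable_nc.
- apply: continuous_compact_integrable; first exact: segment_compact.
  by apply: continuous_subspaceT => x; exact: cvg_cst.
Qed.

(* Subtracting the affine part of [k], whose integral is exact, leaves the remainder. *)
Lemma side_estimate (k : R[i] -> R[i]) f f' a b (al be z0 : R[i]) eta M :
  a < b -> {in `[a, b], forall x, pderiv f x (f' x)} ->
  {in `[a, b], forall x, pcontinuous_at f' x} ->
  {in `[a, b], forall x, ccontinuous_at k (f x)} ->
  {in `[a, b], forall x, nc (k (f x) - al - be * (f x - z0)) <= eta} ->
  {in `[a, b], forall x, nc (f' x) <= M} ->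
  nc (Cint leb `[a, b] (fun x => k (f x) * f' x) -
      ((al * f b + be * (f b - z0) ^+ 2 / 2) - (al * f a + be * (f a - z0) ^+ 2 / 2)))
    <= 2 * (eta * M * (b - a)).
Proof.
move=> ab df cf' ck keta fM.
have cf x : x \in `[a, b] -> pcontinuous_at f x by move=> /df/pderiv_continuous.
pose P x := al * f x + be * (f x - z0) ^+ 2 / 2.
pose P' x := (al + be * (f x - z0)) * f' x.
have cP' : {in `[a, b], forall x, pcontinuous_at P' x}.
  move=> x xab; apply: pcontinuousM; last exact: cf'.
  apply: pcontinuousD; first exact: pcontinuous_cst.
  apply: pcontinuousM; first exact: pcontinuous_cst.
  by apply: pcontinuousB; [exact: cf|exact: pcontinuous_cst].
have ckf : {in `[a, b], forall x, pcontinuous_at (fun x => k (f x) * f' x) x}.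
  move=> x xab; apply: pcontinuousM; last exact: cf'.
  by apply: pcontinuous_comp; [exact: cf|exact: ck].
have -> : al * f b + be * (f b - z0) ^+ 2 / 2 - (al * f a + be * (f a - z0) ^+ 2 / 2) =
    Cint leb `[a, b] P'.
  rewrite (@Cint_FTC P P')// => x xab.
  have d0 := df x xab; have d1 := pderivD d0 (pderiv_cst (- z0) x).
  have := pderivD (pderivZ al d0) (pderivZ (be / 2) (pderivM d1 d1)).
  rewrite addr0; set Q := (fun _ => _); set q := (_ + _ : R[i]).
  have -> : Q = P by apply/funext => y; rewrite /Q /P; field.
  by have -> : q = P' x by rewrite /q /P'; field.
rewrite -CintB//; [|exact: Cintegrable_itv..].
apply: Cint_itv_bound; first exact: ltW.
  by move=> x xab; apply: pcontinuousB; [exact: ckf|exact: cP'].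
move=> x xab; rewrite /P' -mulrBl opprD addrA ncM.
by apply: ler_pM; rewrite ?nc_ge0 ?keta ?fM.
Qed.

End paths.

(** * Goursat's theorem on a parametrized square *)

Section goursat.
Context {R : realType}.
Local Notation leb := (@lebesgue_measure R).
Variables (gam gam1 gam2 : R -> R -> R[i]) (k : R[i] -> R[i]) (M : R).
Hypothesis dgam1 : forall t u, pderiv (gam^~ u) t (gam1 t u).
Hypothesis dgam2 : forall t u, pderiv (gam t) u (gam2 t u).
Hypothesis cgam1 : forall t u, pcontinuous_at (gam1^~ u) t.
Hypothesis cgam2 : forall t u, pcontinuous_at (gam2 t) u.
Hypothesis M0 : 0 < M.
Hypothesis bgam : forall t u, 0 <= t <= 1 -> 0 <= u <= 1 ->
  nc (gam1 t u) <= M /\ nc (gam2 t u) <= M.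
Hypothesis lgam : forall t u t' u', 0 <= t <= 1 -> 0 <= u <= 1 ->
  0 <= t' <= 1 -> 0 <= u' <= 1 ->
  nc (gam t u - gam t' u') <= M * (`|t - t'| + `|u - u'|).
Hypothesis dk : forall t u, 0 <= t <= 1 -> 0 <= u <= 1 -> exists l, cderiv k (gam t u) l.

Let hside u a b := Cint leb `[a, b] (fun t => k (gam t u) * gam1 t u).
Let vside t a b := Cint leb `[a, b] (fun u => k (gam t u) * gam2 t u).
Let loop x y l := hside y x (x + l) + vside (x + l) y (y + l)
  - hside (y + l) x (x + l) - vside x y (y + l).

Let hside_cont u t : 0 <= t <= 1 -> 0 <= u <= 1 ->
  pcontinuous_at (fun t => k (gam t u) * gam1 t u) t.
Proof.
move=> t01 u01; apply: pcontinuousM => //.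
have [l dkl] := dk t01 u01.
apply: pcontinuous_comp; first exact: pderiv_continuous (dgam1 _ _).
exact: cderiv_continuous dkl.
Qed.

Let vside_cont t u : 0 <= t <= 1 -> 0 <= u <= 1 ->
  pcontinuous_at (fun u => k (gam t u) * gam2 t u) u.
Proof.
move=> t01 u01; apply: pcontinuousM => //.
have [l dkl] := dk t01 u01.
apply: pcontinuous_comp; first exact: pderiv_continuous (dgam2 _ _).
exact: cderiv_continuous dkl.
Qed.

Let loop_sub x y l : 0 < l -> 0 <= x -> x + l <= 1 -> 0 <= y -> y + l <= 1 ->
  loop x y l = loop x y (l / 2) + loop (x + l / 2) y (l / 2) +
    loop x (y + l / 2) (l / 2) + loop (x + l / 2) (y + l / 2) (l / 2).
Proof.
move=> l0 x0 x1 y0 y1; rewrite /loop.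
have -> : x + l / 2 + l / 2 = x + l by field.
have -> : y + l / 2 + l / 2 = y + l by field.
have hs u : 0 <= u <= 1 -> hside u x (x + l) = hside u x (x + l / 2) + hside u (x + l / 2) (x + l).
  move=> u01; apply: Cint_itv_split; first lra.
  by move=> t; rewrite in_itv/= => ht; apply: hside_cont => //; lra.
have vs t : 0 <= t <= 1 -> vside t y (y + l) = vside t y (y + l / 2) + vside t (y + l / 2) (y + l).
  move=> t01; apply: Cint_itv_split; first lra.
  by move=> u; rewrite in_itv/= => hu; apply: vside_cont => //; lra.
rewrite (hs y) ?(hs (y + l)) ?(vs x) ?(vs (x + l)); [ring|lra..].
Qed.

Let loop_local x0 y0 e : 0 < e -> 0 <= x0 <= 1 -> 0 <= y0 <= 1 ->
  exists2 d, 0 < d & forall x y l, 0 < l < d -> 0 <= x <= x0 -> x0 <= x + l <= 1 ->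
    0 <= y <= y0 -> y0 <= y + l <= 1 -> nc (loop x y l) <= e * l ^+ 2.
Proof.
move=> e0 x01 y01; have [be dkb] := dk x01 y01.
(* The image of a square of side [l] lies within [2 M l] of [z0], each side is traversed with speed
   at most [M], and the integral bound costs a factor 2. The constant 16 leaves [e / 4 * l ^ 2] for
   each of the four sides. *)
have e1 : 0 < e / (16 * M ^+ 2) by rewrite divr_gt0// mulr_gt0// exprn_gt0.
have [d d0 H] := dkb _ e1.
exists (d / (2 * M)); first by rewrite divr_gt0// mulr_gt0.
move=> x y l /andP[l0]; rewrite ltr_pdivlMr ?mulr_gt0// => ld hx1 hx2 hy1 hy2.
set z0 := gam x0 y0 in dkb H; set al := k z0 in H.
pose eta := e / (16 * M ^+ 2) * (2 * M * l).
have near_ t u : x <= t <= x + l -> y <= u <= y + l ->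
    nc (k (gam t u) - al - be * (gam t u - z0)) <= eta.
  move=> ht hu; have h : nc (gam t u - z0) <= 2 * M * l.
    apply: (le_trans (lgam _ _ _ _)); try lra.
    have : `|t - x0| <= l by rewrite ler_norml; lra.
    have : `|u - y0| <= l by rewrite ler_norml; lra.
    by move=> ? ?; have := ler_wpM2l (ltW M0) (lerD (_ : `|t - x0| <= l) (_ : `|u - y0| <= l));
       rewrite mulrDr; nra.
  have : nc (gam t u - z0) < d by apply: le_lt_trans h _; lra.
  by move=> /H h'; apply: le_trans h' _; rewrite ler_wpM2l// ltW.
pose P z := al * z + be * (z - z0) ^+ 2 / 2.
have eqe : 2 * (eta * M * l) = e / 4 * l ^+ 2.
  by rewrite /eta; field; rewrite gt_eqF.
have hs u : y <= u <= y + l ->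
    nc (hside u x (x + l) - (P (gam (x + l) u) - P (gam x u))) <= e / 4 * l ^+ 2.
  move=> hu; have := @side_estimate _ k (gam^~ u) (gam1^~ u) x (x + l) al be z0 eta M.
  rewrite (_ : x + l - x = l) ?eqe; last by ring.
  apply; rewrite ?ltrDl//.
  - by move=> t; rewrite in_itv/= => ht; have [||b hb] := @dk t u; [lra|lra|exact: cderiv_continuous hb].
  - by move=> t; rewrite in_itv/= => ht; exact: near_.
  - by move=> t; rewrite in_itv/= => ht; have [||b1 b2] := @bgam t u; lra.
have vs t : x <= t <= x + l ->
    nc (vside t y (y + l) - (P (gam t (y + l)) - P (gam t y))) <= e / 4 * l ^+ 2.
  move=> ht; have := @side_estimate _ k (gam t) (gam2 t) y (y + l) al be z0 eta M.
  rewrite (_ : y + l - y = l) ?eqe; last by ring.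
  apply; rewrite ?ltrDl//.
  - by move=> u; rewrite in_itv/= => hu; have [||b hb] := @dk t u; [lra|lra|exact: cderiv_continuous hb].
  - by move=> u; rewrite in_itv/= => hu; exact: near_.
  - by move=> u; rewrite in_itv/= => hu; have [||b1 b2] := @bgam t u; lra.
have l1 : y <= y <= y + l by lra.
have l2 : y <= y + l <= y + l by lra.
have l3 : x <= x <= x + l by lra.
have l4 : x <= x + l <= x + l by lra.
have := hs _ l1; have := hs _ l2; have := vs _ l3; have := vs _ l4.
set A := _ - (_ - _); set B := _ - (_ - _); set C := _ - (_ - _); set D := _ - (_ - _).
(* The corner values of the primitive [P] of the affine part cancel around the boundary, so only the
   four remainders are left. *)
move=> hA hB hC hD; have -> : loop x y l = D + A - C - B.
  by rewrite /loop /A /B /C /D; ring.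
have := nc_subadd (D + A - C) B; have := nc_subadd (D + A) C; have := nc_triangle D A.
lra.
Qed.

(** Boundary integrals add up under subdivision into four squares, and so do the bounds [e * l ^ 2].
    With the local estimate, bisection gives [|loop 0 0 1| <= e] for every [e]. Only
    differentiability of [k] at each point of the image is used, no continuity of its derivative. *)
Lemma goursat_square :
  Cint leb `[0, 1] (fun t => k (gam t 0) * gam1 t 0) +
  Cint leb `[0, 1] (fun u => k (gam 1 u) * gam2 1 u) =
  Cint leb `[0, 1] (fun t => k (gam t 1) * gam1 t 1) +
  Cint leb `[0, 1] (fun u => k (gam 0 u) * gam2 0 u).
Proof.
suff : nc (loop 0 0 1) = 0.
  move=> /eqP; rewrite nc_eq0 /loop /hside /vside !add0r => /eqP h.
  by apply/eqP; rewrite -subr_eq0 opprD addrA; apply/eqP.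
apply/eqP; rewrite eq_le nc_ge0 andbT; apply/ler_addgt0Pr => e e0; rewrite add0r.
have -> : e = e * 1 ^+ 2 by rewrite expr1n mulr1.
apply: (@bisect_square _ (fun x y l => nc (loop x y l) <= e * l ^+ 2)).
  move=> x y l l0 x0 x1 y0 y1 h1 h2 h3 h4; rewrite loop_sub//.
  apply: (le_trans (nc_triangle _ _)); apply: (le_trans (lerD (nc_triangle _ _) (lexx _))).
  apply: (le_trans (lerD (lerD (nc_triangle _ _) (lexx _)) (lexx _))).
  have -> : e * l ^+ 2 = e * (l / 2) ^+ 2 + e * (l / 2) ^+ 2 + e * (l / 2) ^+ 2 + e * (l / 2) ^+ 2.
    by field.
  exact: lerD (lerD (lerD h1 h2) h3) h4.
by move=> x0 y0 hx hy; exact: loop_local.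
Qed.

End goursat.

(** * Cauchy's formula and mean values on circles *)

Section circle.
Context {R : realType}.
Local Notation leb := (@lebesgue_measure R).

(** This is [exp (2 pi i u)]. Parametrizing by the unit interval makes integrals over the circle
    averages, without a factor [2 pi]. *)
Definition ecirc (u : R) : R[i] := cos (pi *+ 2 * u) +i* sin (pi *+ 2 * u).

Lemma nc_ecirc u : nc (ecirc u) = 1.
Proof. by rewrite /= cos2Dsin2 sqrtr1. Qed.

Lemma ecirc0 : ecirc 0 = 1.
Proof. by rewrite /ecirc mulr0 cos0 sin0. Qed.

Lemma ecirc1 : ecirc 1 = 1.
Proof. by rewrite /ecirc mulr1 cos2pi sin2pi. Qed.

Lemma ecirc_neq0 u : ecirc u != 0.
Proof. by rewrite -nc_eq0 nc_ecirc oner_eq0. Qed.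

Lemma pderiv_ecirc u : pderiv ecirc u ((0 +i* (pi *+ 2)) * ecirc u).
Proof.
have h : is_derive u 1 (fun v : R => pi *+ 2 * v) (pi *+ 2).
  by apply: is_derive_eq; rewrite /GRing.scale/=; ring.
split.
  have := @is_derive1_comp _ cos (fun v => pi *+ 2 * v) u _ _ (is_derive_cos _) h.
  by rewrite /= mul0r sub0r mulrC mulrN.
have := @is_derive1_comp _ sin (fun v => pi *+ 2 * v) u _ _ (is_derive_sin _) h.
by rewrite /= mul0r add0r mulrC.
Qed.

Lemma pcontinuous_ecirc u : pcontinuous_at ecirc u.
Proof. exact: pderiv_continuous (pderiv_ecirc u). Qed.

(** The constant is twice the speed [2 pi], because the bound for complex integrals carries a factor
    2. *)
Lemma ecirc_lipschitz u v : nc (ecirc u - ecirc v) <= pi *+ 4 * `|u - v|.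
Proof.
wlog vu : u v / v <= u.
  move=> H; have [/H//|/ltW/H] := leP v u.
  by rewrite ncB distrC.
move: vu; rewrite le_eqVlt => /predU1P[->|vu]; first by rewrite !subrr nc0 normr0 mulr0.
rewrite -(@Cint_FTC _ ecirc (fun w => (0 +i* (pi *+ 2)) * ecirc w))//; last 2 first.
- by move=> x _; exact: pderiv_ecirc.
- by move=> x _; apply: pcontinuousM; [exact: pcontinuous_cst|exact: pcontinuous_ecirc].
apply: le_trans (Cint_itv_bound (M := pi *+ 2) (ltW vu) _ _) _.
- by move=> x _; apply: pcontinuousM; [exact: pcontinuous_cst|exact: pcontinuous_ecirc].
- move=> x _; rewrite ncM nc_ecirc mulr1 /= expr0n/= add0r sqrtr_sqr ger0_norm//.
  by rewrite mulrn_wge0// pi_ge0.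
by rewrite ger0_norm ?subr_ge0 ?(ltW vu)// mulrA mulr_natl -mulrnA.
Qed.

Definition cholomorphic (h : R[i] -> R[i]) := forall w, nc w < 1 -> exists l, cderiv h w l.

Section homotopy.
Variables (h : R[i] -> R[i]) (z z0 : R[i]).
Hypothesis hh : cholomorphic h.
Hypothesis z1 : nc z < 1.
Hypothesis z01 : nc z0 < nc z.

Let e (u : R) : R[i] := ecirc u * z.
Let nce u : nc (e u) = nc z. Proof. by rewrite ncM nc_ecirc mul1r. Qed.
Let ez0 u : nc z - nc z0 <= nc (e u - z0).
Proof. by apply: le_trans (nc_lower _ _); rewrite nce. Qed.
Let ez0' u : e u - z0 != 0.
Proof. by rewrite -nc_gt0; apply: lt_le_trans (ez0 u); rewrite subr_gt0. Qed.
Let e_cont u : pcontinuous_at e u.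
Proof. by apply: pcontinuousM; [exact: pcontinuous_ecirc|exact: pcontinuous_cst]. Qed.

Let q (u : R) : R[i] := e u / (e u - z0).
Let q_cont u : pcontinuous_at q u.
Proof.
apply: pcontinuousM => //.
apply: (@pcontinuous_comp _ (fun w => w^-1) (fun u => e u - z0)).
  by apply: pcontinuousB => //; exact: pcontinuous_cst.
by apply: cderiv_continuous; exact: cderiv_inv.
Qed.

Let pt (tau u : R) : R[i] := z0 + tau%:C * (e u - z0).

Let pt_lt1 (tau u : R) : 0 <= tau <= 1 -> nc (pt tau u) < 1.
Proof.
have z1' := z1; have z01' := z01.
move=> /andP[t0 t1]; have -> : pt tau u = (1 - tau)%:C * z0 + tau%:C * e u.
  by rewrite /pt rmorphB rmorph1; ring.
apply: le_lt_trans (nc_triangle _ _) _; rewrite 2!ncM !nc_real nce.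
have -> : `|1 - tau| = 1 - tau by rewrite ger0_norm//; lra.
have -> : `|tau| = tau by rewrite ger0_norm.
have h1 : (1 - tau) * nc z0 <= (1 - tau) * nc z by apply: ler_wpM2l; lra.
by lra.
Qed.

(** The circle is contracted towards [z0] by [z0 + tau (e u - z0)], stopping at [tau0 > 0] so that
    [h w / (w - z0)] stays differentiable. The two sides [u = 0] and [u = 1] of the parameter square
    have the same image and cancel. On the other two the factor [tau] cancels between numerator and
    denominator, which leaves the same weight [q] on both. *)
Let homotopy (tau0 : R) : 0 < tau0 < 1 ->
  Cint leb `[0, 1] (fun u => h (e u) * q u) =
  Cint leb `[0, 1] (fun u => h (pt tau0 u) * q u).
Proof.
have z1' := z1; have z01' := z01.
move=> /andP[t0 t1].
pose tau (s : R) : R := tau0 + (1 - tau0) * s.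
have tau01 s : 0 <= s <= 1 -> tau0 <= tau s <= 1 by rewrite /tau; nra.
pose c : R[i] := 0 +i* (pi *+ 2).
have c0 : c != 0.
  by rewrite -nc_gt0 /c /= expr0n/= add0r sqrtr_sqr normr_gt0 mulrn_eq0/= gt_eqF ?pi_gt0.
have ncc : nc c = pi *+ 2.
  by rewrite /c /= expr0n/= add0r sqrtr_sqr ger0_norm// mulrn_wge0// pi_ge0.
pose gam (s u : R) : R[i] := pt (tau s) u.
pose gam1 (s u : R) : R[i] := (1 - tau0)%:C * (e u - z0).
pose gam2 (s u : R) : R[i] := (tau s)%:C * (c * e u).
pose k w := h w / (w - z0).
have ncez u : nc (e u - z0) <= 2.
  by apply: (le_trans (nc_subadd _ _)); rewrite nce; lra.
have pip := pi_gt0 R.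
have pi2E : pi *+ 2 = 2 * pi :> R by rewrite mulr_natl.
have pi4E : pi *+ 4 = 4 * pi :> R by rewrite mulr_natl.
have ne2 u : nc (c * e u) <= pi *+ 2.
  rewrite ncM nce ncc; have := nc_ge0 z; rewrite -mulr_natl; nra.
have lip u v : nc (e u - e v) <= pi *+ 4 * `|u - v|.
  rewrite /e -mulrBl ncM; apply: (le_trans _ (ecirc_lipschitz u v)).
  by rewrite ler_piMr ?nc_ge0// ltW.
(* One constant for all bounds: 2 covers the derivative in [s], [2 pi] the one in [u], and
   [4 pi + 2] dominates both Lipschitz coefficients. *)
have M0 : 0 < pi *+ 4 + 2 :> R by rewrite -mulr_natl; lra.
have := @goursat_square _ gam gam1 gam2 k (pi *+ 4 + 2) _ _ _ _ M0 _ _ _.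
have -> : (fun t => k (gam t 1) * gam1 t 1) = (fun t => k (gam t 0) * gam1 t 0).
  by rewrite /gam /gam1 /pt /e ecirc0 ecirc1.
have ptz s u : 0 <= s <= 1 -> pt (tau s) u - z0 != 0.
  move=> s01; rewrite /pt addrAC subrr add0r mulf_neq0// -nc_gt0 nc_real normr_gt0.
  by have := tau01 s s01; lra.
have vs s : 0 <= s <= 1 -> Cint leb `[0, 1] (fun u => k (gam s u) * gam2 s u) =
    c * Cint leb `[0, 1] (fun u => h (pt (tau s) u) * q u).
  move=> s01; rewrite -CintZ//; last first.
    apply: Cintegrable_itv => u _; apply: pcontinuousM => //.
    apply: (@pcontinuous_comp _ h (pt (tau s))).
      apply: pcontinuousD; first exact: pcontinuous_cst.
      apply: pcontinuousM; first exact: pcontinuous_cst.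
      by apply: pcontinuousB => //; exact: pcontinuous_cst.
    have [|l hl] := hh (pt_lt1 u (_ : 0 <= tau s <= 1)); first by have := tau01 s s01; lra.
    exact: cderiv_continuous hl.
  apply: eq_Cint => u _; rewrite /k /gam /gam2 /q.
  have := ptz s u s01; rewrite /pt addrAC subrr add0r => p0.
  have ts : (tau s)%:C != 0 by move: p0; rewrite mulf_eq0 negb_or => /andP[].
  by field; rewrite ez0' ts.
rewrite !vs ?lexx ?ler01//.
have -> : tau 1 = 1 by rewrite /tau; ring.
have -> : tau 0 = tau0 by rewrite /tau; ring.
have -> : pt 1 = e by apply/funext => u; rewrite /pt mul1r; ring.
move=> H; apply: (mulfI c0); apply: (addrI (Cint leb `[0, 1] (fun t => k (gam t 0) * gam1 t 0))).
apply: H.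
- move=> t u; rewrite /gam /gam1 /pt.
  have d : is_derive t 1 tau (1 - tau0).
    by apply: is_derive_eq; rewrite /GRing.scale/=; ring.
  have := pderivD (pderiv_cst z0 t) (pderivM (pderiv_real d) (pderiv_cst (e u - z0) t)).
  by rewrite add0r mulr0 addr0.
- move=> t u; rewrite /gam /gam2 /pt.
  have := pderivD (pderiv_cst z0 u) (pderivZ (tau t)%:C (pderivD
    (pderivM (pderiv_ecirc u) (pderiv_cst z u)) (pderiv_cst (- z0) u))).
  by rewrite add0r mulr0 !addr0 -[_ * ecirc u * z]mulrA.
- by move=> t u; exact: pcontinuous_cst.
- move=> t u; apply: pcontinuousM; first exact: pcontinuous_cst.
  by apply: pcontinuousM => //; exact: pcontinuous_cst.
- move=> t u t01 u01; split.
    rewrite ncM nc_real ger0_norm; last lra.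
    apply: (@le_trans _ _ (1 * 2)); last by rewrite pi4E; lra.
    by apply: ler_pM; rewrite ?nc_ge0//; lra.
  rewrite ncM nc_real ger0_norm; last by have := tau01 t t01; lra.
  apply: (@le_trans _ _ (1 * pi *+ 2)); last by rewrite mul1r pi2E pi4E; lra.
  have := tau01 t t01; have := ne2 u => ? ?.
  by rewrite -mulrnAr; apply: ler_pM; rewrite ?nc_ge0//; lra.
- move=> t u t' u' t01 u01 t01' u01'.
  have -> : gam t u - gam t' u' = (1 - tau0)%:C * (t - t')%:C * (e u - z0) + (tau t')%:C * (e u - e u').
    rewrite /gam /pt -!rmorphM/= -[X in X * (e u - z0)]/((_)%:C).
    have -> : (1 - tau0) * (t - t') = tau t - tau t' by rewrite /tau; ring.
    by rewrite rmorphB/=; ring.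
  apply: (le_trans (nc_triangle _ _)); rewrite !ncM !nc_real mulrDr.
  have h1 : `|1 - tau0| <= 1 by rewrite ger0_norm; lra.
  have h2 : `|tau t'| <= 1 by rewrite ger0_norm; have := tau01 t' t01'; lra.
  have := lip u u'; have := ncez u; have := nc_ge0 (e u - z0); have := nc_ge0 (e u - e u').
  have := normr_ge0 (t - t'); have := normr_ge0 (u - u').
  rewrite pi4E.
  move=> A1 A2 A3 A4 A5 A6; apply: lerD.
    apply: (@le_trans _ _ (1 * `|t - t'| * 2)).
      by apply: ler_pM => //; rewrite ?mulr_ge0//; apply: ler_pM.
    by rewrite mul1r mulrC ler_wpM2r//; lra.
  apply: (@le_trans _ _ (1 * (4 * pi * `|u - u'|))); first by apply: ler_pM.
  by rewrite mul1r ler_wpM2r//; lra.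
- move=> t u t01 u01; have [|l hl] := hh (pt_lt1 u (_ : 0 <= tau t <= 1)).
    by have := tau01 t t01; lra.
  have d := cderiv_inv (ptz t u t01).
  have d2 := cderiv_comp (cderivB (cderiv_id (pt (tau t) u)) (cderiv_cst z0 _)) d.
  by eexists; exact: cderivM hl d2.
Qed.

(** As the contracted circle shrinks, [h] along it tends to [h z0] while the weight [q] is
    unchanged. The mean of [q] is deliberately left unevaluated: it is trivial for [z0 = 0], which
    gives the mean value property, and that property is what evaluates it in the general case. *)
Lemma cauchy_mean_aux : Cint leb `[0, 1] (fun u => h (ecirc u * z) * (ecirc u * z / (ecirc u * z - z0))) =
  h z0 * Cint leb `[0, 1] (fun u => ecirc u * z / (ecirc u * z - z0)).
Proof.
have z1' := z1; have z01' := z01.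
apply/eqP; rewrite -subr_eq0 -nc_eq0 eq_le nc_ge0 andbT.
apply/ler_addgt0Pr => eps eps0; rewrite add0r.
pose A := nc z / (nc z - nc z0).
have A0 : 0 < A by rewrite divr_gt0//; have := nc_ge0 z0; lra.
have qA u : nc (q u) <= A.
  rewrite ncM ncV nce ler_wpM2l ?nc_ge0// lef_pV2 ?posrE//; last lra.
  by rewrite nc_gt0.
have z0d : nc z0 < 1 by lra.
have [l /cderiv_continuous hl] := hh z0d.
have e2 : 0 < eps / (2 * A) by rewrite divr_gt0// mulr_gt0.
have [d d0 H] := hl _ e2.
(* Points of the contracted circle are within [2 * tau0 < d] of [z0]; the bound 1/2 keeps [tau0]
   below 1. *)
pose tau0 := Num.min (2^-1) (d / 4).
have t0 : 0 < tau0 < 1.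
  rewrite lt_min gt_min invr_gt0 ltr0n (divr_gt0 d0)//=.
  by apply/orP; left; rewrite invf_lt1 ?ltr0n// ltr1n.
have td : tau0 * 2 < d.
  have : tau0 <= d / 4 by rewrite ge_min lexx orbT.
  by lra.
rewrite (homotopy t0) -CintZ//; last by apply: Cintegrable_itv => u _; exact: q_cont.
have cpt u : pcontinuous_at (fun u => h (pt tau0 u)) u.
  apply: (@pcontinuous_comp _ h (pt tau0)).
    apply: pcontinuousD; first exact: pcontinuous_cst.
    apply: pcontinuousM; first exact: pcontinuous_cst.
    by apply: pcontinuousB => //; exact: pcontinuous_cst.
  have [|m hm] := hh (pt_lt1 u (_ : 0 <= tau0 <= 1)); first lra.
  exact: cderiv_continuous hm.
rewrite -CintB//; last 2 first.
- by apply: Cintegrable_itv => u _; apply: pcontinuousM.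
- by apply: Cintegrable_itv => u _; apply: pcontinuousM => //; exact: pcontinuous_cst.
apply: (le_trans (Cint_itv_bound (M := eps / (2 * A) * A) ler01 _ _)).
- move=> u _; apply: pcontinuousB; apply: pcontinuousM => //; exact: pcontinuous_cst.
- move=> u _; rewrite -mulrBl ncM; apply: ler_pM; rewrite ?nc_ge0//.
  apply/ltW/H; rewrite /pt addrAC subrr add0r ncM nc_real gtr0_norm; last lra.
  apply: le_lt_trans td; rewrite ler_wpM2l//; first lra.
  by apply: (le_trans (nc_subadd _ _)); rewrite nce; lra.
by rewrite subr0 mulr1 le_eqVlt; apply/orP; left; apply/eqP; field; rewrite gt_eqF.
Qed.

End homotopy.

Lemma Cint_unit_cst (c : R[i]) : Cint leb `[0, 1] (fun=> c) = c.
Proof.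
rewrite Cint_cst//= lebesgue_measure_itv/= lte_fin ltr01/=.
by rewrite oppr0 addr0 rmorph1 mulr1.
Qed.

Lemma mean_value h z : cholomorphic h -> nc z < 1 ->
  Cint leb `[0, 1] (fun u => h (ecirc u * z)) = h 0.
Proof.
move=> hh z1; have [->|z0] := eqVneq z 0.
  by under eq_Cint do rewrite mulr0; rewrite Cint_unit_cst.
have z01 : nc 0 < nc z by rewrite nc0 nc_gt0.
have := cauchy_mean_aux hh z1 z01.
have E u : ecirc u * z / (ecirc u * z - 0) = 1.
  by rewrite subr0 divff// mulf_neq0// ecirc_neq0.
under eq_Cint do rewrite E mulr1.
by under [in RHS]eq_Cint do rewrite E; rewrite Cint_unit_cst mulr1.
Qed.

Lemma cderiv_affine_inv (x : R[i]) w : 1 - x * w != 0 ->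
  exists l, cderiv (fun w => (1 - x * w)^-1) w l.
Proof.
move=> xw; eexists; apply: (cderivV (f := fun w => 1 - x * w) xw).
exact: cderivB (cderiv_cst 1 w) (cderivZ x (cderiv_id w)).
Qed.

Lemma conj_affine_inv (x w : R[i]) : ((1 - x^* * w)^-1)^* = (1 - x * w^*)^-1.
Proof.
rewrite conjc_inv; congr (_^-1); case: x w => [a b] [c d].
by apply: complex_eq => /=; ring.
Qed.

Lemma one_sub_neq0 (v : R[i]) : nc v < 1 -> 1 - v != 0.
Proof. by move=> v1; rewrite -nc_gt0; have := nc_lower 1 v; rewrite nc1; lra. Qed.

(* On the circle through [z], [1 - x * w^* = (w - x |z|^2) / w]. *)
Lemma cauchy_mean h x z : cholomorphic h -> nc z < 1 -> nc x <= 1 ->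
  Cint leb `[0, 1] (fun u => h (ecirc u * z) / (1 - x * (ecirc u * z)^*)) =
  h (x * (nc z ^+ 2)%:C).
Proof.
move=> hh z1 x1; have [->|z0] := eqVneq z 0.
  rewrite nc0 expr2 mulr0 rmorph0 mulr0.
  by under eq_Cint do rewrite !mulr0 cconj0 mulr0 subr0 divr1; rewrite Cint_unit_cst.
have nz : 0 < nc z by rewrite nc_gt0.
pose z0' := x * (nc z ^+ 2)%:C.
have z01 : nc z0' < nc z.
  by rewrite ncM nc_real ger0_norm ?exprn_ge0// ?nc_ge0//; have := nc_ge0 x; rewrite expr2; nra.
have e0 u : ecirc u * z != 0 by rewrite mulf_neq0// ecirc_neq0.
have xc u : nc (x * (ecirc u * z)^*) < 1.
  by rewrite ncM nc_conj ncM nc_ecirc; have := nc_ge0 x; nra.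
have E u : ecirc u * z / (ecirc u * z - z0') = (1 - x * (ecirc u * z)^*)^-1.
  have d0 := one_sub_neq0 (xc u).
  have -> : ecirc u * z - z0' = ecirc u * z * (1 - x * (ecirc u * z)^*).
    rewrite mulrBr mulr1 mulrCA mulc_conj /z0' ncM nc_ecirc mul1r.
    by [].
  by rewrite invfM mulrA divff// mul1r.
have := cauchy_mean_aux hh z1 z01.
under eq_Cint do rewrite E.
under [in RHS]eq_Cint do rewrite E.
(* The kernel has mean 1: its conjugate is the holomorphic function [w |-> (1 - x^* * w)^-1], whose
   value at 0 is 1. *)
move=> ->; rewrite [X in _ * X](_ : _ = 1) ?mulr1//.
have cq u : pcontinuous_at (fun u => (1 - x^* * (ecirc u * z))^-1) u.
  apply: (@pcontinuous_comp _ (fun w => (1 - x^* * w)^-1) (fun u => ecirc u * z)).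
    by apply: pcontinuousM; [exact: pcontinuous_ecirc|exact: pcontinuous_cst].
  have [|l hl] := @cderiv_affine_inv x^* (ecirc u * z); last exact: cderiv_continuous hl.
  by apply: one_sub_neq0; have := xc u; rewrite !(ncM, nc_conj).
have -> : (fun u => (1 - x * (ecirc u * z)^*)^-1) = (fun u => ((1 - x^* * (ecirc u * z))^-1)^*).
  by apply/funext => u; rewrite conj_affine_inv.
rewrite Cint_conj//; last by apply: Cintegrable_itv => u _; exact: cq.
rewrite (@mean_value (fun w => (1 - x^* * w)^-1))//.
  by rewrite mulr0 subr0 invr1 cconj1.
move=> w w1; apply: cderiv_affine_inv; apply: one_sub_neq0.
by rewrite ncM nc_conj; have := nc_ge0 w; nra.
Qed.

End circle.

(** * Change of variables for maps that scale a measure *)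

Definition scales_measure d (T : measurableType d) (R : realType)
    (mu : {measure set T -> \bar R}) (phi : T -> T) (c : R) :=
  measurable_fun setT phi /\
  forall A, measurable A -> mu (phi @^-1` A) = (c%:E * mu A)%E.

Lemma measurable_preimageT d1 d2 (T1 : measurableType d1) (T2 : measurableType d2)
    (phi : T1 -> T2) (A : set T2) : measurable_fun setT phi -> measurable A ->
  measurable (phi @^-1` A).
Proof. by move=> mphi mA; rewrite -[X in measurable X]setTI; exact: mphi. Qed.

Section image_measure.
Context d1 d2 (T1 : measurableType d1) (T2 : measurableType d2) (R : realType).
Variables (mu : {measure set T1 -> \bar R}) (nu : {measure set T2 -> \bar R}).
Variables (phi : T1 -> T2) (c : R) (D : set T2).
Hypotheses (c0 : 0 <= c) (mphi : measurable_fun setT phi) (mD : measurable D).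
Hypothesis phiE : forall A, measurable A -> A `<=` D -> mu (phi @^-1` A) = (c%:E * nu A)%E.

(** Scaling is assumed only for measurable subsets of [D]. This generality is for the squared
    modulus, whose image measure is a multiple of Lebesgue measure on the half-line of its values
    but vanishes on negative numbers. *)
Lemma ge0_integral_image (f : T2 -> \bar R) : measurable_fun D f ->
  (forall x, D x -> (0 <= f x)%E) ->
  (\int[mu]_(x in phi @^-1` D) f (phi x) = c%:E * \int[nu]_(x in D) f x)%E.
Proof.
move=> mf f0.
rewrite -[LHS](ge0_integral_pushforward mphi mu mD mf); last by move=> x /[!inE]; exact: f0.
rewrite -(@ge0_integral_mscale _ _ _ nu D mD (NngNum c0))//.
by apply: eq_measure_integral => A mA AD; exact: phiE.
Qed.

Lemma integral_image (f : T2 -> R) : nu.-integrable D (EFin \o f) ->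
  mu.-integrable (phi @^-1` D) (EFin \o (f \o phi)) /\
  \int[mu]_(x in phi @^-1` D) f (phi x) = c * \int[nu]_(x in D) f x.
Proof.
move=> iF; have mf : measurable_fun D (EFin \o f) by exact: measurable_int iF.
have mphiD := measurable_preimageT mphi mD.
have mfphi : measurable_fun (phi @^-1` D) (EFin \o (f \o phi)).
  apply: (measurable_comp mD _ mf); first by move=> _ [x Dx <-].
  exact: measurable_funTS mphi.
have iphi : mu.-integrable (phi @^-1` D) (EFin \o (f \o phi)).
  apply/integrableP; split => //.
  have := @ge0_integral_image (abse \o (EFin \o f)).
  rewrite /comp/= => ->//; last exact: (measurableT_comp (@abse_measurable R setT) mf).
  by apply: lte_mul_pinfty => //; case/integrableP : iF.
split => //; rewrite /Rintegral -[RHS]/(fine c%:E * _) -fineM//; last exact: integrable_fin_num.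
congr fine; rewrite integralE [in RHS]integralE muleBr//; last first.
  by rewrite fin_num_adde_defl// fin_numN (integrable_neg_fin_num mD iF).
rewrite -(@ge0_integral_image ((EFin \o f)^\+)%E)//; last exact: measurable_funepos.
rewrite -(@ge0_integral_image ((EFin \o f)^\-)%E)//; last exact: measurable_funeneg.
by congr (_ - _)%E; apply: eq_integral => x _; rewrite ?funeposE ?funenegE.
Qed.

Lemma Cint_image (f : T2 -> R[i]) : Cintegrable nu D f ->
  Cintegrable mu (phi @^-1` D) (f \o phi) /\
  Cint mu (phi @^-1` D) (f \o phi) = c%:C * Cint nu D f.
Proof.
move=> [f1 f2]; have [i1 e1] := integral_image f1; have [i2 e2] := integral_image f2.
split; first by [].
by apply: complex_eq; rewrite ?ReM ?ImM /= ?mul0r ?subr0 ?addr0.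
Qed.

End image_measure.

Section scales_measure.
Context d (T : measurableType d) (R : realType) (mu : {measure set T -> \bar R}).
Implicit Types (phi psi : T -> T).

Lemma scales_measure_id : scales_measure mu id 1.
Proof. by split=> // A mA; rewrite mul1e. Qed.

Lemma scales_measure_comp phi psi c e :
  scales_measure mu phi c -> scales_measure mu psi e ->
  scales_measure mu (phi \o psi) (c * e).
Proof.
move=> [mphi phiE] [mpsi psiE]; split; first exact: measurableT_comp.
move=> A mA; rewrite comp_preimage psiE ?phiE; [|by []|exact: measurable_preimageT].
by rewrite muleA -EFinM mulrC.
Qed.

Lemma ge0_integral_scales phi c (D : set T) (f : T -> \bar R) : 0 <= c ->
  scales_measure mu phi c -> measurable D -> measurable_fun D f ->
  (forall x, D x -> (0 <= f x)%E) ->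
  (\int[mu]_(x in phi @^-1` D) f (phi x) = c%:E * \int[mu]_(x in D) f x)%E.
Proof. by move=> c0 [mphi phiE] mD; apply: ge0_integral_image => // A mA _; exact: phiE. Qed.

Lemma Cint_scales phi c (D : set T) (f : T -> R[i]) : 0 <= c ->
  scales_measure mu phi c -> measurable D -> Cintegrable mu D f ->
  Cintegrable mu (phi @^-1` D) (f \o phi) /\
  Cint mu (phi @^-1` D) (f \o phi) = c%:C * Cint mu D f.
Proof. by move=> c0 [mphi phiE] mD; apply: Cint_image => // A mA _; exact: phiE. Qed.

End scales_measure.

(** * Affine maps and Lebesgue measure on the line and the plane *)

Section lebesgue1.
Context {R : realType}.
Local Notation leb := (@lebesgue_measure R).

Lemma leb_translation (a : R) : scales_measure leb (fun x : measurableTypeR R => x + a) 1.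
Proof.
have mt : measurable_fun setT (fun x : measurableTypeR R => (x + a : measurableTypeR R)).
  exact: measurable_funD.
split=> // A mA; rewrite mul1e; apply/esym.
pose phi : {mfun measurableTypeR R >-> measurableTypeR R} :=
  HB.pack (fun x : measurableTypeR R => x + a) (isMeasurableFun.Build _ _ _ _ _ mt).
apply: (@lebesgue_measure_unique _ (pushforward leb phi)) => //.
move=> _ [[u v] _ <-]; rewrite /pushforward/=.
rewrite [RHS](_ : _ = leb `](u - a), (v - a)]%classic); last first.
  by congr (leb _); apply/seteqP; split => x /=; rewrite !in_itv/=; lra.
rewrite !lebesgue_measure_itv/= !lte_fin ltrD2r; case: ifPn => // _.
by rewrite -!EFinB; congr EFin; ring.
Qed.

(** Preimages are measured, so the constant is the inverse of the Jacobian. Multiplied by [k], the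
    image measure agrees with Lebesgue measure on half-open intervals, and uniqueness concludes. *)
Lemma leb_dilation (k : R) : 0 < k -> scales_measure leb (fun x : measurableTypeR R => k * x) k^-1.
Proof.
move=> k0.
have mt : measurable_fun setT (fun x : measurableTypeR R => (k * x : measurableTypeR R)).
  by apply: measurable_funM.
split=> // A mA; have k0' := ltW k0.
pose phi : {mfun measurableTypeR R >-> measurableTypeR R} :=
  HB.pack (fun x : measurableTypeR R => k * x) (isMeasurableFun.Build _ _ _ _ _ mt).
transitivity (k^-1%:E * (k%:E * leb (phi @^-1` A)))%E.
  by rewrite muleA -EFinM mulVf ?gt_eqF// mul1e.
congr (_ * _)%E; apply/esym.
apply: (@lebesgue_measure_unique _ (mscale (NngNum k0') (pushforward leb phi)) _ A) => //.
move=> _ [[u v] _ <-]; rewrite /mscale/= /pushforward/=.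
pose I : set R := `](u / k), (v / k)]%classic.
rewrite [RHS](_ : _ = k%:E * leb I)%E; last first.
  by congr (_ * leb _)%E; apply/seteqP; split => x; rewrite /I/= !in_itv/= ltr_pdivrMr// ler_pdivlMr// mulrC.
rewrite /I !lebesgue_measure_itv/= !lte_fin ltr_pM2r ?invr_gt0//.
case: ifPn => _; last by rewrite mule0.
by rewrite -!EFinB -EFinM -mulrBl mulrCA divff ?mulr1// gt_eqF.
Qed.

End lebesgue1.

Section lebesgue2.
Context {R : realType}.
Local Notation leb := (@lebesgue_measure R).
Local Notation mR := (measurableTypeR R).
Local Notation M2 := (mR * mR)%type.
Local Notation leb2 := (@lebesgue2 R).

Lemma lebesgue2_unique (nu : {measure set M2 -> \bar R}) :
  (forall A B : set mR, measurable A -> measurable B -> nu (A `*` B) = leb A * leb B)%E ->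
  forall X : set M2, measurable X -> leb2 X = nu X.
Proof. exact: product_measure_unique. Qed.

Lemma lebesgue2_setX (A B : set mR) : measurable A -> measurable B ->
  leb2 (A `*` B) = (leb A * leb B)%E.
Proof. exact: product_measure1E. Qed.

Lemma lebesgue2_swap : scales_measure leb2 (fun p : M2 => (p.2, p.1)) 1.
Proof.
have ms : measurable_fun setT (fun p : M2 => (p.2, p.1)) by exact: measurable_swap.
split=> // A mA; rewrite mul1e; apply/esym.
pose phi : {mfun M2 >-> M2} :=
  HB.pack (fun p : M2 => (p.2, p.1)) (isMeasurableFun.Build _ _ _ _ _ ms).
apply: (lebesgue2_unique (nu := pushforward leb2 phi)) => //.
move=> X Y mX mY; rewrite /pushforward/=.
rewrite [LHS](_ : _ = leb2 (Y `*` X)); last first.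
  by congr (leb2 _); apply/seteqP; split => -[x y] /= [].
by rewrite lebesgue2_setX// muleC.
Qed.

Lemma lebesgue2_prod (f g : mR -> mR) (c e : R) : 0 <= c -> 0 <= e ->
  scales_measure leb f c -> scales_measure leb g e ->
  scales_measure leb2 (fun p : M2 => (f p.1, g p.2)) (c * e).
Proof.
move=> c0 e0 [mf fE] [mg gE].
have mh : measurable_fun setT (fun p : M2 => (f p.1, g p.2)).
  by apply: measurable_fun_pair; apply: measurableT_comp.
split=> // A mA; rewrite /lebesgue2 /product_measure1.
transitivity (\int[leb]_x (e%:E * leb (xsection A (f x))))%E.
  apply: eq_integral => x _ /=; rewrite -gE; last exact: measurable_xsection.
  by congr (leb _); apply/seteqP; split => y /=; rewrite /xsection/= !inE.
rewrite ge0_integralZl//; last first.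
  apply: (measurableT_comp (f := fun x => leb (xsection A x))) => //.
  exact: measurable_fun_xsection.
have := @ge0_integral_scales _ _ _ leb f c setT (fun x => leb (xsection A x)) c0 (conj mf fE) measurableT.
rewrite preimage_setT => ->//; last exact: measurable_fun_xsection.
by rewrite muleA -EFinM mulrC.
Qed.

(** Each vertical section is translated by [a * x], which the line does not notice; integration over
    the first coordinate keeps the equality. *)
Lemma lebesgue2_shear (a : R) : scales_measure leb2 (fun p : M2 => (p.1, p.2 + a * p.1)) 1.
Proof.
have mh : measurable_fun setT (fun p : M2 => (p.1, p.2 + a * p.1)).
  apply: measurable_fun_pair => //.
  by apply: measurable_funD => //; apply: measurable_funM.
split=> // A mA; rewrite mul1e /lebesgue2 /product_measure1.
apply: eq_integral => x _; have [_ H] := leb_translation (a * x).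
rewrite -[RHS]mul1e -H; last exact: measurable_xsection.
by congr (leb _); apply/seteqP; split => y /=; rewrite /xsection/= !inE.
Qed.

Lemma lebesgue2_translation (q : M2) :
  scales_measure leb2 (fun p : M2 => (p.1 + q.1, p.2 + q.2)) 1.
Proof.
have := lebesgue2_prod ler01 ler01 (leb_translation q.1) (leb_translation q.2).
by rewrite mulr1.
Qed.

Lemma lebesgue2_dilation (k : R) : 0 < k ->
  scales_measure leb2 (fun p : M2 => (k * p.1, k * p.2)) (k ^- 2).
Proof.
move=> k0; have k1 : 0 <= k^-1 by rewrite invr_ge0 ltW.
have := lebesgue2_prod k1 k1 (leb_dilation k0) (leb_dilation k0).
by rewrite -expr2 exprVn.
Qed.

Lemma lebesgue2_shear' (a : R) : scales_measure leb2 (fun p : M2 => (p.1 + a * p.2, p.2)) 1.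
Proof.
have := scales_measure_comp lebesgue2_swap (scales_measure_comp (lebesgue2_shear a) lebesgue2_swap).
by rewrite !mulr1.
Qed.

Definition rot2 (c s : R) (p : M2) : M2 := (c * p.1 - s * p.2, s * p.1 + c * p.2).

(* A rotation is a product of three shears unless it is [id] or [- id]. *)
Lemma lebesgue2_rotation (c s : R) : c ^+ 2 + s ^+ 2 = 1 -> scales_measure leb2 (rot2 c s) 1.
Proof.
have nz c' s' : c' ^+ 2 + s' ^+ 2 = 1 -> s' != 0 -> scales_measure leb2 (rot2 c' s') 1.
  move=> cs s0; set al := (c' - 1) / s'.
  have := scales_measure_comp (lebesgue2_shear' al)
    (scales_measure_comp (lebesgue2_shear s') (lebesgue2_shear' al)).
  rewrite !mulr1; congr (scales_measure _ _ _); apply/funext => -[x y] /=.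
  rewrite /rot2/=; congr pair; last by rewrite /al; field.
  rewrite /al; apply/eqP; rewrite -subr_eq0; apply/eqP.
  transitivity (y * (c' ^+ 2 + s' ^+ 2 - 1) / s'); first by field.
  by rewrite cs subrr mulr0 mul0r.
move=> cs; have [s0|] := eqVneq s 0; last exact: nz.
have [c1|] := eqVneq c 1.
  rewrite (_ : rot2 c s = id); first exact: scales_measure_id.
  by apply/funext => -[x y]; rewrite /rot2 c1 s0/=; congr pair; ring.
move=> c1; have cN : c = -1.
  by apply/eqP; move: cs; rewrite s0 expr0n/= addr0 => /eqP; rewrite sqrf_eq1 (negbTE c1).
(* The remaining case is minus the identity: it is the square of the quarter turn, which is a
   product of shears. *)
have h : scales_measure leb2 (rot2 0 1) 1 by apply: nz; [ring|exact: oner_neq0].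
have := scales_measure_comp h h; rewrite mulr1; congr (scales_measure _ _ _).
by apply/funext => -[x y]; rewrite /rot2 cN s0/=; congr pair; ring.
Qed.

End lebesgue2.

(** * Discs, the squared modulus and rotations *)

Section disc.
Context {R : realType}.
Local Notation leb := (@lebesgue_measure R).
Local Notation mR := (measurableTypeR R).
Local Notation M2 := (mR * mR)%type.
Local Notation leb2 := (@lebesgue2 R).

Definition toC (p : M2) : R[i] := p.1 +i* p.2.
Definition disc (r : R) : set M2 := [set p | nc (toC p) < r].
Definition sqnc (p : M2) : mR := nc (toC p) ^+ 2.

Lemma Cmeasurable_toC (A : set M2) : Cmeasurable A toC.
Proof. by split; apply: measurable_funTS; [exact: measurable_fst|exact: measurable_snd]. Qed.

Lemma measurable_sqnc : measurable_fun setT sqnc.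
Proof. by apply: measurable_funX; apply: measurable_nc; exact: Cmeasurable_toC. Qed.

Lemma measurable_disc r : measurable (disc r).
Proof.
have -> : disc r = setT `&` (fun p => nc (toC p) : mR) @^-1` `]-oo, r[.
  by rewrite setTI; apply/seteqP; split => p; rewrite /disc /= in_itv.
by apply: measurable_nc => //; exact: Cmeasurable_toC.
Qed.
Hint Resolve measurable_disc : core.

Let mcdisc s : measurable [set p | sqnc p <= s].
Proof.
have -> : [set p | sqnc p <= s] = sqnc @^-1` `]-oo, s].
  by apply/seteqP; split => p; rewrite /= in_itv.
exact: measurable_preimageT measurable_sqnc _.
Qed.

(** The number [pi], kept as a symbol; it normalises means and kernels. *)
Definition disc_area : R := fine (leb2 [set p | sqnc p <= 1]).

Let sqncE p : sqnc p = p.1 ^+ 2 + p.2 ^+ 2.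
Proof. by rewrite /sqnc sqr_nc. Qed.

Let cdisc1_lty : (leb2 [set p | sqnc p <= 1]%R < +oo)%E.
Proof.
apply: (@le_lt_trans _ _ (leb2 (`[-1, 1]%classic `*` `[-1, 1]%classic))).
  apply: le_measure; rewrite ?inE//; first exact: measurableX.
  move=> [a b]; rewrite /= sqncE/= !in_itv/= => h.
  have ha := sqr_ge0 a; have hb := sqr_ge0 b.
  have aux (x : R) : x ^+ 2 <= 1 -> -1 <= x <= 1.
    by move=> x1; rewrite -ler_norml -sqrtr_sqr -[leRHS]sqrtr1 ler_sqrt.
  by split; apply: aux; lra.
rewrite lebesgue2_setX//= lebesgue_measure_itv/= lte_fin.
by case: ifP => _; rewrite ?mule0// -EFinB -EFinM ltry.
Qed.

Lemma disc_area_gt0 : 0 < disc_area.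
Proof.
apply: (@lt_le_trans _ _ 1) => //; rewrite -lee_fin fineK; last by rewrite ge0_fin_numE ?cdisc1_lty.
apply: (@le_trans _ _ (leb2 (`[- 2^-1, 2^-1]%classic `*` `[- 2^-1, 2^-1]%classic))).
  rewrite lebesgue2_setX//= lebesgue_measure_itv/= lte_fin ifT; last lra.
  by rewrite -EFinB -EFinM lee_fin; lra.
apply: le_measure; rewrite ?inE//; first exact: measurableX.
move=> [a b] [/=]; rewrite !in_itv/= => ha hb; rewrite sqncE/=.
by nra.
Qed.

Let cdisc_area s : leb2 [set p | sqnc p <= s] = (Num.max s 0 * disc_area)%:E.
Proof.
have pos t : 0 < t -> leb2 [set p | sqnc p <= t] = (t * disc_area)%:E.
  move=> t0; have k0 : 0 < (Num.sqrt t)^-1 by rewrite invr_gt0 sqrtr_gt0.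
  have [_ /(_ [set p | sqnc p <= 1])] := lebesgue2_dilation k0.
  move=> /(_ (mcdisc 1)); rewrite exprVn sqr_sqrtr ?(ltW t0)// invrK.
  rewrite EFinM fineK ?ge0_fin_numE// => <-; congr (leb2 _).
  apply/seteqP; split => p /=; rewrite !sqncE/= !exprMn exprVn sqr_sqrtr ?(ltW t0)//;
    rewrite -mulrDr mulrC ler_pdivrMr// mul1r//.
have [s0|s0] := ltP 0 s; first by rewrite pos.
rewrite mul0r; apply/eqP; rewrite eq_le measure_ge0 andbT.
apply/lee_addgt0Pr => e e0; rewrite add0e.
have ea : 0 < e / disc_area by rewrite divr_gt0// disc_area_gt0.
rewrite -[e](divfK (lt0r_neq0 disc_area_gt0)) -pos//.
apply: le_measure; rewrite ?inE// => p /= h; apply: (le_trans h); lra.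
Qed.

Let annulus_area a b : a <= b ->
  leb2 (sqnc @^-1` `]a, b]) = ((Num.max b 0 - Num.max a 0) * disc_area)%:E.
Proof.
move=> ab; have -> : sqnc @^-1` `]a, b] = [set p | sqnc p <= b] `\` [set p | sqnc p <= a].
  apply/seteqP; split => p /=; rewrite in_itv/=; first by move=> /andP[/lt_geF -> ->].
  by move=> [-> /negP]; rewrite -ltNge => ->.
have fb : (leb2 [set p | sqnc p <= b]%R < +oo)%E by rewrite cdisc_area ltry.
transitivity (leb2 [set p | sqnc p <= b]%R -
    leb2 ([set p | sqnc p <= b]%R `&` [set p | sqnc p <= a]%R))%E; first exact: measureD.
rewrite (_ : _ `&` _ = [set p | sqnc p <= a]).
  by rewrite !cdisc_area -EFinB mulrBl.
by apply/seteqP; split => p /=; [case|move=> h; split => //; apply: (le_trans h)].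
Qed.

(** The area of [|p|^2 <= s] is linear in [s], so in this variable the image measure has constant
    density. Uniqueness of Lebesgue measure needs agreement on the whole line, whereas the image
    measure has no mass on negative numbers; the auxiliary measure [nu] therefore adds Lebesgue
    measure restricted to the half-line [N], which meets [A] in at most one point. *)
Lemma radial_measure (A : set mR) : measurable A -> A `<=` `[0, 1[ ->
  leb2 (sqnc @^-1` A) = (disc_area%:E * leb A)%E.
Proof.
move=> mA A01; have a0 := disc_area_gt0.
have ia0 : 0 <= disc_area^-1 by rewrite invr_ge0 ltW.
pose N : set mR := `]-oo, 0]%classic.
have mN : measurable N by exact: measurable_itv.
pose nu0 : {measure set mR -> \bar R} := mscale (NngNum ia0) (pushforward leb2 sqnc).
pose nu : {measure set mR -> \bar R} := measure_add (nu0 measurable_sqnc) (mrestr leb mN).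
have nuE X : nu X = (disc_area^-1%:E * leb2 (sqnc @^-1` X) + leb (X `&` N))%E.
  exact: (measure_addE (nu0 measurable_sqnc) (mrestr leb mN) X).
have := @lebesgue_measure_unique _ nu _ A mA; rewrite nuE => ->.
- rewrite [X in (_ + X)%E](_ : _ = 0%E).
    by rewrite adde0 muleA -EFinM divff ?gt_eqF// mul1e.
  apply/eqP; rewrite eq_le measure_ge0 andbT.
  rewrite -[leRHS](@lebesgue_measure_set1 R 0); apply: le_measure; rewrite ?inE//.
    exact: measurableI.
  move=> x [/A01]; rewrite /N/= !in_itv/= => /andP[x0 _] x1.
  by apply/eqP; rewrite eq_le x0 x1.
- move=> _ [[a b] _ <-]; rewrite nuE/=.
  have [ab|ba] := leP a b; last first.
    by rewrite set_itv_ge ?bnd_simp -?leNgt ?ltW// preimage_set0 set0I !measure0 mule0 adde0.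
  rewrite annulus_area//.
  have -> : `]a, b] `&` N = `]a, Num.min b 0]%classic.
    by apply/seteqP; split => x; rewrite /N/= !in_itv/= le_min;
      [move=> [/andP[-> ->] ->]|move=> /and3P[-> -> ->]].
  rewrite !lebesgue_measure_itv/= !lte_fin -EFinM mulrCA mulVf ?gt_eqF// mulr1.
  by case: ifPn => h1; case: ifPn => h2; rewrite -?EFinB -?EFinD; congr EFin;
    move: ab h1 h2; clear; rewrite ?lt_min -?leNgt ?ge_min; case: (leP b 0); case: (leP a 0) => //= *; lra.
Qed.

Let disc1E : disc 1 = sqnc @^-1` `[0, 1[.
Proof.
apply/seteqP; split => p /=; rewrite in_itv/= /sqnc /disc sqr_ge0/=.
  by move=> h; rewrite expr_lt1 ?nc_ge0.
by rewrite expr_lt1 ?nc_ge0.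
Qed.

Lemma ge0_integral_radial (f : mR -> \bar R) :
  measurable_fun (`[0, 1[%classic : set mR) f ->
  (forall x, 0 <= x < 1 -> (0 <= f x)%E) ->
  (\int[leb2]_(p in disc 1) f (sqnc p) = disc_area%:E * \int[leb]_(x in `[0%R, 1%R[) f x)%E.
Proof.
move=> mf f0; rewrite disc1E.
apply: (@ge0_integral_image _ _ _ _ _ leb2 leb sqnc disc_area `[0, 1[ (ltW disc_area_gt0)) => //.
- exact: measurable_sqnc.
- by move=> A mA A01; exact: radial_measure.
Qed.

Lemma Cint_radial (f : mR -> R[i]) : Cintegrable leb `[0, 1[ f ->
  Cint leb2 (disc 1) (fun p => f (sqnc p)) = disc_area%:C * Cint leb `[0, 1[ f.
Proof.
move=> iF; rewrite disc1E.
have r (A : set mR) : measurable A -> A `<=` `[0, 1[ -> leb2 (sqnc @^-1` A) = (disc_area%:E * leb A)%E.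
  by move=> mA A01; exact: radial_measure.
exact: (Cint_image (ltW disc_area_gt0) measurable_sqnc _ r iF).2.
Qed.

Definition rotation (u : R) (p : M2) : M2 := rot2 (cos (pi *+ 2 * u)) (sin (pi *+ 2 * u)) p.

Lemma toC_rotation u p : toC (rotation u p) = ecirc u * toC p.
Proof. by case: p => x y; apply: complex_eq; rewrite /toC /=; ring. Qed.

Lemma rotation_disc u r : rotation u @^-1` (disc r) = disc r.
Proof.
have E p : disc r (rotation u p) = disc r p.
  by rewrite /disc /mkset toC_rotation ncM nc_ecirc mul1r.
by apply/seteqP; split => p; rewrite /preimage /mkset E.
Qed.

Lemma scales_rotation u : scales_measure leb2 (rotation u) 1.
Proof. by apply: lebesgue2_rotation; rewrite cos2Dsin2. Qed.

Let measurable_rotate : measurable_fun setT (fun q : M2 * mR => rotation q.2 q.1).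
Proof.
have mc : measurable_fun setT (fun q : M2 * mR => cos (pi *+ 2 * q.2)).
  apply: (measurableT_comp (f := @cos R)); first by apply: continuous_measurable_fun; exact: continuous_cos.
  by apply: measurable_funM => //; exact: measurable_snd.
have ms : measurable_fun setT (fun q : M2 * mR => sin (pi *+ 2 * q.2)).
  apply: (measurableT_comp (f := @sin R)); first by apply: continuous_measurable_fun; exact: continuous_sin.
  by apply: measurable_funM => //; exact: measurable_snd.
have m1 : measurable_fun setT (fun q : M2 * mR => q.1.1).
  by apply: (measurableT_comp measurable_fst); exact: measurable_fst.
have m2 : measurable_fun setT (fun q : M2 * mR => q.1.2).
  by apply: (measurableT_comp measurable_snd); exact: measurable_fst.
apply: measurable_fun_pair.
  by apply: measurable_funB; apply: measurable_funM.
by apply: measurable_funD; apply: measurable_funM.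
Qed.

(** * Averaging over rotations *)

Section rotation_average.
Variable f : M2 -> R.
Hypothesis mf : measurable_fun (disc 1) f.

Let F (q : M2 * mR) : R := ((fun q => f (rotation q.2 q.1)) \_ (disc 1 `*` `[0, 1])) q.

Let mF : measurable_fun setT F.
Proof.
apply/(measurable_restrictT _ _).1; first exact: measurableX.
apply: (measurable_comp (F := disc 1) (f := f)) => //.
  by move=> _ [q [q1 _] <-]; move: q1; rewrite -{1}(rotation_disc q.2 1).
exact: measurable_funTS measurable_rotate.
Qed.

Let F_u p : disc 1 p -> F \o pair p = (fun u => f (rotation u p)) \_ `[0, 1].
Proof.
move=> p1; apply/funext => u; rewrite /F/= !patchE.
case: ifPn => [|nu]; first by rewrite !inE => -[_ u01]; rewrite ifT// inE.
by rewrite ifF//; apply/negP => u01; move/negP: nu; apply; rewrite !inE; split => //; rewrite inE in u01.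
Qed.

Let F_u0 p : ~ disc 1 p -> F \o pair p = cst 0.
Proof.
by move=> p1; apply/funext => u; rewrite /F/= !patchE ifF//; apply/negP; rewrite inE => -[].
Qed.

Let F_p (u : mR) : F \o pair^~ u =
  (if u \in `[0, 1]%classic then (fun p => f (rotation u p)) \_ (disc 1) else cst 0).
Proof.
apply/funext => p; rewrite /F/= !patchE.
case: ifPn => [|nu]; first by rewrite inE => -[p1 u01]; rewrite mem_set// patchE mem_set.
case: ifPn => // u01; rewrite patchE ifF//; apply/negP; rewrite inE => p1.
by move/negP: nu; apply; rewrite inE; split => //; rewrite inE in u01.
Qed.

Let fubini_FE p : fubini_F leb (EFin \o F) p =
  ((fun p => \int[leb]_(u in `[0%R, 1%R]) (f (rotation u p))%:E) \_ (disc 1))%E p.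
Proof.
rewrite /fubini_F patchE; case: ifPn.
  rewrite inE => p1; rewrite [RHS]integral_mkcond; apply: eq_integral => u _.
  by have /(congr1 (fun g => g u))/= := F_u p1; rewrite !patchE => ->; case: ifP.
move=> /negP; rewrite inE => p1; apply: integral0_eq => u _ /=.
by have /(congr1 (fun g => g u))/= := F_u0 p1; move=> ->.
Qed.

Let fubini_GE (u : mR) : (\int[leb2]_(p in disc 1) (f (rotation u p))%:E =
    \int[leb2]_(p in disc 1) (f p)%:E)%E ->
  fubini_G leb2 (EFin \o F) u =
  ((fun=> \int[leb2]_(p in disc 1) (f p)%:E) \_ `[0%R, 1%R])%E u.
Proof.
move=> E; rewrite /fubini_G patchE.
have Fp := F_p u; case: ifPn Fp => u01 Fp.
  rewrite -E [RHS]integral_mkcond; apply: eq_integral => p _.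
  by have /(congr1 (fun g => g p))/= := Fp; rewrite !patchE => ->; case: ifP.
apply: integral0_eq => p _ /=.
by have /(congr1 (fun g => g p))/= := Fp; move=> ->.
Qed.

Let unit_average (c : \bar R) : (\int[leb]_u (((fun=> c) \_ `[0%R, 1%R]) u) = c)%E.
Proof.
rewrite -integral_mkcond integral_cst//= lebesgue_measure_itv/= lte_fin ltr01.
by rewrite oppr0 adde0 mule1.
Qed.

(** Exchange the two integrals: for each fixed angle the rotation preserves both the disc and the
    area, so the inner integral does not depend on the angle, and the angles have total mass 1. *)
Lemma rotation_average_ge0 : (forall p, 0 <= f p) ->
  (\int[leb2]_(p in disc 1) (f p)%:E =
   \int[leb2]_(p in disc 1) \int[leb]_(u in `[0%R, 1%R]) (f (rotation u p))%:E)%E.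
Proof.
move=> f0.
have F0 q : (0 <= (EFin \o F) q)%E by rewrite lee_fin /F patchE; case: ifP.
have mEF : measurable_fun setT (EFin \o F) by exact/measurable_EFinP.
have := @fubini_tonelli _ _ _ _ _ leb2 leb (EFin \o F) mEF F0 => FT.
rewrite [RHS](integral_mkcond (disc 1)).
under [RHS]eq_integral do rewrite -fubini_FE.
rewrite FT -[LHS]unit_average.
apply: eq_integral => u _; rewrite -/(fubini_G leb2 (EFin \o F) u) fubini_GE//.
have := ge0_integral_scales (f := EFin \o f) ler01 (scales_rotation u) (measurable_disc 1).
rewrite rotation_disc mul1e => ->//; first exact/measurable_EFinP.
by move=> p _; rewrite lee_fin.
Qed.

Lemma rotation_average_integrable :
  (\int[leb2]_(p in disc 1) \int[leb]_(u in `[0%R, 1%R]) `|f (rotation u p)|%:E < +oo)%E ->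
  leb2.-integrable (disc 1) (EFin \o f) ->
  (\int[leb2]_(p in disc 1) (f p)%:E =
   \int[leb2]_(p in disc 1) \int[leb]_(u in `[0%R, 1%R]) (f (rotation u p))%:E)%E.
Proof.
move=> fin iF.
have mEF : measurable_fun setT (EFin \o F) by exact/measurable_EFinP.
have iEF : (leb2 \x leb)%E.-integrable setT (EFin \o F).
  apply/integrable12ltyP; [exact: mEF|]; apply: le_lt_trans fin.
  rewrite [leRHS]integral_mkcond le_eqVlt; apply/orP; left; apply/eqP.
  apply: eq_integral => p _; rewrite patchE; case: ifPn.
    rewrite inE => p1; rewrite [RHS]integral_mkcond; apply: eq_integral => u _.
    have /(congr1 (fun g => g u))/= := F_u p1; rewrite !patchE => ->.
    by case: ifP => // _; rewrite normr0.
  move=> /negP; rewrite inE => p1; apply: integral0_eq => u _ /=.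
  by have /(congr1 (fun g => g u))/= := F_u0 p1; move=> ->; rewrite normr0.
have FT := Fubini iEF.
rewrite [RHS](integral_mkcond (disc 1)).
under [RHS]eq_integral do rewrite -fubini_FE.
rewrite [RHS]FT -[LHS]unit_average; apply: eq_integral => u _; rewrite -/(fubini_G leb2 (EFin \o F) u) fubini_GE//.
have rE A : measurable A -> A `<=` disc 1 -> leb2 (rotation u @^-1` A) = (1%:E * leb2 A)%E.
  by move=> mA _; exact: (scales_rotation u).2.
have [] := integral_image ler01 (scales_rotation u).1 (measurable_disc 1) rE iF.
rewrite rotation_disc mul1r /Rintegral => i1 e; have := congr1 EFin e.
by rewrite !fineK//; [exact: integrable_fin_num iF|exact: integrable_fin_num i1].
Qed.

End rotation_average.

End disc.
#[global] Hint Resolve measurable_disc : core.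

(** * The reproducing formula on the unit disc *)

Section reproducing.
Context {R : realType}.
Local Notation leb := (@lebesgue_measure R).
Local Notation mR := (measurableTypeR R).
Local Notation M2 := (mR * mR)%type.
Local Notation leb2 := (@lebesgue2 R).
Local Notation A1 := (@disc_area R).

(** Averaging the modulus, where nonnegativity suffices, yields the product integrability required
    to average the signed function. *)
Lemma rotation_average (f : M2 -> R) : leb2.-integrable (disc 1) (EFin \o f) ->
  (forall p, disc 1 p -> leb.-integrable `[0, 1] (EFin \o (fun u => f (rotation u p)))) ->
  \int[leb2]_(p in disc 1) f p =
  \int[leb2]_(p in disc 1) \int[leb]_(u in `[0, 1]) f (rotation u p).
Proof.
move=> iF ic; have mf : measurable_fun (disc 1) f.
  by apply/measurable_EFinP; exact: measurable_int iF.
rewrite /Rintegral rotation_average_integrable//.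
  congr fine; apply: eq_integral => p; rewrite inE => p1.
  by rewrite fineK//; exact: integrable_fin_num (ic _ p1).
have mn : measurable_fun (disc 1) (fun p => `|f p|) by exact: measurableT_comp.
rewrite -(rotation_average_ge0 mn)//.
by case/integrableP : iF.
Qed.

Lemma rotation_average_C (f : R[i] -> R[i]) (m : M2 -> R[i]) :
  Cintegrable leb2 (disc 1) (fun p => f (toC p)) ->
  (forall p, disc 1 p -> Cintegrable leb `[0, 1] (fun u => f (ecirc u * toC p)) /\
     Cint leb `[0, 1] (fun u => f (ecirc u * toC p)) = m p) ->
  Cint leb2 (disc 1) (fun p => f (toC p)) = Cint leb2 (disc 1) m.
Proof.
move=> [f1 f2] fm; apply: complex_eq => /=.
  rewrite (rotation_average f1); last first.
    move=> p /fm[[+ _] _]; apply: eq_integrable => // u _ /=.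
    by rewrite toC_rotation.
  apply: eq_Rintegral => p; rewrite inE => /fm[_ <-] /=.
  by apply: eq_Rintegral => u _; rewrite toC_rotation.
rewrite (rotation_average f2); last first.
  move=> p /fm[[_ +] _]; apply: eq_integrable => // u _ /=.
  by rewrite toC_rotation.
apply: eq_Rintegral => p; rewrite inE => /fm[_ <-] /=.
by apply: eq_Rintegral => u _; rewrite toC_rotation.
Qed.

Lemma Cintegrable_bounded_mul d (T : measurableType d) (mu : {measure set T -> \bar R})
    (A : set T) (f g : T -> R[i]) (B : R) : measurable A -> Cintegrable mu A f ->
  Cmeasurable A g -> (forall x, A x -> nc (g x) <= B) ->
  Cintegrable mu A (fun x => f x * g x).
Proof.
move=> mA iF mg gB; apply: (le_Cintegrable (h := fun x => B * nc (f x))) => //.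
- by apply: CmeasurableM => //; exact: Cintegrable_measurable iF.
- by move=> x Ax; rewrite ncM mulrC ler_wpM2r ?nc_ge0 ?gB.
by have := integrableZl mA B (integrable_nc mA iF); apply: eq_integrable.
Qed.

Lemma nc_mul_conj_lt1 (x w : R[i]) : nc x <= 1 -> nc w < 1 -> nc (x * w^*) < 1.
Proof.
move=> x1 w1; rewrite ncM nc_conj; apply: le_lt_trans w1.
by apply: ler_piMl => //; exact: nc_ge0.
Qed.

Lemma nc_one_sub_ge (x w : R[i]) : nc w <= 1 -> 1 - nc x <= nc (1 - x * w^*).
Proof.
move=> w1; apply: le_trans (nc_lower _ _); rewrite nc1 ncM nc_conj.
by rewrite lerD2l lerN2 ler_piMr ?nc_ge0.
Qed.

Lemma nc_inv_one_sub (x w : R[i]) : nc x < 1 -> nc w <= 1 ->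
  nc (1 - x * w^*)^-1 <= (1 - nc x)^-1.
Proof.
move=> x1 w1; have := nc_one_sub_ge x w1 => h; rewrite ncV lef_pV2 ?posrE//; lra.
Qed.

Lemma Cmeasurable_one_sub (x : R[i]) (A : set M2) :
  Cmeasurable A (fun p => 1 - x * (toC p)^*).
Proof.
apply: CmeasurableB; first exact: Cmeasurable_cst.
apply: CmeasurableM; first exact: Cmeasurable_cst.
by apply: Cmeasurable_conj; exact: Cmeasurable_toC.
Qed.

Section disc_reproducing.
Variables (h : R[i] -> R[i]) (x : R[i]).
Hypothesis hh : cholomorphic h.
Hypothesis ih : Cintegrable leb2 (disc 1) (fun p => h (toC p)).
Hypothesis x1 : nc x < 1.

Let h_cont w : nc w < 1 -> ccontinuous_at h w.
Proof. by move=> /hh[l hl]; exact: cderiv_continuous hl. Qed.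

Let line_cont s t : 0 <= s <= 1 -> 0 <= t <= 1 -> pcontinuous_at (fun t => h (s%:C * x * t%:C)) t.
Proof.
move=> s01 t01; apply: (@pcontinuous_comp _ h (fun t : R => s%:C * x * t%:C)).
  apply: pcontinuousM; first exact: pcontinuous_cst.
  apply: (@pderiv_continuous _ _ _ 1%:C).
  by apply: (pderiv_real (r := id)); exact: is_derive_id.
apply: h_cont; rewrite !ncM !nc_real.
have -> : `|s| = s by rewrite ger0_norm//; lra.
have -> : `|t| = t by rewrite ger0_norm//; lra.
rewrite mulrAC; apply: le_lt_trans x1; apply: ler_piMl; first exact: nc_ge0.
by apply: mulr_ile1; lra.
Qed.

Let nsx s : 0 <= s <= 1 -> nc (s%:C * x) < 1.
Proof.
move=> s01; rewrite ncM nc_real.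
have -> : `|s| = s by rewrite ger0_norm//; lra.
by apply: le_lt_trans x1; apply: ler_piMl; [exact: nc_ge0|lra].
Qed.

(** On each circle Cauchy's formula gives [h] at [s x |p|^2], which depends on [p] through its
    squared modulus alone. The radial change of variables then turns the area integral into an
    integral along the segment from 0 to [s x]. *)
Let cauchy_transform s : 0 <= s <= 1 ->
  Cint leb2 (disc 1) (fun p => h (toC p) * (1 - s%:C * x * (toC p)^*)^-1) =
  A1%:C * Cint leb `[0, 1] (fun t => h (s%:C * x * t%:C)).
Proof.
move=> s01; have sx1 := nsx s01.
have iline : Cintegrable leb `[0, 1] (fun t => h (s%:C * x * t%:C)).
  by apply: Cintegrable_itv => t t01; exact: line_cont.
(* Path integrals live on the closed interval and the radial formula on the half-open one; the
   endpoint has measure zero. *)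
have co_cc (f : mR -> R[i]) : Cintegrable leb `[0, 1] f ->
    Cintegrable leb `[0, 1[ f /\ Cint leb `[0, 1[ f = Cint leb `[0, 1] f.
  move=> [f1 f2].
  have i1 : leb.-integrable `[0, 1[ (EFin \o (fun x => Re (f x))).
    by apply: integrableS f1 => //; apply: subset_itvl; rewrite bnd_simp.
  have i2 : leb.-integrable `[0, 1[ (EFin \o (fun x => Im (f x))).
    by apply: integrableS f2 => //; apply: subset_itvl; rewrite bnd_simp.
  by split; first (by split); rewrite /Cint !Rintegral_itv_bndo_bndc.
have [ico eco] := co_cc _ iline; rewrite -eco -Cint_radial//.
have mh p : disc 1 p -> pcontinuous_at (fun u => h (ecirc u * toC p)) =1 fun=> True.
  move=> p1 u; apply/propext; split => // _.
  apply: (@pcontinuous_comp _ h (fun u => ecirc u * toC p)).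
    by apply: pcontinuousM; [exact: pcontinuous_ecirc|exact: pcontinuous_cst].
  by apply: h_cont; rewrite ncM nc_ecirc mul1r.
apply: (rotation_average_C (f := fun w => h w * (1 - s%:C * x * w^*)^-1)).
  apply: (Cintegrable_bounded_mul (B := (1 - nc (s%:C * x))^-1) (measurable_disc 1) ih).
    by apply: CmeasurableV; exact: Cmeasurable_one_sub.
  by move=> p p1; apply: nc_inv_one_sub => //; exact: ltW.
move=> p p1; split; last by rewrite cauchy_mean// ltW.
apply: Cintegrable_itv => u _; apply: pcontinuousM; first by rewrite mh.
have -> : (fun u => (1 - s%:C * x * (ecirc u * toC p)^*)^-1) =
    (fun u => ((1 - (s%:C * x)^* * (ecirc u * toC p))^-1)^*).
  by apply/funext => v; rewrite conj_affine_inv.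
have /pcontinuous_ReIm[c1 c2] : pcontinuous_at (fun u => (1 - (s%:C * x)^* * (ecirc u * toC p))^-1) u.
  apply: (@pcontinuous_comp _ (fun w => (1 - (s%:C * x)^* * w)^-1) (fun u => ecirc u * toC p)).
    by apply: pcontinuousM; [exact: pcontinuous_ecirc|exact: pcontinuous_cst].
  have [|l hl] := @cderiv_affine_inv _ (s%:C * x)^* (ecirc u * toC p); last exact: cderiv_continuous hl.
  have ep1 : nc (ecirc u * toC p) < 1 by rewrite ncM nc_ecirc mul1r.
  apply: one_sub_neq0; rewrite ncM nc_conj.
  by have := nc_mul_conj_lt1 (ltW sx1) ep1; rewrite ncM nc_conj.
apply: ReIm_pcontinuous.
  by rewrite /prop_for/continuous_at Re_conj; under eq_fun do rewrite Re_conj.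
rewrite /prop_for/continuous_at Im_conj; under eq_fun do rewrite Im_conj.
exact: cvgN.
Qed.

(* Scaling turns the previous identity into [s * F s = A1 * \int_0^s h (x t) dt]. *)
Let cauchy_transform_scaled s : 0 < s <= 1 ->
  s%:C * Cint leb2 (disc 1) (fun p => h (toC p) * (1 - s%:C * x * (toC p)^*)^-1) =
  A1%:C * Cint leb `[0, s] (fun t => h (x * t%:C)).
Proof.
move=> /andP[s0 s1]; rewrite cauchy_transform; last by rewrite s1 ltW.
have is_ : Cintegrable leb `[0, s] (fun t => h (x * t%:C)).
  apply: Cintegrable_itv => t; rewrite in_itv/= => ts.
  have := @line_cont 1 t; rewrite rmorph1 mul1r; apply; lra.
have m0s : measurable (`[0, s]%classic : set mR) by exact: measurable_itv.
have s0' : 0 <= s^-1 by rewrite invr_ge0 ltW.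
have [_] := Cint_scales s0' (leb_dilation s0) m0s is_.
have -> : (fun t : mR => s * t) @^-1` `[0, s] = `[0, 1]%classic.
  by apply/seteqP; split => t /=; rewrite !in_itv/= pmulr_rge0// ger_pMr.
rewrite (_ : _ \o _ = (fun t => h (s%:C * x * t%:C))); last first.
  by apply/funext => t /=; congr h; rewrite rmorphM/=; ring.
move=> ->; rewrite [RHS](_ : _ = s%:C * (A1%:C * (s^-1%:C * Cint leb `[0, s] (fun t : mR => h (x * t%:C)))))//.
rewrite [RHS]mulrCA; congr (_ * _); rewrite mulrA -rmorphM/= divff ?gt_eqF//.
by rewrite rmorph1 mul1r.
Qed.

(** The squared kernel is the derivative at [s = 1] of [s / (1 - s v)], where [v] is [x] times the
    conjugate of the point. Differentiating the scaled Cauchy transform at [s = 1] gives the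
    formula, since its right side is an integral with upper end [s]. As [nc x < 1] bounds the
    kernels uniformly, an integrable [h] is enough. *)
Lemma disc_reproducing :
  Cint leb2 (disc 1) (fun p => h (toC p) * (1 - x * (toC p)^*)^-1 ^+ 2) = A1%:C * h x.
Proof.
pose v (p : M2) := x * (toC p)^*.
pose G s (p : M2) := h (toC p) * (1 - s%:C * x * (toC p)^*)^-1.
have mI s A : Cmeasurable A (fun p => (1 - s%:C * x * (toC p)^*)^-1).
  by apply: CmeasurableV; exact: Cmeasurable_one_sub.
have a0 := @disc_area_gt0 R.
pose b := (1 - nc x)^-1; have b0 : 0 < b by rewrite invr_gt0 subr_gt0.
have bs s p : 0 <= s <= 1 -> disc 1 p -> nc (1 - s%:C * x * (toC p)^*)^-1 <= b.
  move=> s01 p1; apply: le_trans (nc_inv_one_sub (nsx s01) (ltW p1)) _.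
  rewrite lef_pV2 ?posrE ?subr_gt0 ?nsx// lerD2l lerN2 ncM nc_real.
  have -> : `|s| = s by rewrite ger0_norm//; lra.
  by apply: ler_piMl; [exact: nc_ge0|lra].
have iG s : 0 <= s <= 1 -> Cintegrable leb2 (disc 1) (G s).
  by move=> s01; apply: (Cintegrable_bounded_mul (B := b) (measurable_disc 1) ih (mI s _)) => p p1; exact: bs.
have i2 s : 0 <= s <= 1 -> Cintegrable leb2 (disc 1) (fun p => G s p * (1 - x * (toC p)^*)^-1).
  move=> s01; apply: (Cintegrable_bounded_mul (B := b) (measurable_disc 1) (iG s s01)).
    by have := mI 1 (disc 1); rewrite rmorph1 mul1r.
  by move=> p p1; have := @bs 1 p; rewrite rmorph1 mul1r ler01 lexx; exact.
pose N := \int[leb2]_(p in disc 1) nc (h (toC p)).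
have N0 : 0 <= N by apply: Rintegral_ge0 => p _; exact: nc_ge0.
have o01 : 0 <= (1 : R) <= 1 by rewrite ler01 lexx.
have line t : 0 <= t <= 1 -> pcontinuous_at (fun t => h (x * t%:C)) t.
  by move=> t01; have := @line_cont 1 t; rewrite rmorph1 mul1r; exact.
(* difference quotient of [s F s] at [s = 1] *)
have key s : 0 < s < 1 -> (1 - s)%:C * Cint leb2 (disc 1) (fun p => G s p * (1 - x * (toC p)^*)^-1) =
    A1%:C * Cint leb `[s, 1] (fun t => h (x * t%:C)).
  move=> /andP[s0 s1].
  have s01 : 0 <= s <= 1 by lra.
  have c01 : {in `[0, 1], forall t : R, pcontinuous_at (fun t => h (x * t%:C)) t}.
    by move=> t; rewrite in_itv/=; exact: line.
  have := Cint_itv_split s01 c01.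
  move=> /(congr1 (fun z => A1%:C * z)); rewrite mulrDr.
  rewrite -(@cauchy_transform_scaled s); last lra.
  rewrite -(@cauchy_transform_scaled 1); last lra.
  rewrite rmorph1 mul1r => /eqP; rewrite addrC -subr_eq => /eqP <-.
  rewrite -/(G 1) -/(G s).
  rewrite -!CintZ//; [|exact: iG s01|exact: i2 s01].
  rewrite -CintB//; [|exact: iG o01|apply: CintegrableZ => //; exact: iG s01].
  apply: eq_Cint => p; rewrite inE => p1; rewrite /G rmorph1 mul1r.
  have d1 : 1 - x * (toC p)^* != 0.
    by apply: one_sub_neq0; apply: nc_mul_conj_lt1 => //; exact: ltW.
  have d2 : 1 - s%:C * x * (toC p)^* != 0.
    by apply: one_sub_neq0; apply: nc_mul_conj_lt1 => //; apply/ltW/nsx; lra.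
  by rewrite rmorphB rmorph1; field; rewrite d1 d2.
apply/eqP; rewrite -subr_eq0 -nc_eq0 eq_le nc_ge0 andbT.
apply/ler_addgt0Pr => e e0; rewrite add0r.
have eA : 0 < e / (4 * A1) by rewrite divr_gt0// mulr_gt0.
have [d d0 H] := h_cont x1 eA.
pose K := 2 * b ^+ 3 * N + 1.
have K0 : 0 < K by rewrite /K ltr_wpDl// mulr_ge0// mulr_ge0// exprn_ge0// ltW.
(* Three requirements on [s = 1 - de]: it stays in []0, 1[]; on the segment from [s x] to [x] the
   function [h] is within [e / (4 * A1)] of [h x]; and replacing one factor of the squared kernel by
   its value at [s] costs at most [e / 2]. *)
pose de := Num.min (2^-1) (Num.min (d / 2) (e / (2 * K))).
have de0 : 0 < de by rewrite !lt_min invr_gt0 ltr0n divr_gt0//= divr_gt0// mulr_gt0.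
have [de1 de2 de3] : [/\ de <= 2^-1, de <= d / 2 & de <= e / (2 * K)].
  by rewrite /de; split; rewrite !ge_min lexx ?orbT.
clearbody b de.
have [s sE] : exists s, s = 1 - de by exists (1 - de).
have s01 : 0 < s < 1 by rewrite sE subr_gt0 gtrBl de0 andbT; apply: le_lt_trans de1 _; rewrite invf_lt1// ltr1n.
have s01' : 0 <= s <= 1 by have /andP[? ?] := s01; rewrite !ltW.
have s10 : 0 < 1 - s by have /andP[_ ?] := s01; rewrite subr_gt0.
have st01 t : s <= t <= 1 -> 0 <= t <= 1.
  by move=> /andP[st ->]; have /andP[sg _] := s01'; rewrite (le_trans sg st).
set I := Cint _ _ _.
pose J := Cint leb2 (disc 1) (fun p => G s p * (1 - x * (toC p)^*)^-1).
have IJ : nc (I - J) <= e / 2.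
  have -> : I = Cint leb2 (disc 1) (fun p => G 1 p * (1 - x * (toC p)^*)^-1).
    by apply: eq_Cint => p _; rewrite /G rmorph1 mul1r expr2 mulrA.
  rewrite -CintB//; [|exact: i2 o01|exact: i2].
  apply: (le_trans (nc_Cint_le _ _)) => //; first (apply: CintegrableB => //; [exact: i2 o01|exact: i2]).
  have : \int[leb2]_(p in disc 1) nc (G 1 p * (1 - x * (toC p)^*)^-1 - G s p * (1 - x * (toC p)^*)^-1)
      <= \int[leb2]_(p in disc 1) (de * b ^+ 3 * nc (h (toC p))).
    apply: le_Rintegral => //.
    - apply: integrable_nc => //; apply: CintegrableB => //; [exact: i2 o01|exact: i2].
    - by have := integrableZl (measurable_disc 1) (de * b ^+ 3) (integrable_nc (measurable_disc 1) ih);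
        apply: eq_integrable.
    move=> p p1; rewrite /G rmorph1 mul1r.
    have d1 : 1 - x * (toC p)^* != 0.
      by apply: one_sub_neq0; apply: nc_mul_conj_lt1 => //; exact: ltW.
    have d2 : 1 - s%:C * x * (toC p)^* != 0.
      by apply: one_sub_neq0; apply: nc_mul_conj_lt1 => //; exact/ltW/nsx.
    have b1 := @bs s p s01' p1.
    have b2 : nc (1 - x * (toC p)^*)^-1 <= b.
      by have := @bs 1 p; rewrite rmorph1 mul1r ler01 lexx; exact.
    rewrite (_ : _ - _ = (1 - s)%:C * (x * (toC p)^*) * (1 - s%:C * x * (toC p)^*)^-1 *
       ((1 - x * (toC p)^*)^-1 * (1 - x * (toC p)^*)^-1) * h (toC p)); last first.
      by rewrite rmorphB rmorph1; field; rewrite d1 d2.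
    rewrite [in leLHS]ncM ler_wpM2r ?nc_ge0//.
    have prod4 (a1 a2 a3 a4 : R[i]) :
      nc (a1 * a2 * a3 * (a4 * a4)) = nc a1 * (nc a2 * nc a3 * (nc a4 * nc a4)).
      by rewrite !ncM !mulrA.
    rewrite prod4 nc_real gtr0_norm// (_ : 1 - s = de); last by rewrite sE; ring.
    have h1 : nc (x * (toC p)^*) <= 1.
      by apply/ltW/nc_mul_conj_lt1 => //; exact: ltW.
    rewrite (_ : b ^+ 3 = 1 * b * (b * b)); last by ring.
    rewrite ler_wpM2l//; first exact: ltW.
    apply: ler_pM; rewrite ?mulr_ge0 ?nc_ge0//; apply: ler_pM; rewrite ?mulr_ge0 ?nc_ge0//.
  rewrite RintegralZl//; last exact: integrable_nc.
  rewrite -/N => hN; apply: (@le_trans _ _ (de * K)).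
    have : 2 * (de * b ^+ 3 * N) <= de * K.
      by rewrite /K mulrDr mulr1 -!mulrA [2 * _]mulrCA (mulrCA 2) lerDl ltW.
    by apply: le_trans; rewrite ler_pM2l.
  have -> : e / 2 = e / (2 * K) * K by field; rewrite gt_eqF.
  by rewrite ler_pM2r.
have Js : nc (J - A1%:C * h x) <= e / 2.
  have s1C : (1 - s)%:C != 0 by rewrite -nc_gt0 nc_real normr_gt0 gt_eqF.
  rewrite -(@ler_pM2l _ (1 - s))//.
  have -> : (1 - s) * nc (J - A1%:C * h x) = nc ((1 - s)%:C * (J - A1%:C * h x)).
    by rewrite ncM nc_real gtr0_norm.
  rewrite mulrBr key//.
  have -> : (1 - s)%:C * (A1%:C * h x) = A1%:C * Cint leb `[s, 1] (fun=> h x).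
    have /andP[_ s1] := s01.
    by rewrite Cint_cst//= lebesgue_measure_itv/= lte_fin s1 -EFinB/=; ring.
  rewrite -mulrBr ncM nc_real gtr0_norm// -CintB//; last 2 first.
  - apply: Cintegrable_itv => t; rewrite in_itv/= => ht; exact/line/st01.
  - by apply: Cintegrable_itv => t _; exact: pcontinuous_cst.
  have bd : nc (Cint leb `[s, 1] (fun t => h (x * t%:C) - h x)) <= 2 * (e / (4 * A1) * (1 - s)).
    apply: Cint_itv_bound; first by rewrite ltW// -subr_gt0.
      move=> t; rewrite in_itv/= => ht; apply: pcontinuousB; last exact: pcontinuous_cst.
      exact/line/st01.
    move=> t; rewrite in_itv/= => /andP[st t1]; apply/ltW/H.
    have -> : x * t%:C - x = x * (t - 1)%:C by rewrite rmorphB rmorph1; ring.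
    rewrite ncM nc_real; have -> : `|t - 1| = 1 - t by rewrite distrC ger0_norm ?subr_ge0.
    apply: (@le_lt_trans _ _ (1 - t)); last first.
      apply: (@le_lt_trans _ _ de); first by rewrite lerBlDr addrC -lerBlDr -sE.
      by apply: le_lt_trans de2 _; rewrite ltr_pdivrMr// ltr_pMr// ltr1n.
    by apply: ler_piMl; [rewrite subr_ge0|exact: ltW].
  apply: (le_trans (ler_wpM2l (ltW a0) bd)).
  by rewrite le_eqVlt; apply/orP; left; apply/eqP; field; rewrite gt_eqF.
have -> : I - A1%:C * h x = (I - J) + (J - A1%:C * h x) by ring.
by apply: (le_trans (nc_triangle _ _)); rewrite [e]splitr lerD.
Qed.

End disc_reproducing.
End reproducing.

(** * Discs of any centre and radius *)

Section disc_at.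
Context {R : realType}.
Local Notation mR := (measurableTypeR R).
Local Notation M2 := (mR * mR)%type.
Local Notation leb2 := (@lebesgue2 R).
Local Notation A1 := (@disc_area R).

Definition disc_at (c : R[i]) (r : R) : set M2 := [set p | nc (toC p - c) < r].

Lemma disc_at0 r : disc_at 0 r = disc r.
Proof. by apply/seteqP; split => p; rewrite /disc_at /disc /mkset subr0. Qed.

Lemma measurable_disc_at c r : measurable (disc_at c r).
Proof.
have -> : disc_at c r = setT `&` (fun p => nc (toC p - c) : mR) @^-1` `]-oo, r[.
  by rewrite setTI; apply/seteqP; split => p; rewrite /disc_at /= in_itv.
apply: measurable_nc => //; apply: CmeasurableB; first exact: Cmeasurable_toC.
exact: Cmeasurable_cst.
Qed.

Definition affine2 (k : R) (c : R[i]) (p : M2) : M2 := (k * p.1 + Re c, k * p.2 + Im c).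

Lemma toC_affine2 k c p : toC (affine2 k c p) = k%:C * toC p + c.
Proof. by apply: complex_eq; case: c => a b; rewrite /toC /=; ring. Qed.

Lemma scales_affine2 k c : 0 < k -> scales_measure leb2 (affine2 k c) (k ^- 2).
Proof.
move=> k0; have := scales_measure_comp (lebesgue2_translation (Re c, Im c)) (lebesgue2_dilation k0).
by rewrite mul1r.
Qed.

Lemma affine2_disc_at c r : 0 < r -> affine2 r^-1 (- (r^-1)%:C * c) @^-1` (disc 1) = disc_at c r.
Proof.
move=> r0; have E p : disc 1 (affine2 r^-1 (- (r^-1)%:C * c) p) = disc_at c r p.
  rewrite /disc /disc_at /mkset toC_affine2 mulNr -mulrBr ncM nc_real gtr0_norm ?invr_gt0//.
  by rewrite mulrC ltr_pdivrMr// mul1r.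
by apply/seteqP; split => p; rewrite /preimage /mkset E.
Qed.

Lemma affine2_disc c r : 0 < r -> affine2 r c @^-1` (disc_at c r) = disc 1.
Proof.
move=> r0; have E p : disc_at c r (affine2 r c p) = disc 1 p.
  by rewrite /disc /disc_at /mkset toC_affine2 addrK ncM nc_real gtr0_norm// gtr_pMr.
by apply/seteqP; split => p; rewrite /preimage /mkset E.
Qed.

Lemma disc_at_reproducing (h : R[i] -> R[i]) c r x : 0 < r -> nc x < 1 ->
  (forall w, nc (w - c) < r -> exists l, cderiv h w l) ->
  Cintegrable leb2 (disc_at c r) (fun p => h (toC p)) ->
  Cint leb2 (disc_at c r) (fun p => h (toC p) * (1 - x * (r^-1%:C * (toC p - c))^*)^-1 ^+ 2) =
  (r ^+ 2 * A1)%:C * h (c + r%:C * x).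
Proof.
move=> r0 x1 hh ih; have r0C : r%:C != 0 by rewrite -nc_gt0 nc_real normr_gt0 gt_eqF.
pose k w := h (c + r%:C * w).
have hk : cholomorphic k.
  move=> w w1; have [|l hl] := hh (c + r%:C * w).
    by rewrite addrAC subrr add0r ncM nc_real gtr0_norm// gtr_pMr.
  have d := cderivD (cderiv_cst c w) (cderivZ r%:C (cderiv_id w)).
  by eexists; exact: cderiv_comp d hl.
have rN2 : 0 <= r ^- 2 by rewrite invr_ge0 exprn_ge0// ltW.
have [ik _] := Cint_scales rN2 (scales_affine2 c r0) (measurable_disc_at c r) ih.
rewrite affine2_disc// in ik.
have {}ik : Cintegrable leb2 (disc 1) (fun p => k (toC p)).
  move: ik; rewrite (_ : _ \o _ = (fun p => k (toC p)))//.
  by apply/funext => p /=; rewrite toC_affine2 /k addrC.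
have := disc_reproducing hk ik x1.
have ik2 : Cintegrable leb2 (disc 1) (fun p => k (toC p) * (1 - x * (toC p)^*)^-1 ^+ 2).
  apply: (Cintegrable_bounded_mul (B := ((1 - nc x)^-1) ^+ 2) (measurable_disc 1) ik).
    by apply/CmeasurableX/CmeasurableV; exact: Cmeasurable_one_sub.
  move=> p p1; rewrite ncX; apply: lerXn2r; rewrite ?nnegrE ?nc_ge0 ?invr_ge0 ?subr_ge0 ?(ltW x1)//.
  by apply: nc_inv_one_sub => //; exact: ltW.
have ri : 0 < r^-1 by rewrite invr_gt0.
have r2 : 0 <= r^-1 ^- 2 by rewrite invr_ge0 exprn_ge0// ltW.
have [_] := Cint_scales r2 (scales_affine2 (- (r^-1)%:C * c) ri) (measurable_disc 1) ik2.
rewrite affine2_disc_at// exprVn invrK => + E; rewrite E mulrA -rmorphM => <-.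
apply: eq_Cint => p _; rewrite /comp toC_affine2 mulNr -mulrBr /k.
by rewrite [r%:C * (_ * _)]mulrA -rmorphM/= divff ?gt_eqF// rmorph1 mul1r [c + _]addrC subrK.
Qed.

Lemma disc_at_mean (h : R[i] -> R[i]) c r : 0 < r ->
  (forall w, nc (w - c) < r -> exists l, cderiv h w l) ->
  Cintegrable leb2 (disc_at c r) (fun p => h (toC p)) ->
  Cint leb2 (disc_at c r) (fun p => h (toC p)) = (r ^+ 2 * A1)%:C * h c.
Proof.
move=> r0 hh ih; have z1 : nc (0 : R[i]) < 1 by rewrite nc0.
have := disc_at_reproducing r0 z1 hh ih; rewrite mulr0 addr0 => <-.
by apply: eq_Cint => p _; rewrite mul0r subr0 invr1 expr1n mulr1.
Qed.

(** Clearing [r] from the denominator prepares the use on fibres: there [r] is the modulus of [g]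
    and [r ^+ 2] factors as [g] times its conjugate, which is how the radius enters the kernel of
    the domain. *)
Lemma disc_reproducing_radius (h : R[i] -> R[i]) r x : 0 < r -> nc x < r ->
  (forall w, nc w < r -> exists l, cderiv h w l) ->
  Cintegrable leb2 (disc r) (fun p => h (toC p)) ->
  Cint leb2 (disc r) (fun p => h (toC p) * ((r ^+ 2)%:C - x * (toC p)^*)^-1 ^+ 2) =
  (A1 / r ^+ 2)%:C * h x.
Proof.
move=> r0 xr hh ih; have r0C : r%:C != 0 by rewrite -nc_gt0 nc_real normr_gt0 gt_eqF.
rewrite -disc_at0.
have x1 : nc (r^-1%:C * x) < 1.
  by rewrite ncM nc_real gtr0_norm ?invr_gt0// mulrC ltr_pdivrMr// mul1r.
have hh' w : nc (w - 0) < r -> exists l, cderiv h w l by rewrite subr0; exact: hh.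
have ih' : Cintegrable leb2 (disc_at 0 r) (fun p => h (toC p)) by rewrite disc_at0.
have := disc_at_reproducing r0 x1 hh' ih'.
rewrite add0r [r%:C * (_ * _)]mulrA -rmorphM divff ?gt_eqF// rmorph1 mul1r => E.
have -> : (A1 / r ^+ 2)%:C * h x = (r ^- 4)%:C * ((r ^+ 2 * A1)%:C * h x).
  by rewrite mulrA -rmorphM/=; congr (_%:C * _); field; rewrite gt_eqF.
rewrite -E -CintZ//; [|exact: measurable_disc_at|]; last first.
  apply: (Cintegrable_bounded_mul (B := ((1 - nc (r^-1%:C * x))^-1) ^+ 2) (measurable_disc_at 0 r) ih').
  - apply/CmeasurableX/CmeasurableV/CmeasurableB; first exact: Cmeasurable_cst.
    apply: CmeasurableM; first exact: Cmeasurable_cst.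
    apply: (Cmeasurable_conj (f := fun p => r^-1%:C * (toC p - 0))); apply: CmeasurableM; first exact: Cmeasurable_cst.
    by apply: CmeasurableB; [exact: Cmeasurable_toC|exact: Cmeasurable_cst].
  move=> p; rewrite disc_at0 => pr.
  have h1 : nc (r^-1%:C * (toC p - 0)) <= 1.
    rewrite subr0 ncM nc_real gtr0_norm ?invr_gt0//.
    by rewrite mulrC ler_pdivrMr// mul1r ltW.
  have h2 := nc_inv_one_sub x1 h1.
  rewrite ncX; apply: lerXn2r; rewrite ?nnegrE ?nc_ge0//.
  by rewrite invr_ge0 subr_ge0 ltW.
apply: eq_Cint => p _; rewrite subr0 conjcM conjc_real [RHS]mulrCA; congr (_ * _).
have -> : (r ^+ 2)%:C - x * (toC p)^* = (r ^+ 2)%:C * (1 - r^-1%:C * x * (r^-1%:C * (toC p)^*)).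
  rewrite mulrBr mulr1; congr (_ - _).
  rewrite !mulrA -!rmorphM/= [X in _ = X * _]mulrAC -rmorphM/= [X in X%:C](_ : _ = 1) ?rmorph1 ?mul1r//.
  by field; rewrite gt_eqF.
have invM2 (a b : R[i]) : (a * b)^-1 ^+ 2 = a^-1 ^+ 2 * b^-1 ^+ 2 by rewrite invfM exprMn.
rewrite invM2; congr (_ * _).
by rewrite -fmorphV -rmorphXn/= exprVn -exprM.
Qed.

End disc_at.

(** * Limits at a complex point *)

Section cnbhs.
Context {R : realType}.
Implicit Types (z w : R[i]).

(** A filter on complex numbers given by the modulus. Real-valued limits along it can use the
    continuity of [ln], [atan] and quotients, which is how the logarithm is treated. *)
Definition cnbhs z : set_system R[i] :=
  [set A | exists2 d : R, 0 < d & forall w, nc (w - z) < d -> A w].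

Lemma cnbhs_filter z : Filter (cnbhs z).
Proof.
split.
- by exists 1.
- move=> A B [d d0 hA] [d' d'0 hB]; exists (Num.min d d'); first by rewrite lt_min d0.
  by move=> w; rewrite lt_min => /andP[/hA ? /hB ?].
- by move=> A B AB [d d0 hA]; exists d => // w /hA/AB.
Qed.
#[global] Existing Instance cnbhs_filter.

Lemma cvg_cnbhsP (u : R[i] -> R) z (l : R) : (u w @[w --> cnbhs z] --> l) <->
  forall e : R, 0 < e -> exists2 d : R, 0 < d & forall w, nc (w - z) < d -> `|u w - l| < e.
Proof.
split.
  move=> /cvgrPdist_lt H e e0; have [d d0 hd] := H e e0.
  by exists d => // w /hd /=; rewrite distrC.
move=> H; apply/cvgrPdist_lt => e e0; have [d d0 hd] := H e e0.
by exists d => // w /hd /=; rewrite distrC.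
Qed.

Lemma cvg_Re z : Re w @[w --> cnbhs z] --> Re z.
Proof.
apply/cvg_cnbhsP => e e0; exists e => // w; apply: le_lt_trans.
by have := Re_le_nc (w - z); rewrite ReD ReN.
Qed.

Lemma cvg_Im z : Im w @[w --> cnbhs z] --> Im z.
Proof.
apply/cvg_cnbhsP => e e0; exists e => // w; apply: le_lt_trans.
by have := Im_le_nc (w - z); rewrite ImD ImN.
Qed.

Lemma cvg_nc z : nc w @[w --> cnbhs z] --> nc z.
Proof.
apply/cvg_cnbhsP => e e0; exists e => // w; apply: le_lt_trans.
by have := nc_lower w z; have := nc_lower z w; rewrite (ncB z w) ler_norml; lra.
Qed.

Lemma ccontinuous_ReIm (f : R[i] -> R[i]) z :
  Re (f w) @[w --> cnbhs z] --> Re (f z) -> Im (f w) @[w --> cnbhs z] --> Im (f z) ->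
  ccontinuous_at f z.
Proof.
move=> /cvg_cnbhsP h1 /cvg_cnbhsP h2 e e0; have e2 : 0 < e / 2 by lra.
have [d d0 H1] := h1 _ e2; have [d' d'0 H2] := h2 _ e2.
exists (Num.min d d'); first by rewrite lt_min d0.
move=> w; rewrite lt_min => /andP[/H1 k1 /H2 k2].
by apply: le_lt_trans (nc_le_ReIm _) _; rewrite ReD ReN ImD ImN; lra.
Qed.

Lemma is_derive_eps (f : R -> R) (x l : R) : is_derive x 1 f l ->
  forall e : R, 0 < e -> exists2 d : R, 0 < d &
  forall t, `|t| < d -> `|f (x + t) - f x - l * t| <= e * `|t|.
Proof.
move=> [df dv] e e0.
have : t^-1 *: (f (t *: 1 + x) - f x) @[t --> (0 : R)^'] --> l by rewrite -dv; exact: df.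
move=> /cvgrPdist_le/(_ e e0)[d /= d0 H]; exists d => // t td.
have [->|t0] := eqVneq t 0; first by rewrite addr0 subrr mulr0 subr0 normr0 mulr0.
have := H t; rewrite /ball_/= sub0r normrN => /(_ td t0).
rewrite /GRing.scale/= mulr1 => h.
have -> : f (x + t) - f x - l * t = - (l - t^-1 * (f (t + x) - f x)) * t.
  by rewrite [t + x]addrC; field.
by rewrite normrM normrN ler_wpM2r.
Qed.

End cnbhs.

(** * Complex exponential, logarithm and powers *)

Section cpow.
Context {R : realType}.
Implicit Types (z w : R[i]) (a : R).

Definition cexp z : R[i] := (expR (Re z))%:C * (cos (Im z) +i* sin (Im z)).

Lemma nc_cis (y : R) : nc (cos y +i* sin y) = 1.
Proof. by rewrite /= cos2Dsin2 sqrtr1. Qed.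

Lemma nc_cexp z : nc (cexp z) = expR (Re z).
Proof. by rewrite /cexp ncM nc_cis mulr1 nc_real gtr0_norm// expR_gt0. Qed.

Lemma cexpD z w : cexp (z + w) = cexp z * cexp w.
Proof.
rewrite /cexp ReD ImD expRD rmorphM/=.
rewrite -!mulrA; congr (_ * _); rewrite mulrCA; congr (_ * _).
by rewrite cosD sinD; apply: complex_eq => /=; ring.
Qed.

Lemma cexp0 : cexp 0 = 1.
Proof. by rewrite /cexp /= expR0 cos0 sin0; apply: complex_eq => /=; ring. Qed.

Lemma cexp_neq0 z : cexp z != 0.
Proof. by rewrite -nc_gt0 nc_cexp expR_gt0. Qed.

Lemma cderiv_cexp0 : cderiv cexp 0 1.
Proof.
(* The 9 counts error terms of size [e1 * |h|]: one from the real exponential, six from the cosine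
   and sine multiplied by an exponential of at most 3, and two from the mixed product. *)
move=> e e0; have [e1 [e10 e11 e19]] : exists e1 : R, [/\ 0 < e1, e1 <= 1 & e1 <= e / 9].
  exists (Num.min 1 (e / 9)).
  by split; rewrite ?lt_min ?ltr01 ?divr_gt0// ge_min lexx ?orbT.
have [d1 d10 H1] := is_derive_eps (is_derive_expR 0) e10.
have [d2 d20 H2] := is_derive_eps (is_derive_cos 0) e10.
have [d3 d30 H3] := is_derive_eps (is_derive_sin 0) e10.
exists (Num.min (Num.min d1 e1) (Num.min d2 d3)); first by rewrite !lt_min d10 e10 d20.
move=> h; rewrite subr0 cexp0 mul1r !lt_min => /andP[/andP[hd1 he1] /andP[hd2 hd3]].
have Rh := Re_le_nc h; have Ih := Im_le_nc h.
set x := Re h in Rh; set y := Im h in Ih; set n := nc h in Rh Ih hd1 he1 hd2 hd3 *.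
have n0 : 0 <= n by exact: nc_ge0.
have := H1 x (le_lt_trans Rh hd1); rewrite add0r expR0 mul1r => h1.
have := H2 y (le_lt_trans Ih hd2); rewrite add0r cos0 sin0 oppr0 mul0r subr0 => h2.
have := H3 y (le_lt_trans Ih hd3); rewrite add0r cos0 sin0 mul1r subr0 => h3.
have -> : cexp h - 1 - h = (expR x - 1 - x)%:C +
    ((expR x)%:C * ((cos y - 1) +i* (sin y - y)) + 'i%C * ((expR x - 1) * y)%:C).
  by rewrite /cexp -/x -/y; apply: complex_eq; rewrite ?ReD ?ImD ?ReN ?ImN ?ReM ?ImM /= -/x -/y; ring.
have ex1 : `|expR x - 1| <= 2 * n.
  rewrite -[expR x - 1](subrK x) (le_trans (ler_normD _ _))//.
  have : e1 * `|x| <= 1 * n by apply: ler_pM => //; exact: ltW.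
  by lra.
have ex : expR x <= 3.
  have : expR x - 1 <= `|expR x - 1| by exact: ler_norm.
  by lra.
have b1 : nc (expR x - 1 - x)%:C <= e1 * n.
  by rewrite nc_real (le_trans h1)// ler_wpM2l// ltW.
have b2 : nc ((expR x)%:C * ((cos y - 1) +i* (sin y - y))) <= 6 * (e1 * n).
  rewrite ncM nc_real gtr0_norm ?expR_gt0//.
  have : nc ((cos y - 1) +i* (sin y - y)) <= 2 * (e1 * n).
    apply: (le_trans (nc_le_ReIm _)) => /=.
    have : e1 * `|y| <= e1 * n by rewrite ler_wpM2l// ltW.
    by lra.
  move=> hc; apply: (@le_trans _ _ (3 * (2 * (e1 * n)))); last by rewrite mulrA; lra.
  by apply: ler_pM; rewrite ?nc_ge0 ?expR_ge0.
have b3 : nc ('i%C * ((expR x - 1) * y)%:C) <= 2 * (e1 * n).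
  rewrite ncM nc_real normrM (_ : nc 'i = 1) ?mul1r; last by rewrite /= expr0n expr1n add0r sqrtr1.
  apply: (@le_trans _ _ (2 * n * n)); first by apply: ler_pM.
  by rewrite -mulrA ler_pM2l// ler_wpM2r// ltW.
apply: (le_trans (nc_triangle _ _)); have := nc_triangle ((expR x)%:C * ((cos y - 1) +i* (sin y - y))) ('i%C * ((expR x - 1) * y)%:C).
have : 9 * (e1 * n) <= e * n by rewrite mulrA ler_wpM2r//; lra.
by lra.
Qed.

Lemma cderiv_cexp z : cderiv cexp z (cexp z).
Proof.
have -> : cexp = (fun w => cexp z * cexp (w - z)).
  by apply/funext => w; rewrite -cexpD addrC subrK.
rewrite subrr cexp0 mulr1; rewrite -[X in cderiv _ _ X]mulr1; apply: cderivZ.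
have d := cderivB (cderiv_id z) (cderiv_cst z z).
have := cderiv_comp d (m := 1); rewrite subrr => /(_ _ cderiv_cexp0).
by rewrite subr0 mulr1.
Qed.

(** Continuity of [f] lets the expansion of [E] be applied at [f w]. Since
    [E (f w) - E (f z) = w - z], that expansion bounds [|f w - f z|] by [2 |w - z| / |m|], after
    which it can be solved for [f w - f z]. *)
Lemma cderiv_left_inverse (f E : R[i] -> R[i]) z m (d0 : R) : 0 < d0 ->
  (forall w, nc (w - z) < d0 -> E (f w) = w) -> ccontinuous_at f z ->
  cderiv E (f z) m -> m != 0 -> cderiv f z m^-1.
Proof.
move=> d00 Ef fc dE m0 e e0.
have nm : 0 < nc m by rewrite nc_gt0.
pose e1 := Num.min (nc m / 2) (e * nc m ^+ 2 / 2).
have e10 : 0 < e1 by rewrite lt_min !divr_gt0// mulr_gt0// exprn_gt0.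
have [e11 e12] : e1 <= nc m / 2 /\ e1 <= e * nc m ^+ 2 / 2.
  by rewrite /e1; split; rewrite ge_min lexx ?orbT.
have [d1 d10 H1] := dE _ e10; have [d2 d20 H2] := fc _ d10.
exists (Num.min d0 d2); first by rewrite lt_min d00.
move=> w; rewrite lt_min => /andP[wd0 wd2].
have := H1 _ (H2 _ wd2); rewrite Ef// Ef ?subrr ?nc0//.
set u := f w - f z => h1.
have ub : nc u <= 2 / nc m * nc (w - z).
  have h2 : nc m * nc u <= nc (w - z) + nc m / 2 * nc u.
    have := nc_subadd (w - z) (w - z - m * u); rewrite opprB addrCA subrr addr0 ncM.
    have : e1 * nc u <= nc m / 2 * nc u by rewrite ler_wpM2r ?nc_ge0.
    by lra.
  rewrite mulrAC ler_pdivlMr//; lra.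
have -> : u - m^-1 * (w - z) = - m^-1 * (w - z - m * u) by field.
rewrite ncM ncN ncV mulrC ler_pdivrMr//; apply: (le_trans h1).
apply: (@le_trans _ _ (e1 * (2 / nc m * nc (w - z)))); first by rewrite ler_wpM2l// ltW.
apply: (@le_trans _ _ (e * nc m ^+ 2 / 2 * (2 / nc m * nc (w - z)))).
  by rewrite ler_wpM2r// mulr_ge0 ?nc_ge0// divr_ge0// nc_ge0.
by rewrite le_eqVlt; apply/orP; left; apply/eqP; field; lra.
Qed.

(** The principal branch on the right half-plane, where the arctangent of the slope is the argument;
    [1 - z] stays in that half-plane for [|z| < 1]. *)
Definition clog z : R[i] := ln (nc z) +i* atan (Im z / Re z).

Lemma cexp_clog z : 0 < Re z -> cexp (clog z) = z.
Proof.
move=> x0; rewrite /cexp /clog /=.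
have nz : 0 < nc z by apply: lt_le_trans x0 _; apply: le_trans (Re_le_nc _); exact: ler_norm.
rewrite lnK ?posrE//; set t := Im z / Re z.
have sn : sin (atan t) = t * cos (atan t).
  have h : sin (atan t) / cos (atan t) = t by exact: atanK.
  rewrite -[X in _ = X * _]h divfK//.
  by rewrite cos_atan invr_eq0 sqrtr_eq0 -ltNge ltr_pwDl// sqr_ge0.
have nzE : nc z = Re z * Num.sqrt (1 + t ^+ 2).
  rewrite -[LHS]ger0_norm ?nc_ge0// -sqrtr_sqr sqr_nc.
  rewrite -[X in X * Num.sqrt _](ger0_norm (ltW x0)) -sqrtr_sqr -sqrtrM ?sqr_ge0//.
  by congr Num.sqrt; rewrite /t; field; rewrite gt_eqF.
have q0 : Num.sqrt (1 + t ^+ 2) != 0 by rewrite sqrtr_eq0 -ltNge ltr_pwDl// sqr_ge0.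
have c1 : nc z * cos (atan t) = Re z by rewrite cos_atan nzE mulfK.
apply: complex_eq; rewrite ?ReM ?ImM /= ?mul0r ?subr0 ?addr0//.
by rewrite sn mulrCA c1 /t divfK// gt_eqF.
Qed.

Lemma ccontinuous_clog z : 0 < Re z -> ccontinuous_at clog z.
Proof.
move=> x0.
have nz : 0 < nc z by apply: lt_le_trans x0 _; apply: le_trans (Re_le_nc _); exact: ler_norm.
apply: ccontinuous_ReIm => /=.
  by apply: (continuous_cvg _ (continuous_ln nz)); exact: cvg_nc.
apply: (continuous_cvg _ (@continuous_atan _ (Im z / Re z))).
apply: cvgM; first exact: cvg_Im.
by apply: cvgV; [rewrite gt_eqF|exact: cvg_Re].
Qed.

Lemma cderiv_clog z : 0 < Re z -> cderiv clog z z^-1.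
Proof.
(* Within distance [Re z] of [z] the real part stays positive, so [clog] is inverted by [cexp]
   there. *)
move=> x0; apply: (@cderiv_left_inverse clog cexp z z (Re z)) => //.
- move=> w wz; apply: cexp_clog.
  have := le_lt_trans (Re_le_nc (w - z)) wz; rewrite ReD ReN ltr_norml; lra.
- exact: ccontinuous_clog.
- by have := cderiv_cexp (clog z); rewrite cexp_clog.
- by apply/eqP => z0; move: x0; rewrite z0 ltxx.
Qed.

Definition cpow a z : R[i] := cexp (a%:C * clog z).

Lemma cpow_neq0 a z : cpow a z != 0.
Proof. exact: cexp_neq0. Qed.

Lemma nc_cpow a z : z != 0 -> nc (cpow a z) = nc z `^ a.
Proof.
move=> z0; rewrite nc_cexp ReM/= mul0r subr0 /powR ifF//.
by apply/negP => /eqP/ComplexField.Normc.eq0_normc; apply/eqP.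
Qed.

Lemma cderiv_cpow a z : 0 < Re z -> exists l, cderiv (cpow a) z l.
Proof.
move=> x0; eexists; apply: (cderiv_comp (f := fun z => a%:C * clog z)).
  exact: cderivZ _ (cderiv_clog x0).
exact: cderiv_cexp.
Qed.

End cpow.

(** * Power integrals on the unit interval *)

Section power_integrals.
Context {R : realType}.
Local Notation leb := (@lebesgue_measure R).
Local Notation mR := (measurableTypeR R).

Lemma is_derive_one_sub_powR (k r : R) : r < 1 ->
  is_derive r 1 (fun r : R => (1 - r) `^ k) (- (k * (1 - r) `^ (k - 1))).
Proof.
move=> r1; have d0 : 0 < 1 - r by lra.
have h : is_derive r 1 (fun r : R => 1 - r) (- 1).
  have := is_deriveB (is_derive_cst (1 : R) r (1 : R)) (is_derive_id r (1 : R)).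
  by rewrite sub0r.
have := @is_derive1_comp _ (fun x : R => x `^ k) (fun r : R => 1 - r) r _ _ (is_derive1_powR k d0) h.
by rewrite mulrN1.
Qed.

Lemma measurable_one_sub_powR (k : R) (A : set mR) :
  measurable_fun A (fun r : mR => (1 - r) `^ k).
Proof.
apply: (measurableT_comp (f := fun x : R => x `^ k)); first exact: measurable_powR.
by apply: measurable_funB.
Qed.

Lemma integral_one_sub_powR (k a b : R) : a <= b -> b < 1 -> k + 1 != 0 ->
  (\int[leb]_(r in `[a, b]) ((1 - r) `^ k)%:E =
   (((1 - a) `^ (k + 1) - (1 - b) `^ (k + 1)) / (k + 1))%:E)%E.
Proof.
move=> ab b1 k1; move: ab; rewrite le_eqVlt => /predU1P[->|ab].
  by rewrite subrr mul0r set_itv1 integral_set1.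
have cf : {in `[a, b], forall r : R, {for r, continuous (fun r : R => (1 - r) `^ k)}}.
  move=> r; rewrite in_itv/= => /andP[_ rb].
  have [|dr _] := @is_derive_one_sub_powR k r; first lra.
  by apply: differentiable_continuous; apply/derivable1_diffP.
have dF r : r \in `[a, b] -> is_derive r 1 (fun r : R => - (k + 1)^-1 * (1 - r) `^ (k + 1)) ((1 - r) `^ k).
  rewrite in_itv/= => /andP[_ rb].
  have [|dr _] := @is_derive_one_sub_powR k r; first lra.
  have := @is_derive_one_sub_powR (k + 1) r; rewrite addrK => /(_ _) d.
  have {}d : is_derive r 1 (fun r : R => (1 - r) `^ (k + 1)) (- ((k + 1) * (1 - r) `^ k)) by apply: d; lra.
  have {}d := @is_deriveZ _ _ _ _ (- (k + 1)^-1) _ _ _ d.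
  rewrite (_ : (1 - r) `^ k = - (k + 1)^-1 *: (- ((k + 1) * (1 - r) `^ k)))//.
  by rewrite /GRing.scale/=; field.
have FT := congr1 EFin (FTC2_real ab dF cf); rewrite /Rintegral fineK in FT.
  by rewrite FT; congr EFin; field.
apply: integrable_fin_num => //; apply: continuous_compact_integrable; first exact: segment_compact.
by apply: continuous_in_subspaceT => r; rewrite inE; exact: cf.
Qed.

(** Monotone convergence along the intervals [[b, t n]]; the maximum in [t n] keeps them from being
    empty. *)
Lemma ge0_integral_improper (f : mR -> \bar R) (b : R) (M : \bar R) : b < 1 ->
  measurable_fun setT f -> (forall r, (0 <= f r)%E) ->
  (forall t, b <= t < 1 -> (\int[leb]_(r in `[b, t]) f r <= M)%E) ->
  (\int[leb]_(r in `[b, 1%R[) f r <= M)%E.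
Proof.
move=> b1 mf f0 H.
pose t n : R := Num.max b (1 - n.+1%:R^-1).
pose F n : set mR := `[b, t n]%classic.
have tn n : b <= t n < 1.
  by rewrite /t le_max lexx/= gt_max b1/= ltrBlDr ltrDl invr_gt0.
have ndF : nondecreasing_seq F.
  apply/nondecreasing_seqP => n; rewrite subsetEset => x; rewrite /F/= !in_itv/= => /andP[-> xt]/=.
  apply: (le_trans xt); rewrite /t ge_max !le_max lexx/= lerD2l lerN2.
  by rewrite lef_pV2 ?posrE// ler_nat leqnSn orbT.
have UF : \bigcup_n F n = `[b, 1[%classic.
  apply/seteqP; split => x.
    move=> [n _]; rewrite /F/= !in_itv/= => /andP[-> xt]/=.
    by have /andP[_] := tn n; exact: le_lt_trans.
  rewrite /= in_itv/= => /andP[bx x1].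
  have x0 : 0 < 1 - x by lra.
  have [n] : exists n, n.+1%:R^-1 < 1 - x.
    have := ltr_add_invr x0; move=> [n]; rewrite add0r => h; exists n; exact: h.
  move=> hn; exists n => //; rewrite /F/= in_itv/= bx/= /t le_max; apply/orP; right.
  by rewrite lerBrDr -lerBrDl ltW.
have mF n : measurable (F n) by exact: measurable_itv.
have mfF n : measurable_fun (F n) f by exact: measurable_funTS.
have f0F n x : F n x -> (0 <= f x)%E by [].
have h := ge0_nondecreasing_set_cvg_integral (mu := leb) ndF mF mfF f0F.
rewrite UF in h.
rewrite -(cvg_lim _ h)//; apply: lime_le; first by apply/cvg_ex; eexists; exact: h.
by apply: nearW => n; exact: H.
Qed.

Lemma powR_antitone (x y k : R) : 0 < x -> x <= y -> 0 <= k -> y `^ (- k) <= x `^ (- k).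
Proof.
move=> x0 xy k0; have y0 : 0 < y by exact: lt_le_trans xy.
rewrite !powRN lef_pV2 ?posrE ?powR_gt0//.
by apply: ge0_ler_powR; rewrite ?nnegrE// ltW.
Qed.

Lemma integral_two_powers (A B c de : R) : A < 1 -> 0 < c -> 0 <= B -> 0 <= A -> A + B = 1 + c ->
  0 < de <= 1 ->
  (\int[leb]_(r in `[0%R, 1%R[) ((1 - r) `^ (- A) * (1 - (1 - de) * r) `^ (- B))%:E <=
   (((1 - A)^-1 + c^-1) * de `^ (- c))%:E)%E.
Proof.
move=> A1 c0 B0 A0 AB /andP[de0 de1].
pose b := 1 - de; have b01 : 0 <= b < 1 by rewrite /b; lra.
pose f (r : mR) : \bar R := ((1 - r) `^ (- A) * (1 - b * r) `^ (- B))%:E.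
have f0 r : (0 <= f r)%E by rewrite lee_fin mulr_ge0 ?powR_ge0.
have mf : measurable_fun setT f.
  apply/measurable_EFinP; apply: measurable_funM; first exact: measurable_one_sub_powR.
  apply: (measurableT_comp (f := fun x : R => x `^ (- B))); first exact: measurable_powR.
  by apply: measurable_funB => //; exact: measurable_funM.
have UE : (`[0, 1[%classic : set mR) = `[0, b] `|` `]b, 1[.
  apply/seteqP; split => x /=; rewrite !in_itv/=.
    by move=> /andP[-> ->]; rewrite andbT; have [_|_] := leP x b; [left|right].
  by move=> [/andP[-> /=]|/andP[+ ->]]; lra.
rewrite [leLHS](_ : _ = \int[leb]_(r in `[0%R, 1%R[) f r)%E//.
rewrite [leLHS](_ : _ = \int[leb]_(r in `[0%R, b] `|` `]b, 1%R[) f r)%E; last by rewrite -UE.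
rewrite ge0_integral_setU; last 5 first.
- exact: measurable_itv.
- exact: measurable_itv.
- exact: measurable_funTS.
- by [].
- by apply/disj_setPS => x [/=]; rewrite !in_itv/=; lra.
have dc : 0 <= de `^ (- c) by exact: powR_ge0.
rewrite mulrDl [X in X%:E]addrC EFinD; apply: leeD.
  apply: (@le_trans _ _ (\int[leb]_(r in `[0%R, b]) ((1 - r) `^ (- (1 + c)))%:E)%E).
    apply: ge0_le_integral => //.
    - exact: measurable_funTS.
    - by apply/measurable_EFinP; exact: measurable_one_sub_powR.
    move=> r; rewrite /= in_itv/= => /andP[r0 rb]; rewrite lee_fin.
    have r1 : 0 < 1 - r by lra.
    apply: (@le_trans _ _ ((1 - r) `^ (- A) * (1 - r) `^ (- B))).
      rewrite ler_wpM2l ?powR_ge0//; apply: powR_antitone => //.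
      by rewrite lerD2l lerN2 ler_piMl//; lra.
    rewrite -powRD ?(gt_eqF r1) ?implybT// le_eqVlt; apply/orP; left; apply/eqP.
    by congr powR; lra.
  rewrite integral_one_sub_powR; [|lra|lra|lra].
  rewrite lee_fin (_ : - (1 + c) + 1 = - c); last by ring.
  rewrite subr0 powR1 (_ : 1 - b = de); last by rewrite /b; ring.
  rewrite invrN mulrN -mulNr opprB mulrC ler_wpM2l ?invr_ge0 ?(ltW c0)//; lra.
apply: (@le_trans _ _ (\int[leb]_(r in `[b, 1%R[) (de `^ (- B) * (1 - r) `^ (- A))%:E)%E).
  apply: (@le_trans _ _ (\int[leb]_(r in `]b, 1%R[) (de `^ (- B) * (1 - r) `^ (- A))%:E)%E).
    apply: ge0_le_integral => //.
    - exact: measurable_funTS.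
    - by apply/measurable_EFinP/measurable_funM => //; exact: measurable_one_sub_powR.
    move=> r; rewrite /= in_itv/= => /andP[br r1]; rewrite lee_fin mulrC.
    rewrite ler_wpM2r ?powR_ge0//; apply: powR_antitone => //.
    have : b * r <= b * 1 by apply: ler_wpM2l; lra.
    by rewrite /b; lra.
  apply: ge0_subset_integral.
  - exact: measurable_itv.
  - exact: measurable_itv.
  - by apply/measurable_EFinP/measurable_funM => //; exact: measurable_one_sub_powR.
  - by move=> r _; rewrite lee_fin mulr_ge0 ?powR_ge0.
  - by move=> r /=; rewrite !in_itv/= => /andP[/ltW -> ->].
apply: ge0_integral_improper; first lra.
- by apply/measurable_EFinP/measurable_funM => //; exact: measurable_one_sub_powR.
- by move=> r; rewrite lee_fin mulr_ge0 ?powR_ge0.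
move=> t /andP[bt t1].
under eq_integral do rewrite EFinM.
rewrite ge0_integralZl_EFin ?powR_ge0//; last 2 first.
- by move=> r _; rewrite lee_fin powR_ge0.
- by apply/measurable_EFinP; exact: measurable_one_sub_powR.
rewrite integral_one_sub_powR//; last lra.
rewrite -EFinM lee_fin (_ : 1 - b = de); last by rewrite /b; ring.
rewrite (_ : - A + 1 = 1 - A); last by ring.
have -> : (1 - A)^-1 * de `^ (- c) = de `^ (- B) * (de `^ (1 - A) / (1 - A)).
  rewrite mulrC mulrA -powRD ?(gt_eqF de0) ?implybT//; congr (_ `^ _ / _).
  by lra.
rewrite ler_wpM2l ?powR_ge0// ler_wpM2r ?invr_ge0; [by []|lra|].
by rewrite gerBl powR_ge0.
Qed.

End power_integrals.

(** * Forelli-Rudin estimates on the unit disc *)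

Section forelli_rudin.
Context {R : realType}.
Local Notation leb := (@lebesgue_measure R).
Local Notation mR := (measurableTypeR R).
Local Notation M2 := (mR * mR)%type.
Local Notation leb2 := (@lebesgue2 R).
Local Notation A1 := (@disc_area R).

(** Up to normalisation, the inverse modulus of the Szego kernel; its power -2 is the modulus of the
    Bergman kernel. *)
Definition szego (z : R[i]) (p : M2) : R := nc (1 - z * (toC p)^*).

Lemma szego_gt0 z p : nc z <= 1 -> disc 1 p -> 0 < szego z p.
Proof. by move=> z1 p1; rewrite nc_gt0; apply: one_sub_neq0; exact: nc_mul_conj_lt1. Qed.

Lemma szego_ge0 z p : 0 <= szego z p.
Proof. exact: nc_ge0. Qed.

Lemma measurable_szego z (A : set M2) : measurable_fun A (szego z).
Proof. by apply: measurable_nc; exact: Cmeasurable_one_sub. Qed.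

Lemma measurable_szegoV z k (A : set M2) : measurable_fun A (fun p => (szego z p) ^- k).
Proof.
apply: measurable_inv_ge0; first by move=> p; rewrite exprn_ge0// szego_ge0.
by apply: measurable_funX; exact: measurable_szego.
Qed.

(** On a circle the squared modulus of the kernel is the holomorphic function
    [w |-> (1 - z^* * w)^-1] times the Cauchy kernel, so Cauchy's formula evaluates that function at
    [z |p|^2]. *)
Lemma kernel_average z p : nc z <= 1 -> disc 1 p ->
  (\int[leb]_(u in `[0%R, 1%R]) (szego z (rotation u p) ^- 2)%:E =
   ((1 - nc z ^+ 2 * sqnc p)^-1)%:E)%E.
Proof.
move=> z1 p1.
pose h w : R[i] := (1 - z^* * w)^-1.
have hh : cholomorphic h.
  move=> w w1; apply: cderiv_affine_inv; apply: one_sub_neq0.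
  by have := nc_mul_conj_lt1 z1 w1; rewrite !ncM !nc_conj.
have := cauchy_mean hh p1 z1.
have E u : h (ecirc u * toC p) / (1 - z * (ecirc u * toC p)^*) = (szego z (rotation u p) ^- 2)%:C.
  rewrite /h /szego toC_rotation -[X in X / _]conjcK conj_affine_inv.
  by rewrite mulrC mulc_conj ncV exprVn.
have hv : h (z * (nc (toC p) ^+ 2)%:C) = ((1 - nc z ^+ 2 * sqnc p)^-1)%:C.
  rewrite /h /sqnc mulrA [z^* * z]mulrC mulc_conj -rmorphM -[X in (X - _)^-1](rmorph1 (real_complex R)).
  by rewrite -rmorphB fmorphV.
under eq_Cint do rewrite E; rewrite hv => /(congr1 (@complex.Re R)) /= Ei.
rewrite -Ei /Rintegral fineK//.
apply: integrable_fin_num => //; apply: continuous_compact_integrable; first exact: segment_compact.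
apply: continuous_in_subspaceT => u _.
have /pcontinuous_ReIm[+ _] : pcontinuous_at (fun u => h (ecirc u * toC p) / (1 - z * (ecirc u * toC p)^*)) u.
  have c0 : pcontinuous_at (fun u => h (ecirc u * toC p)) u.
    apply: (@pcontinuous_comp _ h (fun u => ecirc u * toC p)).
      by apply: pcontinuousM; [exact: pcontinuous_ecirc|exact: pcontinuous_cst].
    have ep1 : nc (ecirc u * toC p) < 1 by rewrite ncM nc_ecirc mul1r.
    by have [l hl] := hh _ ep1; exact: cderiv_continuous hl.
  apply: pcontinuousM => //.
  have -> : (fun u => (1 - z * (ecirc u * toC p)^*)^-1) = (fun u => (h (ecirc u * toC p))^*).
    by apply/funext => v; rewrite /h conj_affine_inv.
  have [c1 c2] := pcontinuous_ReIm c0.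
  apply: ReIm_pcontinuous.
    by rewrite /prop_for/continuous_at Re_conj; under eq_fun do rewrite Re_conj.
  rewrite /prop_for/continuous_at Im_conj; under eq_fun do rewrite Im_conj.
  exact: cvgN.
by rewrite /prop_for/continuous_at E /=; under eq_fun do rewrite E /=.
Qed.

Lemma one_sub_gt0 z (r : R) : nc z <= 1 -> 0 <= r < 1 -> 0 < 1 - nc z ^+ 2 * r.
Proof.
move=> z1 /andP[r0 r1]; have : nc z ^+ 2 * r <= 1 * r.
  by rewrite ler_wpM2r// expr_le1// nc_ge0.
lra.
Qed.

Lemma sqnc_itv (p : M2) : disc 1 p -> 0 <= sqnc p < 1.
Proof.
move=> p1; rewrite /sqnc exprn_ge0 ?nc_ge0//=.
by have := p1; rewrite /disc /mkset => h; rewrite expr_lt1// nc_ge0.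
Qed.

Lemma integral_kernel_radial z (Phi : mR -> R) : nc z <= 1 ->
  measurable_fun setT Phi -> (forall r, 0 <= Phi r) ->
  (\int[leb2]_(p in disc 1) (szego z p ^- 2 * Phi (sqnc p))%:E =
   A1%:E * \int[leb]_(r in `[0%R, 1%R[) (Phi r / (1 - nc z ^+ 2 * r))%:E)%E.
Proof.
move=> z1 mPhi Phi0.
have mPs (A : set M2) : measurable_fun A (fun p => Phi (sqnc p)).
  by apply: (measurableT_comp mPhi); apply: measurable_funTS; exact: measurable_sqnc.
have mf : measurable_fun (disc 1) (fun p => szego z p ^- 2 * Phi (sqnc p)).
  by apply: measurable_funM => //; exact: measurable_szegoV.
rewrite (rotation_average_ge0 mf); last first.
  by move=> p; rewrite mulr_ge0 ?invr_ge0 ?exprn_ge0 ?szego_ge0.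
(* The absolute value makes [F] nonnegative and measurable on the whole line; on [[0, 1[] it changes
   nothing. *)
pose F (r : mR) : \bar R := (Phi r * `|1 - nc z ^+ 2 * r|^-1)%:E.
have mF (A : set mR) : measurable_fun A F.
  apply/measurable_EFinP; apply: measurable_funM; first exact: measurable_funTS.
  apply: measurable_inv_ge0 => //; apply: measurableT_comp => //.
  by apply: measurable_funB => //; exact: measurable_funM.
transitivity (\int[leb2]_(p in disc 1) F (sqnc p))%E.
  apply: eq_integral => p; rewrite inE => p1.
  transitivity (\int[leb]_(u in `[0%R, 1%R]) ((Phi (sqnc p))%:E * (szego z (rotation u p) ^- 2)%:E))%E.
    apply: eq_integral => u _; rewrite -EFinM mulrC; congr (_ * _)%:E.
    by rewrite /sqnc toC_rotation ncM nc_ecirc mul1r.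
  rewrite ge0_integralZl_EFin//; last 2 first.
  - by move=> u _; rewrite lee_fin invr_ge0 exprn_ge0// szego_ge0.
  - apply/measurable_EFinP; apply: measurable_inv_ge0; first by move=> u; rewrite exprn_ge0// szego_ge0.
    apply: measurable_funX; rewrite /szego.
    have -> : (fun u => nc (1 - z * (toC (rotation u p))^*)) = (fun u => nc (1 - z * (ecirc u * toC p)^*)).
      by apply/funext => u; rewrite toC_rotation.
    have me : Cmeasurable (`[0, 1]%classic : set mR) (fun u : mR => ecirc u).
      by apply: (@Cintegrable_measurable _ _ _ leb); apply: Cintegrable_itv => u _; exact: pcontinuous_ecirc.
    apply: measurable_nc; apply: CmeasurableB; first exact: Cmeasurable_cst.
    apply: CmeasurableM; first exact: Cmeasurable_cst.
    apply: (Cmeasurable_conj (f := fun u => ecirc u * toC p)).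
    by apply: CmeasurableM => //; exact: Cmeasurable_cst.
  rewrite kernel_average// -EFinM /F gtr0_norm//.
  by apply: one_sub_gt0 => //; exact: sqnc_itv.
rewrite ge0_integral_radial//; last first.
  by move=> r _; rewrite lee_fin mulr_ge0// invr_ge0.
congr (_ * _)%E; apply: eq_integral => r; rewrite inE/= in_itv/= => r01.
by rewrite /F gtr0_norm//; exact: one_sub_gt0.
Qed.

Lemma forelli_rudin (c : R) : 0 < c < 1 -> exists2 C : R, 0 < C & forall z, nc z < 1 ->
  (\int[leb2]_(p in disc 1) (szego z p ^- 2 * (1 - sqnc p) `^ (- c))%:E <=
   (C * (1 - nc z ^+ 2) `^ (- c))%:E)%E.
Proof.
move=> /andP[c0 c1]; exists (A1 * ((1 - c)^-1 + c^-1)).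
  by rewrite mulr_gt0 ?disc_area_gt0// addr_gt0 ?invr_gt0//; lra.
move=> z z1.
have mP : measurable_fun setT (fun r : mR => (1 - r) `^ (- c)) by exact: measurable_one_sub_powR.
have P0 (r : mR) : 0 <= (1 - r) `^ (- c) by exact: powR_ge0.
rewrite [leLHS](integral_kernel_radial (ltW z1) mP P0).
have d1 : 0 < 1 - nc z ^+ 2 <= 1.
  by rewrite gerBl exprn_ge0 ?nc_ge0// andbT subr_gt0 expr_lt1// nc_ge0.
have := @integral_two_powers _ c 1 c (1 - nc z ^+ 2) c1 c0 ler01 (ltW c0) (addrC _ _) d1.
have a0 : (0 <= A1%:E)%E by rewrite lee_fin ltW// disc_area_gt0.
move=> /(lee_wpmul2l a0); rewrite -EFinM mulrA; apply: le_trans.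
rewrite le_eqVlt; apply/orP; left; apply/eqP; congr (_ * _)%E.
apply: eq_integral => r; rewrite inE/= in_itv/= => r01.
rewrite subKr powR_inv1//; exact/ltW/one_sub_gt0/r01/ltW.
Qed.

(* Young's inequality [X^(1-u) Y^u <= (1-u) m^u X + u m^(u-1) Y]; with
   [m = (1 - |z|^2 r) / (1 - r)] the circle averages of both terms agree. *)
Lemma young_weight (X Y u m : R) : 0 < X -> 0 < Y -> 0 < u < 1 -> 0 < m ->
  X `^ (1 - u) * Y `^ u <= (1 - u) * (m `^ u * X) + u * (m `^ (u - 1) * Y).
Proof.
move=> X0 Y0 /andP[u0 u1] m0.
have q0 : 0 < (1 - u)^-1 by rewrite invr_gt0; lra.
have p0 : 0 < u^-1 by rewrite invr_gt0.
have S : (1 - u)^-1^-1 + u^-1^-1 = 1 by rewrite !invrK; lra.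
have X' : 0 <= (m `^ u * X) `^ (1 - u) by exact: powR_ge0.
have Y' : 0 <= (m `^ (u - 1) * Y) `^ u by exact: powR_ge0.
have := conjugate_powR X' Y' q0 p0 S.
rewrite -!powRrM !divff ?(gt_eqF u0) ?subr_eq0 ?(gt_eqF u1)//.
have mX : 0 <= m `^ u * X by rewrite mulr_ge0 ?powR_ge0 ?ltW.
have mY : 0 <= m `^ (u - 1) * Y by rewrite mulr_ge0 ?powR_ge0 ?ltW.
rewrite !powRr1// !invrK [_ * (1 - u)]mulrC [_ * u]mulrC; apply: le_trans.
rewrite !powRM ?powR_ge0 ?(ltW X0) ?(ltW Y0)// -!powRrM mulrACA -powRD ?(gt_eqF m0) ?implybT//.
by rewrite (_ : u * (1 - u) + (u - 1) * u = 0) ?powRr0 ?mul1r//; ring.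
Qed.

(** The product of kernels at [z] and at the boundary point 1 has no closed circle average. Young's
    inequality with a radial parameter splits it into two terms that do, and both reduce to the same
    integral of [(1 - r)^(-(c + u)) (1 - |z|^2 r)^(-(1 - u))]. The hypothesis [c + u < 1] is its
    convergence. *)
Lemma forelli_rudin_mixed (c u : R) : 0 < c -> 0 < u -> c + u < 1 -> exists2 C : R, 0 < C &
  forall z, nc z < 1 ->
  (\int[leb2]_(p in disc 1)
     ((szego z p ^- 2) `^ (1 - u) * (szego 1 p ^- 2) `^ u * (1 - sqnc p) `^ (- c))%:E <=
   (C * (1 - nc z ^+ 2) `^ (- c))%:E)%E.
Proof.
move=> c0 u0 cu1; exists (A1 * ((1 - (c + u))^-1 + c^-1)).
  by rewrite mulr_gt0 ?disc_area_gt0// addr_gt0 ?invr_gt0//; lra.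
move=> z z1; have z1' := ltW z1; have n1 : nc (1 : R[i]) <= 1 by rewrite nc1.
pose m (r : mR) : R := (`|1 - nc z ^+ 2 * r| / `|1 - r|).
have mm : measurable_fun setT m.
  apply: measurable_funM.
    by apply: measurableT_comp => //; apply: measurable_funB => //; exact: measurable_funM.
  by apply: measurable_inv_ge0 => //; apply: measurableT_comp => //; exact: measurable_funB.
have mpow k : measurable_fun setT (fun r => m r `^ k).
  by apply: (measurableT_comp (f := fun x : R => x `^ k)) => //; exact: measurable_powR.
pose Phi1 r := (1 - u) * (m r `^ u * (1 - r) `^ (- c)).
pose Phi2 r := u * (m r `^ (u - 1) * (1 - r) `^ (- c)).
have mP1 : measurable_fun setT Phi1.
  by apply: measurable_funM => //; apply: measurable_funM => //; exact: measurable_one_sub_powR.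
have mP2 : measurable_fun setT Phi2.
  by apply: measurable_funM => //; apply: measurable_funM => //; exact: measurable_one_sub_powR.
have P10 r : 0 <= Phi1 r by rewrite !mulr_ge0 ?powR_ge0//; lra.
have P20 r : 0 <= Phi2 r by rewrite !mulr_ge0 ?powR_ge0// ltW.
have m0 r : 0 <= r < 1 -> 0 < m r.
  move=> r01; have h1 := one_sub_gt0 z1' r01.
  by rewrite divr_gt0// normr_gt0 gt_eqF//; lra.
have mPs (Phi : mR -> R) (A : set M2) : measurable_fun setT Phi -> measurable_fun A (fun p => Phi (sqnc p)).
  by move=> mPhi; apply: (measurableT_comp mPhi); apply: measurable_funTS; exact: measurable_sqnc.
have mF (w : R[i]) Phi (A : set M2) : measurable_fun setT Phi ->
    measurable_fun A (fun p => (szego w p ^- 2 * Phi (sqnc p))%:E).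
  move=> mPhi; apply/measurable_EFinP; apply: measurable_funM; first exact: measurable_szegoV.
  exact: mPs.
have F0 (w : R[i]) Phi p : (forall r, 0 <= Phi r) -> (0 <= (szego w p ^- 2 * Phi (sqnc p))%:E)%E.
  by move=> P0; rewrite lee_fin mulr_ge0// invr_ge0 exprn_ge0// szego_ge0.
apply: (@le_trans _ _ (\int[leb2]_(p in disc 1)
   ((szego z p ^- 2 * Phi1 (sqnc p))%:E + (szego 1 p ^- 2 * Phi2 (sqnc p))%:E))%E).
  apply: ge0_le_integral => //.
  - by move=> p _; rewrite lee_fin !mulr_ge0 ?powR_ge0.
  - apply/measurable_EFinP; apply: measurable_funM.
      apply: measurable_funM.
        apply: (measurableT_comp (f := fun x : R => x `^ (1 - u))); first exact: measurable_powR.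
        exact: measurable_szegoV.
      apply: (measurableT_comp (f := fun x : R => x `^ u)); first exact: measurable_powR.
      exact: measurable_szegoV.
    by apply: (mPs (fun r => (1 - r) `^ (- c))); exact: measurable_one_sub_powR.
  - by apply: emeasurable_funD; exact: mF.
  move=> p p1; rewrite -EFinD lee_fin.
  have X0 : 0 < szego z p ^- 2 by rewrite invr_gt0 exprn_gt0// szego_gt0.
  have Y0 : 0 < szego 1 p ^- 2 by rewrite invr_gt0 exprn_gt0// szego_gt0.
  have u01 : 0 < u < 1 by lra.
  have := young_weight X0 Y0 u01 (m0 _ (sqnc_itv p1)).
  move=> /(ler_wpM2r (powR_ge0 (1 - sqnc p) (- c))) /le_trans; apply.
  by rewrite le_eqVlt; apply/orP; left; apply/eqP; rewrite /Phi1 /Phi2; ring.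
rewrite ge0_integralD//; last 4 first.
- by move=> p _; exact: F0.
- exact: mF.
- by move=> p _; exact: F0.
- exact: mF.
rewrite !integral_kernel_radial// nc1 expr1n.
pose G (r : mR) : \bar R := ((1 - r) `^ (- (c + u)) * (1 - nc z ^+ 2 * r) `^ (- (1 - u)))%:E.
have mG (A : set mR) : measurable_fun A G.
  apply/measurable_EFinP; apply: measurable_funM; first exact: measurable_one_sub_powR.
  apply: (measurableT_comp (f := fun x : R => x `^ (- (1 - u)))); first exact: measurable_powR.
  by apply: measurable_funB => //; exact: measurable_funM.
have G0 r : (0 <= G r)%E by rewrite lee_fin mulr_ge0 ?powR_ge0.
have e1 : (\int[leb]_(r in `[0%R, 1%R[) (Phi1 r / (1 - nc z ^+ 2 * r))%:E =
    (1 - u)%:E * \int[leb]_(r in `[0%R, 1%R[) G r)%E.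
  rewrite -ge0_integralZl_EFin//; last lra.
  apply: eq_integral => r; rewrite inE/= in_itv/= => r01; rewrite -EFinM /Phi1 /m; congr EFin.
  have h1 := one_sub_gt0 z1' r01; have h2 : 0 < 1 - r by lra.
  rewrite !gtr0_norm// -mulrA; congr (_ * _).
  rewrite powRM ?invr_ge0 ?(ltW h1) ?(ltW h2)//.
  rewrite -[(1 - r)^-1]powR_inv1 ?(ltW h2)// -powRrM mulN1r -[(1 - nc z ^+ 2 * r)^-1]powR_inv1 ?(ltW h1)//.
  rewrite opprD powRD ?(gt_eqF h2) ?implybT// opprB [u - 1]addrC powRD ?(gt_eqF h1) ?implybT//; ring.
have e2 : (\int[leb]_(r in `[0%R, 1%R[) (Phi2 r / (1 - 1 * r))%:E =
    u%:E * \int[leb]_(r in `[0%R, 1%R[) G r)%E.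
  rewrite -ge0_integralZl_EFin//; last lra.
  apply: eq_integral => r; rewrite inE/= in_itv/= => r01; rewrite -EFinM /Phi2 /m mul1r; congr EFin.
  have h1 := one_sub_gt0 z1' r01; have h2 : 0 < 1 - r by lra.
  rewrite !gtr0_norm// -mulrA; congr (_ * _).
  rewrite powRM ?invr_ge0 ?(ltW h1) ?(ltW h2)//.
  rewrite -[(1 - r)^-1]powR_inv1 ?(ltW h2)// -powRrM (_ : -1 * (u - 1) = 1 - u); last by ring.
  have -> : (1 - r) `^ (- (c + u)) = (1 - r) `^ (1 - u) * (1 - r) `^ (- c) * (1 - r) `^ (-1).
    by rewrite -!powRD ?(gt_eqF h2) ?implybT//; congr powR; ring.
  by rewrite opprB; ring.
rewrite e1 e2; set I := (\int[leb]_(r in _) G r)%E.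
have I0 : (0 <= I)%E by apply: integral_ge0 => r _; exact: G0.
have u1 : (0 <= (1 - u)%:E)%E by rewrite lee_fin; lra.
have u2 : (0 <= u%:E)%E by rewrite lee_fin ltW.
rewrite -ge0_muleDr ?mule_ge0// -ge0_muleDl// -EFinD subrK mul1e.
have d1 : 0 < 1 - nc z ^+ 2 <= 1.
  by rewrite gerBl exprn_ge0 ?nc_ge0// andbT subr_gt0 expr_lt1// nc_ge0.
have := @integral_two_powers _ (c + u) (1 - u) c (1 - nc z ^+ 2) cu1 c0 _ _ _ d1.
have a0 : (0 <= A1%:E)%E by rewrite lee_fin ltW// disc_area_gt0.
move=> /(_ _ _ _)/(lee_wpmul2l a0); rewrite -EFinM mulrA subKr; apply; lra.
Qed.

End forelli_rudin.

(** * Forelli-Rudin estimates with a weight at 1 and on discs of any radius *)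

Section weighted_forelli_rudin.
Context {R : realType}.
Local Notation mR := (measurableTypeR R).
Local Notation M2 := (mR * mR)%type.
Local Notation leb2 := (@lebesgue2 R).

Lemma measurable_sqnc_powR (k c : R) (A : set M2) : measurable_fun A (fun p => (1 - sqnc p * k) `^ c).
Proof.
apply: (measurableT_comp (f := fun x : R => x `^ c)); first exact: measurable_powR.
apply: measurable_funB => //; apply: measurable_funM => //.
by apply: measurable_funTS; exact: measurable_sqnc.
Qed.

Lemma measurable_szego_powR z (c : R) (A : set M2) : measurable_fun A (fun p => szego z p `^ c).
Proof.
apply: (measurableT_comp (f := fun x : R => x `^ c)); first exact: measurable_powR.
exact: measurable_szego.
Qed.

(* [|1 - z| <= |1 - z p^*| + |1 - p^*|] trades the weight [|1 - z|^(2u)] for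
   the mixed integral. *)
Lemma forelli_rudin_weighted (c u : R) : 0 < c -> 0 < u -> c + u < 1 -> exists2 C : R, 0 < C &
  forall z, nc z < 1 ->
  (\int[leb2]_(p in disc 1)
     (szego z p ^- 2 * szego 1 p `^ (- (2 * u)) * (1 - sqnc p) `^ (- c))%:E <=
   (C * (nc (1 - z) `^ (- (2 * u)) * (1 - nc z ^+ 2) `^ (- c)))%:E)%E.
Proof.
move=> c0 u0 cu1; have c01 : 0 < c < 1 by lra.
have [C1 C10 h1] := forelli_rudin c01; have [C2 C20 h2] := forelli_rudin_mixed c0 u0 cu1.
(* The 4 bounds [2 ^ (2 u)] for [u < 1]; that power appears when [|1 - z|] is bounded by twice a
   maximum. *)
exists (4 * (C1 + C2)); first by lra.
move=> z z1; set N := nc (1 - z).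
have N0 : 0 < N by rewrite nc_gt0; apply: one_sub_neq0.
have n1 : nc (1 : R[i]) <= 1 by rewrite nc1.
pose f1 (p : M2) := szego z p ^- 2 * (1 - sqnc p) `^ (- c).
pose f2 (p : M2) := (szego z p ^- 2) `^ (1 - u) * (szego 1 p ^- 2) `^ u * (1 - sqnc p) `^ (- c).
have m0 : measurable_fun (disc 1) (fun p => (1 - sqnc p) `^ (- c) : R).
  by have := @measurable_sqnc_powR 1 (- c) (disc 1); under eq_fun do rewrite mulr1.
have mf1 : measurable_fun (disc 1) f1 by apply: measurable_funM => //; exact: measurable_szegoV.
have mf2 : measurable_fun (disc 1) f2.
  apply: measurable_funM => //; apply: measurable_funM.
    apply: (measurableT_comp (f := fun x : R => x `^ (1 - u))); first exact: measurable_powR.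
    exact: measurable_szegoV.
  apply: (measurableT_comp (f := fun x : R => x `^ u)); first exact: measurable_powR.
  exact: measurable_szegoV.
have f10 p : 0 <= f1 p by rewrite mulr_ge0 ?powR_ge0// invr_ge0 exprn_ge0// szego_ge0.
have f20 p : 0 <= f2 p by rewrite !mulr_ge0 ?powR_ge0.
have K0 : 0 <= 4 * N `^ (- (2 * u)) by rewrite mulr_ge0// powR_ge0.
apply: (@le_trans _ _ (\int[leb2]_(p in disc 1) ((4 * N `^ (- (2 * u)))%:E * (f1 p + f2 p)%:E))%E).
  apply: ge0_le_integral => //.
  - by move=> p _; rewrite lee_fin !mulr_ge0 ?powR_ge0// invr_ge0 exprn_ge0// szego_ge0.
  - apply/measurable_EFinP; apply: measurable_funM => //; apply: measurable_funM.
      exact: measurable_szegoV.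
    exact: measurable_szego_powR.
  - by apply: emeasurable_funM => //; apply/measurable_EFinP; apply: measurable_funD.
  move=> p p1; rewrite -EFinM lee_fin /f1 /f2 -mulrDl mulrA ler_wpM2r ?powR_ge0//.
  have s1 := szego_gt0 (ltW z1) p1; have s2 := szego_gt0 n1 p1.
  have -> : (szego z p ^- 2) `^ (1 - u) = szego z p ^- 2 * szego z p `^ (2 * u).
    rewrite -powR_mulrn ?(ltW s1)// -powRN -powRrM -powRD ?(gt_eqF s1) ?implybT//.
    by congr powR; rewrite -[2%:R]/(2 : R); ring.
  have -> : (szego 1 p ^- 2) `^ u = szego 1 p `^ (- (2 * u)).
    by rewrite -powR_mulrn ?(ltW s2)// -powRN -powRrM mulNr.
  have -> : szego z p ^- 2 + szego z p ^- 2 * szego z p `^ (2 * u) * szego 1 p `^ (- (2 * u)) =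
    szego z p ^- 2 * szego 1 p `^ (- (2 * u)) * (szego 1 p `^ (2 * u) + szego z p `^ (2 * u)).
    have E : szego 1 p `^ (- (2 * u)) * szego 1 p `^ (2 * u) = 1.
      by rewrite -powRD ?(gt_eqF s2) ?implybT// addNr powRr0.
    by rewrite mulrDr -[X in _ = X + _]mulrA E mulr1 mulrAC.
  rewrite mulrCA ler_peMr//; first by rewrite mulr_ge0 ?powR_ge0// invr_ge0 exprn_ge0// szego_ge0.
  rewrite mulrAC -ler_pdivrMr ?powRN ?div1r ?invrK; last by rewrite invr_gt0 powR_gt0.
  (* With [v] the conjugate of the point, [1 - z = (1 - z v) - z (1 - v)]. *)
  have tri : N <= 2 * Num.max (szego 1 p) (szego z p).
    have -> : N = nc ((1 - z * (toC p)^*) - z * (1 - 1 * (toC p)^*)) by congr nc; ring.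
    apply: (le_trans (nc_subadd _ _)); rewrite ncM.
    have : nc z * nc (1 - 1 * (toC p)^*) <= nc (1 - 1 * (toC p)^*) by rewrite ler_piMl ?nc_ge0// ltW.
    rewrite -!/(szego _ _); have [] := leP (szego 1 p) (szego z p); lra.
  have u2 : 0 <= 2 * u by lra.
  have N0' : N \in Num.nneg by rewrite nnegrE ltW.
  have M0 : 0 <= Num.max (szego 1 p) (szego z p) by rewrite le_max (ltW s1) orbT.
  apply: (le_trans (ge0_ler_powR u2 N0' _ tri)); first by rewrite nnegrE mulr_ge0.
  rewrite powRM// ler_pM ?powR_ge0//.
    have /(_ (2 * u) 2) : {homo powR (2 : R) : x y / x <= y} by apply: ler_powR; lra.
    rewrite powR_mulrn// => H; apply: (le_trans (H _)); first lra.
    by rewrite expr2; lra.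
  by case: (leP (szego 1 p)) => _; rewrite ?lerDl ?lerDr powR_ge0.
rewrite ge0_integralZl_EFin//; last 2 first.
- by move=> p _; rewrite lee_fin addr_ge0.
- by apply/measurable_EFinP; apply: measurable_funD.
under eq_integral do rewrite EFinD.
rewrite ge0_integralD//; try (by move=> p _; rewrite lee_fin); try exact/measurable_EFinP.
rewrite (_ : (4 * _ * _)%:E = (4 * N `^ (- (2 * u)))%:E *
   ((C1 * (1 - nc z ^+ 2) `^ (- c))%:E + (C2 * (1 - nc z ^+ 2) `^ (- c))%:E))%E; last first.
  by rewrite -EFinD -EFinM; congr EFin; ring.
by apply: lee_wpmul2l; [rewrite lee_fin|apply: leeD; [exact: h1|exact: h2]].
Qed.

(** Rescaling to the unit disc takes [r^(-4)] out of the kernel and [r^2] out of the area, so one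
    constant serves all radii. This uniformity is what lets it be applied on every fibre. *)
Lemma forelli_rudin_radius (c : R) : 0 < c < 1 -> exists2 C : R, 0 < C &
  forall r x, 0 < r -> nc x < r ->
  (\int[leb2]_(p in disc r)
     ((nc ((r ^+ 2)%:C - x * (toC p)^*)) ^- 2 * (1 - sqnc p / r ^+ 2) `^ (- c))%:E <=
   (C * (r ^- 2 * (1 - nc x ^+ 2 / r ^+ 2) `^ (- c)))%:E)%E.
Proof.
move=> c01; have [C C0 hC] := forelli_rudin c01; exists C => // r x r0 xr.
have rC : r%:C != 0 :> R[i] by rewrite -nc_gt0 nc_real normr_gt0 gt_eqF.
pose z := r^-1%:C * x.
have nz : nc z = nc x / r by rewrite /z ncM nc_real gtr0_norm ?invr_gt0// mulrC.
have z1 : nc z < 1 by rewrite nz ltr_pdivrMr// mul1r.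
have ri : 0 < r^-1 by rewrite invr_gt0.
pose f (p : M2) := szego z p ^- 2 * (1 - sqnc p) `^ (- c).
have f0 p : 0 <= f p by rewrite mulr_ge0 ?powR_ge0// invr_ge0 exprn_ge0// szego_ge0.
have mf : measurable_fun (disc 1) f.
  apply: measurable_funM; first exact: measurable_szegoV.
  by have := @measurable_sqnc_powR 1 (- c) (disc 1); under eq_fun do rewrite mulr1.
have r2 : 0 <= r^-1 ^- 2 by rewrite invr_ge0 exprn_ge0// ltW.
have := @ge0_integral_scales _ _ _ leb2 _ _ (disc 1) (fun p => (f p)%:E) r2
  (scales_affine2 (- (r^-1)%:C * 0) ri) (measurable_disc 1).
rewrite affine2_disc_at// disc_at0 => /(_ _ _)/esym E.
have mf' : measurable_fun (disc 1) (fun p => (f p)%:E) by exact/measurable_EFinP.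
have {}E := E mf' (fun p _ => f0 p).
have -> : (\int[leb2]_(p in disc r)
     ((nc ((r ^+ 2)%:C - x * (toC p)^*)) ^- 2 * (1 - sqnc p / r ^+ 2) `^ (- c))%:E =
   (r ^- 4)%:E * \int[leb2]_(p in disc r) (f (affine2 r^-1 (- r^-1%:C * 0) p))%:E)%E.
  rewrite -ge0_integralZl_EFin; last 4 first.
  - exact: measurable_disc.
  - by move=> p _; rewrite lee_fin.
  - apply/measurable_EFinP; apply: (measurable_comp (F := disc 1) (f := f)) => //.
    + by rewrite -disc_at0 -(affine2_disc_at 0 r0) => _ [p hp <-].
    + by apply: measurable_funTS; have [] := scales_affine2 (- (r^-1)%:C * 0) ri.
  - by rewrite invr_ge0 exprn_ge0// ltW.
  apply: eq_integral => p _; rewrite -EFinM /f; congr EFin.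
  have tp : toC (affine2 r^-1 (- r^-1%:C * 0) p) = r^-1%:C * toC p.
    by rewrite toC_affine2 mulr0 addr0.
  rewrite mulrA; congr (_ * _ `^ _); last first.
    by rewrite /sqnc tp ncM nc_real gtr0_norm// exprMn exprVn mulrC.
  rewrite /szego tp conjcM conjc_real.
  have -> : (r ^+ 2)%:C - x * (toC p)^* = (r ^+ 2)%:C * (1 - z * (r^-1%:C * (toC p)^*)).
    by rewrite /z rmorphXn fmorphV; field.
  rewrite ncM nc_real ger0_norm ?exprn_ge0 ?(ltW r0)// exprMn invfM -exprM; congr (_ * _).
rewrite -E muleA -EFinM exprVn invrK.
have -> : r ^- 4 * r ^+ 2 = r ^- 2.
  by rewrite -[4%N]/(2 + 2)%N exprD invfM -mulrA mulVf ?mulr1// expf_neq0// gt_eqF.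
have -> : C * (r ^- 2 * (1 - nc x ^+ 2 / r ^+ 2) `^ (- c)) = r ^- 2 * (C * (1 - nc z ^+ 2) `^ (- c)).
  by rewrite nz exprMn exprVn mulrCA.
rewrite EFinM; apply: lee_wpmul2l; first by rewrite lee_fin invr_ge0 exprn_ge0// ltW.
exact: hC.
Qed.

End weighted_forelli_rudin.

(** * Tonelli's theorem over varying fibres *)

Section fibered_integral.
Context d1 d2 (T1 : measurableType d1) (T2 : measurableType d2) (R : realType).
Variables (m1 : {sigma_finite_measure set T1 -> \bar R}).
Variables (m2 : {sigma_finite_measure set T2 -> \bar R}).
Implicit Types (S : set (T1 * T2)) (f : T1 * T2 -> \bar R).

Lemma ge0_integral_xsection S f : measurable S -> measurable_fun S f ->
  (forall z, S z -> (0 <= f z)%E) ->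
  (\int[m1 \x m2]_(z in S) f z = \int[m1]_x \int[m2]_(y in xsection S x) f (x, y))%E.
Proof.
move=> mS mf f0; rewrite integral_mkcond fubini_tonelli1.
- apply: eq_integral => x _; rewrite /fubini_F [RHS]integral_mkcond.
  by apply: eq_integral => y _; rewrite /patch mem_xsection.
- exact/(measurable_restrictT f mS).
- by move=> z; rewrite /patch; case: ifPn => // /set_mem/f0.
Qed.

Lemma ge0_measurable_xsection S f : measurable S -> measurable_fun S f ->
  (forall z, S z -> (0 <= f z)%E) ->
  measurable_fun setT (fun x => \int[m2]_(y in xsection S x) f (x, y))%E.
Proof.
move=> mS mf f0; have m : measurable_fun setT (f \_ S) by exact/(measurable_restrictT f mS).
have p0 z : (0 <= (f \_ S) z)%E by rewrite /patch; case: ifPn => // /set_mem/f0.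
have := measurable_fun_fubini_tonelli_F (m2 := m2) _ m p0; congr measurable_fun.
apply/funext => x; rewrite /fubini_F [RHS]integral_mkcond.
by apply: eq_integral => y _; rewrite /patch mem_xsection.
Qed.

Lemma measurable_xsection_fun d3 (T3 : measurableType d3) S (f : T1 * T2 -> T3) x :
  measurable S -> measurable_fun S f -> measurable_fun (xsection S x) (fun y => f (x, y)).
Proof.
move=> mS mf; apply: (measurable_comp mS _ mf).
- by move=> _ [y + <-]; rewrite /xsection/= inE.
- exact: measurable_funTS (pair1_measurable x).
Qed.

Lemma measurable_ysection_fun d3 (T3 : measurableType d3) S (f : T1 * T2 -> T3) y :
  measurable S -> measurable_fun S f -> measurable_fun (ysection S y) (fun x => f (x, y)).
Proof.
move=> mS mf; apply: (measurable_comp mS _ mf).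
- by move=> _ [x + <-]; rewrite /ysection/= inE.
- exact: measurable_funTS (pair2_measurable y).
Qed.

Lemma ge0_integral_setX A B f : measurable A -> measurable B -> measurable_fun (A `*` B) f ->
  (forall z, (A `*` B) z -> (0 <= f z)%E) ->
  (\int[m1]_(x in A) \int[m2]_(y in B) f (x, y) = \int[m2]_(y in B) \int[m1]_(x in A) f (x, y))%E.
Proof.
move=> mA mB mf f0; have mS := measurableX mA mB.
have m : measurable_fun setT (f \_ (A `*` B)) by exact/(measurable_restrictT f mS).
have p0 z : (0 <= (f \_ (A `*` B)) z)%E by rewrite /patch; case: ifPn => // /set_mem/f0.
have := fubini_tonelli (m1 := m1) (m2 := m2) _ m p0 => E.
rewrite [LHS]integral_mkcond [RHS]integral_mkcond.
transitivity (\int[m1]_x \int[m2]_y (f \_ (A `*` B)) (x, y))%E; last rewrite E.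
  apply: eq_integral => x _; rewrite [LHS]/patch; case: ifPn => xA.
    by rewrite integral_mkcond; apply: eq_integral => y _; rewrite /patch in_setX xA.
  by rewrite integral0_eq// => y _; rewrite /patch in_setX (negbTE xA).
apply: eq_integral => y _; rewrite [RHS]/patch; case: ifPn => yB.
  by rewrite [RHS]integral_mkcond; apply: eq_integral => x _; rewrite /patch in_setX yB andbT.
by rewrite integral0_eq// => x _; rewrite /patch in_setX (negbTE yB) andbF.
Qed.

Lemma ge0_measurable_integral_setX A B f : measurable A -> measurable B ->
  measurable_fun (A `*` B) f -> (forall z, (A `*` B) z -> (0 <= f z)%E) ->
  measurable_fun A (fun x => \int[m2]_(y in B) f (x, y))%E.
Proof.
move=> mA mB mf f0; have mS := measurableX mA mB.
have := ge0_measurable_xsection mS mf f0; move=> /(measurable_funS measurableT (@subsetT _ A)).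
apply: eq_measurable_fun => x xA.
by rewrite [LHS]integral_mkcond [RHS]integral_mkcond; apply: eq_integral => y _;
  rewrite /patch mem_xsection in_setX xA.
Qed.

End fibered_integral.

(** * The Schur test *)

Section schur_test.
Context d (T : measurableType d) (R : realType).
Variable mu : {sigma_finite_measure set T -> \bar R}.
Implicit Types (A : set T) (f g F G psi : T -> R) (p q : R).

Lemma ge0_hoelder A f g p q : measurable A -> measurable_fun A f -> measurable_fun A g ->
  (forall x, A x -> 0 <= f x) -> (forall x, A x -> 0 <= g x) -> 0 < p -> 0 < q -> p^-1 + q^-1 = 1 ->
  (\int[mu]_(x in A) (f x * g x)%:E <=
   (\int[mu]_(x in A) (f x `^ p)%:E) `^ p^-1 * (\int[mu]_(x in A) (g x `^ q)%:E) `^ q^-1)%E.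
Proof.
move=> mA mf mg f0 g0 p0 q0 pq.
have mf' : measurable_fun setT (f \_ A) by exact/(measurable_restrictT f mA).
have mg' : measurable_fun setT (g \_ A) by exact/(measurable_restrictT g mA).
have := hoelder mu mf' mg' p0 q0 pq.
have N (h : T -> R) r : 0 < r -> (forall x, A x -> 0 <= h x) ->
    ('N[mu]_r%:E[EFin \o (h \_ A)] = (\int[mu]_(x in A) (h x `^ r)%:E) `^ r^-1)%E.
  move=> r0 h0; rewrite unlock [in RHS]integral_mkcond; congr (_ `^ _)%E.
  apply: eq_integral => x _; rewrite /patch/=; case: ifPn => [/set_mem/h0 hx|_].
    by rewrite ger0_norm.
  by rewrite normr0 powR0// gt_eqF.
rewrite !N// Lnorm1; congr (_ <= _)%E; rewrite [RHS]integral_mkcond.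
apply: eq_integral => x _; rewrite /patch/=; case: ifPn => [/set_mem Ax|_].
  by rewrite ger0_norm// mulr_ge0// ?f0 ?g0.
by rewrite mul0r normr0.
Qed.

(** Hoelder's inequality and the first kernel bound give [G^p <= C^(p - 1) psi^p J] pointwise, with
    [J] the kernel integral of [F^p psi^(-p)]. Integrating, exchanging the order and using the
    second bound cancels [psi]. [G] is only required to lie below the kernel integral of [F], so a
    pointwise bound of the projection suffices. *)
Lemma schur_test p q C A (k : T * T -> R) psi F G : 1 < p -> p^-1 + q^-1 = 1 -> 0 < C ->
  measurable A -> measurable_fun (A `*` A) k -> measurable_fun A psi ->
  measurable_fun A F -> measurable_fun A G ->
  (forall z, 0 <= k z) -> (forall x, A x -> 0 < psi x) ->
  (forall x, 0 <= F x) -> (forall x, 0 <= G x) ->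
  (forall x, A x -> (\int[mu]_(y in A) (k (x, y) * psi y `^ q)%:E <= (C * psi x `^ q)%:E)%E) ->
  (forall y, A y -> (\int[mu]_(x in A) (k (x, y) * psi x `^ p)%:E <= (C * psi y `^ p)%:E)%E) ->
  (forall x, A x -> ((G x)%:E <= \int[mu]_(y in A) (k (x, y) * F y)%:E)%E) ->
  (\int[mu]_(x in A) (G x `^ p)%:E <= (C `^ p)%:E * \int[mu]_(x in A) (F x `^ p)%:E)%E.
Proof.
move=> p1 pq C0 mA mk mpsi mF mG k0 psi0 F0 G0 h1 h2 h3.
have p0 : 0 < p by lra.
have q0 : 0 < q.
  rewrite -invr_gt0; have : p^-1 < 1 by rewrite invf_lt1.
  lra.
have qp1 : p / q = p - 1.
  have := congr1 ( *%R p) pq; rewrite mulrDr mulfV ?gt_eqF//; lra.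
have mpow (h : T -> R) r : measurable_fun A h -> measurable_fun A (fun x => h x `^ r).
  by move=> mh; apply: (measurableT_comp (f := fun x : R => x `^ r)) => //; exact: measurable_powR.
have mA2 := measurableX mA mA.
have xA x : A x -> xsection (A `*` A) x = A.
  by move=> Ax; apply/seteqP; split => y; rewrite /xsection/= inE//= => -[].
have yA y : A y -> ysection (A `*` A) y = A.
  by move=> Ay; apply/seteqP; split => x; rewrite /ysection/= inE//= => -[].
have mk1 x : A x -> measurable_fun A (fun y => k (x, y)).
  by move=> Ax; rewrite -[X in measurable_fun X](xA x Ax); exact: measurable_xsection_fun.
have mk2 y : A y -> measurable_fun A (fun x => k (x, y)).
  by move=> Ay; rewrite -[X in measurable_fun X](yA y Ay); exact: measurable_ysection_fun.
pose H y := F y `^ p * psi y `^ (- p).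
have H0 y : 0 <= H y by rewrite mulr_ge0 ?powR_ge0.
have mH : measurable_fun A H by apply: measurable_funM; exact: mpow.
pose J x := (\int[mu]_(y in A) (k (x, y) * H y)%:E)%E.
have J0 x : (0 <= J x)%E by apply: integral_ge0 => y _; rewrite lee_fin mulr_ge0.
have GJ x : A x -> ((G x `^ p)%:E <= (C `^ (p - 1) * psi x `^ p)%:E * J x)%E.
  move=> Ax; have psx := psi0 _ Ax.
  (* The splitting [k F = (k^(1/q) psi) (k^(1/p) F / psi)]: the power [q] of the first factor is
     covered by the first bound, the power [p] of the second is [k * H]. *)
  pose a y := k (x, y) `^ q^-1 * psi y; pose b y := k (x, y) `^ p^-1 * (F y / psi y).
  have ma : measurable_fun A a.
    by apply: measurable_funM => //; apply: mpow; exact: mk1.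
  have mb : measurable_fun A b.
    apply: measurable_funM; first by apply: mpow; exact: mk1.
    apply: measurable_funM => //.
    have := mpow _ (-1) mpsi; apply: eq_measurable_fun => y /set_mem Ay.
    by rewrite powR_inv1// ltW// psi0.
  have a0 y : A y -> 0 <= a y by move=> Ay; rewrite mulr_ge0 ?powR_ge0// ltW// psi0.
  have b0 y : A y -> 0 <= b y by move=> Ay; rewrite mulr_ge0 ?powR_ge0// divr_ge0// ltW// psi0.
  have qp : q^-1 + p^-1 = 1 by rewrite addrC.
  have := ge0_hoelder mA ma mb a0 b0 q0 p0 qp.
  have -> : (\int[mu]_(y in A) (a y * b y)%:E = \int[mu]_(y in A) (k (x, y) * F y)%:E)%E.
    apply: eq_integral => y /set_mem Ay; congr EFin.
    rewrite /a /b mulrACA -powRD; last first.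
      by apply/implyP; rewrite qp oner_eq0.
    rewrite qp powRr1// [psi y * _]mulrC divfK// gt_eqF// psi0//.
  have -> : (\int[mu]_(y in A) (a y `^ q)%:E = \int[mu]_(y in A) (k (x, y) * psi y `^ q)%:E)%E.
    apply: eq_integral => y /set_mem Ay; congr EFin.
    by rewrite /a powRM ?powR_ge0// ?(ltW (psi0 _ Ay))// -powRrM mulVf ?gt_eqF// powRr1.
  have -> : (\int[mu]_(y in A) (b y `^ p)%:E = J x)%E.
    apply: eq_integral => y /set_mem Ay; congr EFin; have py := psi0 _ Ay.
    rewrite /b powRM ?powR_ge0// ?divr_ge0 ?(ltW py)// -powRrM mulVf ?gt_eqF// powRr1//.
    rewrite powRM ?invr_ge0 ?(ltW py)// /H; congr (_ * (_ * _)).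
    by rewrite -powR_inv1 ?(ltW py)// -powRrM mulN1r.
  move=> hh; have {}hh := le_trans (h3 _ Ax) hh.
  have {}hh : ((G x)%:E <= (C * psi x `^ q)%:E `^ q^-1 * J x `^ p^-1)%E.
    apply: (le_trans hh); apply: lee_wpmul2r; first exact: poweR_ge0.
    apply: gt0_ler_poweR.
    - by rewrite invr_ge0 ltW.
    - by rewrite in_itv/= leey andbT integral_ge0// => y _; rewrite lee_fin mulr_ge0 ?powR_ge0.
    - by rewrite in_itv/= leey andbT lee_fin mulr_ge0 ?powR_ge0// ltW.
    - exact: h1.
  have := @gt0_ler_poweR _ p (ltW p0) (G x)%:E ((C * psi x `^ q)%:E `^ q^-1 * J x `^ p^-1)%E.
  rewrite !in_itv/= !leey !andbT lee_fin G0 mule_ge0 ?lee_fin ?powR_ge0 ?poweR_ge0// => /(_ isT isT hh).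
  rewrite poweRM ?poweR_ge0 ?lee_fin ?powR_ge0// -!poweRrM mulVf ?gt_eqF// [(J x `^ 1)%E]poweRe1//.
  move=> /le_trans; apply; rewrite !poweR_EFin; apply: lee_wpmul2r => //.
  have qp1' : q^-1 * p = p - 1 by rewrite mulrC.
  rewrite lee_fin -?powRrM qp1' powRM ?powR_ge0 ?(ltW C0)// -powRrM.
  have -> : q * (p - 1) = p by rewrite -qp1 mulrCA mulfV ?mulr1// gt_eqF.
  exact: lexx.
have mJ : measurable_fun A J.
  have mj : measurable_fun (A `*` A) (fun z : T * T => (k z * H z.2)%:E).
    apply/measurable_EFinP; apply: measurable_funM => //.
    apply: (measurable_comp (F := A) (f := H) (g := snd)) => //.
    + by move=> _ [[x y] [_ /= hy] <-].
    + exact: measurable_funTS measurable_snd.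
  have j0 z : (A `*` A) z -> (0 <= (k z * H z.2)%:E)%E by move=> _; rewrite lee_fin mulr_ge0.
  exact: (@ge0_measurable_integral_setX _ _ _ _ _ mu _ _ _ mA mA mj j0).
apply: (@le_trans _ _ (\int[mu]_(x in A) ((C `^ (p - 1))%:E * ((psi x `^ p)%:E * J x)))%E).
  apply: ge0_le_integral => //.
  - by move=> x _; rewrite lee_fin powR_ge0.
  - by apply/measurable_EFinP; exact: mpow.
  - apply: emeasurable_funM => //; apply: emeasurable_funM => //; apply/measurable_EFinP; exact: mpow.
  - by move=> x Ax; rewrite muleA -EFinM; exact: GJ.
rewrite ge0_integralZl_EFin//; last 3 first.
- by move=> x _; rewrite mule_ge0// lee_fin powR_ge0.
- by apply: emeasurable_funM => //; apply/measurable_EFinP; exact: mpow.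
- exact: powR_ge0.
have -> : C `^ p = C `^ (p - 1) * C.
  by rewrite -[X in _ * X](powRr1 (ltW C0)) -powRD ?(gt_eqF C0) ?implybT// subrK.
rewrite EFinM -muleA; apply: lee_wpmul2l; first by rewrite lee_fin powR_ge0.
pose f (z : T * T) := (psi z.1 `^ p * (k z * H z.2))%:E.
have f0 z : (0 <= f z)%E by rewrite lee_fin !mulr_ge0 ?powR_ge0.
have mf : measurable_fun (A `*` A) f.
  apply/measurable_EFinP; apply: measurable_funM.
    apply: (measurable_comp (F := A) (f := fun x => psi x `^ p) (g := fst)) => //.
    + by move=> _ [[x y] [/= hx _] <-].
    + exact: mpow.
    + exact: measurable_funTS measurable_fst.
  apply: measurable_funM => //.
  apply: (measurable_comp (F := A) (f := H) (g := snd)) => //.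
  + by move=> _ [[x y] [_ /= hy] <-].
  + exact: measurable_funTS measurable_snd.
have EJ : (\int[mu]_(x in A) \int[mu]_(y in A) f (x, y) = \int[mu]_(x in A) ((psi x `^ p)%:E * J x))%E.
  apply: eq_integral => x /set_mem Ax; rewrite -ge0_integralZl_EFin; last 4 first.
  - exact: mA.
  - by move=> y _; rewrite lee_fin mulr_ge0.
  - by apply/measurable_EFinP; apply: measurable_funM => //; exact: mk1.
  - exact: powR_ge0.
  by apply: eq_integral => y _; rewrite -EFinM.
have E := @ge0_integral_setX _ _ _ _ _ mu mu _ _ _ mA mA mf (fun z _ => f0 z).
rewrite -EJ {EJ}E {E}.
apply: (@le_trans _ _ (\int[mu]_(y in A) (C%:E * (F y `^ p)%:E))%E); last first.
  rewrite ge0_integralZl_EFin//.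
  - by move=> y _; rewrite lee_fin powR_ge0.
  - by apply/measurable_EFinP; exact: mpow.
  - exact: ltW.
apply: ge0_le_integral => //.
- by move=> y _; apply: integral_ge0.
- have mf' : measurable_fun (A `*` A) (f \o (fun z : T * T => (z.2, z.1))).
    apply: (measurable_comp (F := A `*` A)) => //.
    + by move=> _ [[x y] [hx hy] <-].
    + by apply: measurable_funTS; exact: measurable_swap.
  exact: (@ge0_measurable_integral_setX _ _ _ _ _ mu _ _ _ mA mA mf' (fun z _ => f0 _)).
- by apply: emeasurable_funM => //; apply/measurable_EFinP; exact: mpow.
move=> y Ay; have py := psi0 _ Ay.
have -> : (\int[mu]_(x in A) f (x, y) = (H y)%:E * \int[mu]_(x in A) (k (x, y) * psi x `^ p)%:E)%E.
  rewrite -ge0_integralZl_EFin//.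
  - by apply: eq_integral => x _; rewrite /f/= -EFinM; congr EFin; ring.
  - by move=> x _; rewrite lee_fin mulr_ge0 ?powR_ge0.
  - by apply/measurable_EFinP; apply: measurable_funM; [exact: mk2|exact: mpow].
have HF : H y * psi y `^ p = F y `^ p.
  by rewrite /H -mulrA -powRD ?(gt_eqF py) ?implybT// addNr powRr0 mulr1.
apply: (le_trans (lee_wpmul2l _ (h2 _ Ay))); first by rewrite lee_fin.
by rewrite -!EFinM mulrCA HF.
Qed.

End schur_test.

(** * Measurability of open sets and continuous functions in the plane *)

Section open_measurable.
Context {R : realType}.
Local Notation mR := (measurableTypeR R).
Local Notation M2 := (mR * mR)%type.

Lemma measurable_square_nbhs (S : set M2) :
  (forall p, S p -> exists2 d : R, 0 < d & forall q : M2, `|q.1 - p.1| < d -> `|q.2 - p.2| < d -> S q) ->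
  measurable S.
Proof.
move=> Sp.
have near (x r e : R) : x - e < r < x -> r - e < x < r + e by lra.
have far (x y r e d : R) : e < d / 2 -> x - e < r < x -> r - e < y < r + e -> `|y - x| < d.
  by move=> h1 h2 h3; rewrite ltr_norml; lra.
pose sq (n : nat) (a b : rat) : set M2 :=
  `]ratr a - n.+1%:R^-1, ratr a + n.+1%:R^-1[%classic `*` `]ratr b - n.+1%:R^-1, ratr b + n.+1%:R^-1[%classic.
(* Rational squares not contained in [S] are replaced by the empty set, so the union runs over all
   rational indices and is countable. *)
pose U n a b : set M2 := if `[< sq n a b `<=` S >] then sq n a b else set0.
have -> : S = \bigcup_n \bigcup_a \bigcup_b U n a b.
  apply/seteqP; split => [p Sp'|p [n _ [a _ [b _]]]]; last first.
    by rewrite /U; case: asboolP => // h /h.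
  have [d d0 hd] := Sp _ Sp'.
  have [n nd] : exists n, n.+1%:R^-1 < d / 2.
    have d2 : 0 < d / 2 by lra.
    have [n _ hn] := near_infty_natSinv_lt (PosNum d2).
    by exists n; exact: (hn n (leqnn n)).
  have n0 : 0 < n.+1%:R^-1 :> R by rewrite invr_gt0.
  have [a ha] : exists a : rat, ratr a \in `]p.1 - n.+1%:R^-1, p.1[.
    by apply: rat_in_itvoo; rewrite gtrBl.
  have [b hb] : exists b : rat, ratr b \in `]p.2 - n.+1%:R^-1, p.2[.
    by apply: rat_in_itvoo; rewrite gtrBl.
  move: ha hb; rewrite !in_itv/= => ha hb.
  exists n => //; exists a => //; exists b => //; rewrite /U.
  have pq : sq n a b p by rewrite /sq/=; split; rewrite /= in_itv/=; exact: near.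
  case: asboolP => // -[] q []; rewrite /= !in_itv/= => h1 h2.
  by apply: hd; [exact: far nd ha h1|exact: far nd hb h2].
apply: bigcupT_measurable => n; apply: bigcupT_measurable_rat => a.
apply: bigcupT_measurable_rat => b; rewrite /U; case: asboolP => // _.
exact: measurableX.
Qed.

Lemma Cmeasurable_continuous (h : R[i] -> R[i]) r :
  (forall w, nc w < r -> ccontinuous_at h w) -> Cmeasurable (disc r) (fun p => h (toC p)).
Proof.
move=> hc; pose sm (p : M2) (d : R) := forall q : M2, `|q.1 - p.1| < d -> `|q.2 - p.2| < d -> nc (toC q - toC p) < 2 * d.
have smP p d : sm p d.
  move=> q h1 h2; apply: le_lt_trans (nc_le_ReIm _) _.
  by rewrite ReD ReN ImD ImN /toC/= mulr_natl mulr2n ltrD.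
(* [u] stands for the real or the imaginary part: both satisfy this one-sided Lipschitz bound, which
   makes preimages of open rays open. *)
have main (u : R[i] -> R) : (forall z w, u z - u w <= nc (z - w)) ->
    measurable_fun (disc r) (fun p : M2 => (u (h (toC p)) : mR)).
  move=> ulip _; apply: (measurability _ (RGenOInfty.measurableE R)) => /=; last exact: measurable_disc.
  move=> _ [_ [a ->]] <-; apply: measurable_square_nbhs => p [pr].
  rewrite /preimage/= in_itv/= andbT => ap; have {}pr : nc (toC p) < r by exact: pr.
  have e0 : 0 < u (h (toC p)) - a by lra.
  have [d d0 hd] := hc _ pr _ e0.
  have [e [e1 e2 e3]] : exists e : R, [/\ 0 < e, e <= d & e <= r - nc (toC p)].
    by exists (Num.min d (r - nc (toC p))); split; rewrite ?lt_min ?ge_min ?lexx ?orbT// d0 subr_gt0.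
  exists (e / 2) => [|q h1 h2]; first lra.
  have := smP _ _ _ h1 h2; rewrite mulrC divfK// => hq; split.
    suff : nc (toC q) < r by [].
    by have := nc_triangle (toC q - toC p) (toC p); rewrite subrK; lra.
  rewrite /= in_itv/= andbT; have := hd _ (lt_le_trans hq e2).
  by have := ulip (h (toC p)) (h (toC q)); rewrite ncB; lra.
split; apply: main => z w.
  by have := Re_le_nc (z - w); rewrite ReD ReN; apply: le_trans; exact: ler_norm.
by have := Im_le_nc (z - w); rewrite ImD ImN; apply: le_trans; exact: ler_norm.
Qed.

End open_measurable.

(** * Fubini's theorem over varying fibres *)

Section fibered_complex_integral.
Context d1 d2 (T1 : measurableType d1) (T2 : measurableType d2) (R : realType).
Variables (m1 : {sigma_finite_measure set T1 -> \bar R}).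
Variables (m2 : {sigma_finite_measure set T2 -> \bar R}).

Lemma Rintegral_xsection (S : set (T1 * T2)) (A : set T1) (f : T1 * T2 -> R) (H : T1 -> R) :
  measurable S -> measurable A -> (forall x, ~ A x -> xsection S x = set0) ->
  (m1 \x m2)%E.-integrable S (EFin \o f) -> measurable_fun A H ->
  {ae m1, forall x, A x -> \int[m2]_(y in xsection S x) f (x, y) = H x} ->
  m1.-integrable A (EFin \o H) /\ \int[(m1 \x m2)%E]_(z in S) f z = \int[m1]_(x in A) H x.
Proof.
move=> mS mA A0 iF mH aeH.
have iF' : (m1 \x m2)%E.-integrable setT ((EFin \o f) \_ S) by exact/(integrable_mkcond _ mS).
have mF := measurable_fubini_F iF'; have iFF := integrable_fubini_F iF'.
have mH' : measurable_fun setT ((EFin \o H) \_ A).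
  by apply/(measurable_restrictT _ mA); exact/measurable_EFinP.
have ae : ae_eq m1 setT (fubini_F m2 ((EFin \o f) \_ S)) ((EFin \o H) \_ A).
  apply: filterS2 (ae_integrable1 iF') aeH => x ix hx _.
  have FE : fubini_F m2 ((EFin \o f) \_ S) x = (\int[m2]_(y in xsection S x) (f (x, y))%:E)%E.
    rewrite /fubini_F [RHS]integral_mkcond; apply: eq_integral => y _.
    by rewrite /patch mem_xsection.
  rewrite [RHS]/patch; case: ifPn => [/set_mem Ax|/negP nA]; last first.
    by rewrite FE A0 ?integral_set0// => Ax; apply: nA; exact/mem_set.
  rewrite FE /= -(hx Ax) /Rintegral fineK//.
  have : m2.-integrable (xsection S x) (EFin \o (fun y => f (x, y))).
    apply/integrable_mkcond; first exact: measurable_xsection.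
    move: ix; apply: eq_integrable => // y _.
    by rewrite /patch mem_xsection.
  move=> ifx; exact: (integrable_fin_num (measurable_xsection _ mS) ifx).
have iH' : m1.-integrable setT ((EFin \o H) \_ A).
  apply/integrableP; split => //; have /integrableP[_] := iFF.
  congr (_ < _)%E; apply: ae_eq_integral => //; try exact: measurableT_comp.
  by apply: filterS ae => x /(_ I) h _; rewrite /= h.
split; first exact/(integrable_mkcond _ mA).
rewrite /Rintegral; congr fine; rewrite [LHS]integral_mkcond -integral12_prod_meas1//.
by rewrite [RHS]integral_mkcond; exact: ae_eq_integral.
Qed.

(** Sections of an integrable function are integrable only almost everywhere. The identity for a
    fibre may therefore assume integrability of the section, and integrability of [H] becomes part
    of the conclusion. *)
Lemma Cint_xsection (S : set (T1 * T2)) (A : set T1) (f : T1 * T2 -> R[i]) (H : T1 -> R[i]) :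
  measurable S -> measurable A -> (forall x, ~ A x -> xsection S x = set0) ->
  Cintegrable (m1 \x m2)%E S f -> Cmeasurable A H ->
  (forall x, A x -> Cintegrable m2 (xsection S x) (fun y => f (x, y)) ->
     Cint m2 (xsection S x) (fun y => f (x, y)) = H x) ->
  Cintegrable m1 A H /\ Cint (m1 \x m2)%E S f = Cint m1 A H.
Proof.
move=> mS mA A0 [i1 i2] [mH1 mH2] hH.
have slice (g : T1 * T2 -> R) : (m1 \x m2)%E.-integrable S (EFin \o g) ->
    {ae m1, forall x, m2.-integrable (xsection S x) (EFin \o (fun y => g (x, y)))}.
  move=> ig; have ig' : (m1 \x m2)%E.-integrable setT ((EFin \o g) \_ S) by exact/(integrable_mkcond _ mS).
  apply: filterS (ae_integrable1 ig') => x ix.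
  apply/integrable_mkcond; first exact: measurable_xsection.
  by move: ix; apply: eq_integrable => // y _; rewrite /patch mem_xsection.
have [|j1 e1] := Rintegral_xsection mS mA A0 i1 mH1.
  apply: filterS2 (slice _ i1) (slice _ i2) => x h1 h2 Ax.
  by rewrite -(hH x Ax (conj h1 h2)).
have [|j2 e2] := Rintegral_xsection mS mA A0 i2 mH2.
  apply: filterS2 (slice _ i1) (slice _ i2) => x h1 h2 Ax.
  by rewrite -(hH x Ax (conj h1 h2)).
by split => //; rewrite /Cint e1 e2.
Qed.

End fibered_complex_integral.

(** * Comparison with the normed structure of complex space *)

Section complex_topology.
Context {R : realType}.
Implicit Types (z w l : R[i]).

Lemma normC_nc z : `|z : R[i]^o| = (nc z)%:C.
Proof. by []. Qed.

Lemma posC (e : R[i]) : 0 < e -> exists2 d : R, 0 < d & e = d%:C.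
Proof.
by case: e => a b; rewrite ltcE/= => /andP[/eqP -> a0]; exists a.
Qed.

Lemma nbhs_complexP z (U : set R[i]^o) :
  nbhs (z : R[i]^o) U <-> exists2 d : R, 0 < d & forall w, nc (w - z) < d -> U w.
Proof.
split.
  move=> /nbhs_ballP[e /= e0]; have [d d0 ->] := posC e0 => H; exists d => // w wz.
  by apply: H; rewrite -ball_normE/= normC_nc ltcR ncB.
move=> [d d0 H]; apply/nbhs_ballP; exists d%:C => /=; first by rewrite ltcR.
by move=> w; rewrite -ball_normE/= normC_nc ltcR ncB => /H.
Qed.

Lemma nbhs_complex2P (Q : C2 R) (U : set (C2 R)) :
  nbhs Q U <-> exists2 d : R, 0 < d &
    forall Q' : C2 R, nc (Q'.1 - Q.1) < d -> nc (Q'.2 - Q.2) < d -> U Q'.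
Proof.
case: Q => z w; split.
  move=> [[A B] [/= /nbhs_complexP[d d0 hA] /nbhs_complexP[e e0 hB]] AB].
  exists (Num.min d e); first by rewrite lt_min d0.
  by move=> Q'; rewrite !lt_min => /andP[/hA h1 _] /andP[_ /hB h2]; exact: AB.
move=> [d d0 H]; exists ([set z' | nc (z' - z) < d], [set w' | nc (w' - w) < d]).
  by split; apply/nbhs_complexP; exists d.
by move=> [z' w'] [/= h1 h2]; exact: H.
Qed.

Lemma cderiv_differentiable (f : R[i] -> R[i]) z l :
  cderiv f z l -> differentiable (f : R[i]^o -> R[i]^o) (z : R[i]^o).
Proof.
move=> df; apply/derivable1_diffP; rewrite /derivable; apply: (cvgP (l : R[i]^o)).
apply/cvgrPdist_lt => e /posC[d d0 ->]; have d2 : 0 < d / 2 by lra.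
have [r r0 hr] := df _ d2.
apply/nbhs_complexP; exists r => // h; rewrite subr0 => hr' /= h0.
have hn : 0 < nc h by rewrite nc_gt0.
have E : h *: (1 : R[i]^o) + z = h + z by congr (_ + _); exact: mulr1.
have := hr (h + z); rewrite addrK => /(_ hr') H; rewrite E.
have -> : (l : R[i]^o) - h^-1 *: (f (h + z) - f z : R[i]^o) = - (h^-1 * (f (h + z) - f z - l * h)).
  by rewrite mulrBr mulrCA mulVf// mulr1 opprB.
rewrite normC_nc ltcR ncN ncM ncV mulrC ltr_pdivrMr//.
by apply: le_lt_trans H _; rewrite ltr_pM2r//; lra.
Qed.

Lemma differentiable_cderiv (f : R[i] -> R[i]) z :
  differentiable (f : R[i]^o -> R[i]^o) (z : R[i]^o) -> exists l, cderiv f z l.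
Proof.
move=> /derivable1_diffP/cvg_ex[l /cvgrPdist_le H]; exists l => e e0.
have eC : (0 : R[i]) < e%:C by rewrite ltcR.
have /nbhs_complexP[d d0 hd] := H _ eC.
exists d => // w wz; have [->|wz0] := eqVneq w z.
  by rewrite !subrr mulr0 subr0 nc0 mulr_ge0 ?nc_ge0// ltW.
have h0 : w - z != 0 by rewrite subr_eq0.
have := hd (w - z); rewrite subr0 => /(_ wz h0) /=.
have E : (w - z) *: (1 : R[i]^o) + z = w.
  by rewrite [X in X + _](_ : _ = w - z) ?subrK//; exact: mulr1.
rewrite E.
have -> : (l : R[i]^o) - (w - z)^-1 *: (f w - f z : R[i]^o) = - ((w - z)^-1 * (f w - f z - l * (w - z))).
  by rewrite mulrBr mulrCA mulVf// mulr1 opprB.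
by rewrite normC_nc lecR ncN ncM ncV mulrC ler_pdivrMr// nc_gt0.
Qed.

(** Covers vertical slices as well as the curves [t |-> (t, c * g t)], along which the ratio of the
    second coordinate to [g] is constant. *)
Lemma differentiable_slice (F : C2 R -> R[i]) (u v : R[i] -> R[i]) z l m :
  cderiv u z l -> cderiv v z m -> differentiable (F : C2 R -> R[i]^o) ((u z, v z) : C2 R) ->
  exists k, cderiv (fun t => F (u t, v t)) z k.
Proof.
move=> du dv dF; apply: differentiable_cderiv.
have dp : differentiable ((fun t => (u t, v t)) : R[i]^o -> C2 R) (z : R[i]^o).
  exact: (differentiable_pair (cderiv_differentiable du) (cderiv_differentiable dv)).
exact: (differentiable_comp dp dF).
Qed.

Lemma differentiable_fst (f : R[i] -> R[i]) (Q : C2 R) l : cderiv f Q.1 l ->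
  differentiable ((fun Q => f Q.1) : C2 R -> R[i]^o) Q.
Proof.
move=> df.
have dfst : differentiable (fst : C2 R -> R[i]^o) Q.
  by apply: linear_differentiable => x; exact: cvg_fst.
exact: (differentiable_comp dfst (cderiv_differentiable df)).
Qed.

Lemma differentiable_snd (Q : C2 R) :
  differentiable (snd : C2 R -> R[i]^o) Q.
Proof. by apply: linear_differentiable => x; exact: cvg_snd. Qed.

End complex_topology.

(** * Hartogs domains over the unit disc *)

Section hartogs_domain.
Context {R : realType}.
Variables (g : R[i] -> R[i]) (B : R).
Hypothesis hg : cholomorphic g.
Hypothesis g0 : forall z, nc z < 1 -> g z != 0.
Hypothesis gB : forall z, nc z < 1 -> nc (g z) <= B.

Definition hartogs : set (C2 R) := [set Q | nc Q.1 < 1 /\ nc Q.2 < nc (g Q.1)].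

Lemma hartogs_open : open hartogs.
Proof.
rewrite openE => Q [h1 h2]; rewrite /interior; apply/nbhs_complex2P.
have [l /cderiv_continuous hc] := hg h1.
have e0 : 0 < (nc (g Q.1) - nc Q.2) / 2 by lra.
have [d d0 hd] := hc _ e0.
exists (Num.min (Num.min d (1 - nc Q.1)) ((nc (g Q.1) - nc Q.2) / 2)).
  by rewrite !lt_min d0 e0 subr_gt0 h1.
move=> Q'; rewrite !lt_min => /andP[/andP[k1 k2] _] /andP[_ k3]; split.
  by have := nc_triangle (Q'.1 - Q.1) Q.1; rewrite subrK; lra.
have := hd _ k1; have := nc_triangle (Q'.2 - Q.2) Q.2; rewrite subrK.
by have := nc_triangle (g Q.1 - g Q'.1) (g Q'.1); rewrite subrK ncB; lra.
Qed.

Lemma hartogs_center : hartogs (0, 0).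
Proof. by rewrite /hartogs /mkset nc0; split => //; rewrite nc_gt0 g0// nc0. Qed.

Lemma hartogs_connected : connected hartogs.
Proof.
(* A straight segment to the origin could leave the domain as [g] varies. For [t <= 1] the path runs
   along the zero section to [(Q.1, 0)]; afterwards it climbs inside the fibre to [Q]. *)
pose path (Q : C2 R) (t : R) : C2 R := ((Num.min t 1)%:C * Q.1, (Num.max (t - 1) 0)%:C * Q.2).
have -> : hartogs = \bigcup_(Q in hartogs) (path Q @` `[0, 2]).
  apply/seteqP; split => [Q hQ|Q [Q' [h1 h2] [t]]].
    exists Q => //; exists 2; first by rewrite /= in_itv/=; lra.
    have e1 : Num.min (2 : R) 1 = 1 by rewrite min_r; lra.
    have e2 : Num.max (2 - 1 : R) 0 = 1 by rewrite max_l; lra.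
    by rewrite /path e1 e2 !mul1r; case: Q {hQ}.
  rewrite /= in_itv/= => /andP[t0 t2] <-; rewrite /path /hartogs /mkset /= !ncM !nc_real.
  have [t1|t1] := leP t 1.
    rewrite max_r ?subr_le0// normr0 mul0r ger0_norm//.
    have h : t * nc Q'.1 < 1 by apply: le_lt_trans h1; rewrite ler_piMl// nc_ge0.
    by split => //; rewrite nc_gt0 g0// ncM nc_real ger0_norm.
  rewrite normr1 !mul1r; split => //.
  rewrite max_l; last lra.
  apply: le_lt_trans h2; rewrite ger0_norm ?ler_piMl ?nc_ge0//; lra.
apply: bigcup_connected.
  exists (0, 0) => Q hQ; exists 0; first by rewrite /= in_itv/= lexx ler0n.
  have e1 : Num.min (0 : R) 1 = 0 by rewrite min_l.
  have e2 : Num.max (0 - 1 : R) 0 = 0 by rewrite max_r//; lra.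
  by rewrite /path e1 e2 !mul0r.
move=> Q hQ; apply: connected_continuous_connected.
  exact: segment_connected.
apply: continuous_subspaceT => t U /nbhs_complex2P[d d0 hd].
have M0 : 0 < nc Q.1 + nc Q.2 + 1 by have := nc_ge0 Q.1; have := nc_ge0 Q.2; lra.
apply/nbhs_ballP; exists (d / (nc Q.1 + nc Q.2 + 1)); first exact: divr_gt0.
move=> s; rewrite -ball_normE/= ltr_pdivlMr// => hs; apply: hd; rewrite /path/= -mulrBl -rmorphB ncM nc_real.
  apply: le_lt_trans hs; apply: ler_pM; rewrite ?nc_ge0//.
    by rewrite !minEle; do 2 case: ifPn; rewrite -?ltNge ler_norml => h1 h2;
      have := ler_norm (t - s); have := ler_norm (s - t); rewrite (distrC s t); lra.
  by have := nc_ge0 Q.2; lra.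
apply: le_lt_trans hs; apply: ler_pM; rewrite ?nc_ge0//.
  by rewrite !maxEle; do 2 case: ifPn; rewrite -?ltNge ler_norml => h1 h2;
    have := ler_norm (t - s); have := ler_norm (s - t); rewrite (distrC s t); lra.
by have := nc_ge0 Q.1; lra.
Qed.

Lemma hartogs_domain : is_domain hartogs.
Proof.
by split; [exists (0, 0); exact: hartogs_center|exact: hartogs_open|exact: hartogs_connected].
Qed.

Lemma hartogs_bounded : bounded_set hartogs.
Proof.
exists (Num.max 1 B)%:C; split; first by rewrite complex_real.
move=> M hM Q [h1 h2]; apply: le_trans (ltW hM).
have b1 : nc Q.1 <= Num.max 1 B by rewrite le_max (ltW h1).
have b2 : nc Q.2 <= Num.max 1 B by rewrite le_max (le_trans (ltW h2) (gB h1)) orbT.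
rewrite prod_normE /Num.max; case: ifP => _; rewrite normC_nc lecR//.
Qed.

End hartogs_domain.

(** * The measure on R^4 and norms as integrals *)

Section lebesgue4_sigma_finite.
Context {R : realType}.
Local Notation mR := (measurableTypeR R).
Local Notation M2 := (mR * mR)%type.
Local Notation leb2 := (@lebesgue2 R).

(** A named form of the measure underlying [lebesgue4], to which sigma-finiteness is attached; the
    Schur test exchanges integrals over pairs of points of the domain. *)
Definition leb4 : set (M2 * M2) -> \bar R := (leb2 \x leb2)%E.
HB.instance Definition _ := Measure.on leb4.

Let leb4_sigma_finite : sigma_finite setT leb4.
Proof.
have /sigma_finiteP[F [TF ndF Foo]] := sigma_finiteT leb2.
exists (fun n => F n `*` F n).
  rewrite -setXTT TF predeqE => -[x y]; split.
    move=> [/= [n _ Fnx] [k _ Fky]]; exists (maxn n k) => //; split.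
    - by move: x Fnx; exact/subsetPset/ndF/leq_maxl.
    - by move: y Fky; exact/subsetPset/ndF/leq_maxr.
  by move=> [n _ []/= ? ?]; split; exists n.
move=> k; have [? ?] := Foo k.
split; first exact: measurableX.
by rewrite /leb4 product_measure1E// lte_mul_pinfty// ge0_fin_numE.
Qed.

HB.instance Definition _ := Measure_isSigmaFinite.Build _ _ _ leb4
  leb4_sigma_finite.

End lebesgue4_sigma_finite.

Section Lp_facts.
Context {R : realType}.
Local Notation mR := (measurableTypeR R).
Local Notation M2 := (mR * mR)%type.
Local Notation leb4 := (@leb4 R).
Implicit Types (D : set (C2 R)) (f g : C2 R -> R[i]) (p : R).

Lemma Lp_normE D p f : 0 < p -> Lp_norm D p f =
  ((\int[leb4]_(x in @C2_of_R4 R @^-1` D) (nc (f (C2_of_R4 x)) `^ p)%:E) `^ p^-1)%E.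
Proof.
move=> p0; rewrite /Lp_norm unlock; congr (_ `^ _)%E.
rewrite [RHS]integral_mkcond; apply: eq_integral => x _.
rewrite /patch; case: ifPn => _; first by rewrite /= ger0_norm ?nc_ge0.
by rewrite /= normr0 powR0// gt_eqF.
Qed.

Lemma Lp_norm_ltyP D p f : 0 < p ->
  (Lp_norm D p f < +oo)%E =
  (\int[leb4]_(x in @C2_of_R4 R @^-1` D) (nc (f (C2_of_R4 x)) `^ p)%:E < +oo)%E.
Proof.
move=> p0; rewrite Lp_normE//; set I := (\int[_]_(x in _) _)%E.
have I0 : (0 <= I)%E by apply: integral_ge0 => x _; rewrite lee_fin powR_ge0.
have ip : 0 < p^-1 by rewrite invr_gt0.
case: I I0 => [r r0| |//].
- by rewrite poweR_EFin !ltry.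
- by rewrite poweRyr ?gt_eqF// ltxx.
Qed.

Lemma integrable_sqr D f : in_Lp D 2 f -> measurable (@C2_of_R4 R @^-1` D) ->
  leb4.-integrable (@C2_of_R4 R @^-1` D) (EFin \o (fun x => nc (f (C2_of_R4 x)) ^+ 2)).
Proof.
move=> [mf]; rewrite Lp_norm_ltyP// => If mD; apply/integrableP; split.
  by apply/measurable_EFinP; apply: measurable_funX; exact: measurable_nc.
move: If; congr (_ < _)%E; apply: eq_integral => x _.
by rewrite /= powR_mulrn ?nc_ge0// ger0_norm// exprn_ge0// nc_ge0.
Qed.

Lemma in_L2P D f : measurable (@C2_of_R4 R @^-1` D) -> measurable_on D f ->
  leb4.-integrable (@C2_of_R4 R @^-1` D) (EFin \o (fun x => nc (f (C2_of_R4 x)) ^+ 2)) ->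
  in_Lp D 2 f.
Proof.
move=> mD mf /integrableP[_ If]; split => //; rewrite Lp_norm_ltyP//.
move: If; congr (_ < _)%E; apply: eq_integral => x _.
by rewrite /= powR_mulrn ?nc_ge0// ger0_norm// exprn_ge0// nc_ge0.
Qed.

Lemma Cintegrable_L2 D f g : measurable (@C2_of_R4 R @^-1` D) -> in_Lp D 2 f -> in_Lp D 2 g ->
  Cintegrable leb4 (@C2_of_R4 R @^-1` D) (fun x => f (C2_of_R4 x) * (g (C2_of_R4 x))^*).
Proof.
move=> mD fL gL; apply: (le_Cintegrable (h := fun x => nc (f (C2_of_R4 x)) ^+ 2 + nc (g (C2_of_R4 x)) ^+ 2)) => //.
- by apply: CmeasurableM; [exact: fL.1|apply: Cmeasurable_conj; exact: gL.1].
- move=> x _; rewrite ncM nc_conj; have := sqr_ge0 (nc (f (C2_of_R4 x)) - nc (g (C2_of_R4 x))).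
  have := nc_ge0 (f (C2_of_R4 x)); have := nc_ge0 (g (C2_of_R4 x)); nra.
by have := integrableD mD (integrable_sqr fL mD) (integrable_sqr gL mD); apply: eq_integrable.
Qed.

Lemma in_L2D D f g : measurable (@C2_of_R4 R @^-1` D) -> in_Lp D 2 f -> in_Lp D 2 g ->
  in_Lp D 2 (fun z => f z + g z).
Proof.
move=> mD fL gL; apply: in_L2P => //; first exact: CmeasurableD fL.1 gL.1.
have := integrableZl mD 2 (integrableD mD (integrable_sqr fL mD) (integrable_sqr gL mD)).
apply: le_integrable => //.
  apply/measurable_EFinP; apply: measurable_funX; apply: measurable_nc.
  exact: CmeasurableD fL.1 gL.1.
move=> x _; rewrite /= -?EFinD -?EFinM lee_fin !ger0_norm; last 2 first.
- by rewrite mulr_ge0// addr_ge0// exprn_ge0// nc_ge0.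
- by rewrite exprn_ge0// nc_ge0.
have := nc_triangle (f (C2_of_R4 x)) (g (C2_of_R4 x)); have := nc_ge0 (f (C2_of_R4 x) + g (C2_of_R4 x)).
by have := sqr_ge0 (nc (f (C2_of_R4 x)) - nc (g (C2_of_R4 x))); nra.
Qed.

Lemma in_L2Z D c f : measurable (@C2_of_R4 R @^-1` D) -> in_Lp D 2 f ->
  in_Lp D 2 (fun z => c * f z).
Proof.
move=> mD fL; apply: in_L2P => //; first by apply: CmeasurableM fL.1; exact: Cmeasurable_cst.
have := integrableZl mD (nc c ^+ 2) (integrable_sqr fL mD).
by apply: eq_integrable => // x _; rewrite /= ncM exprMn.
Qed.

End Lp_facts.

(** * Integration over the Hartogs domain *)

Section hartogs_integral.
Context {R : realType}.
Local Notation mR := (measurableTypeR R).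
Local Notation M2 := (mR * mR)%type.
Local Notation leb2 := (@lebesgue2 R).
Local Notation leb4 := (@leb4 R).
Variable g : R[i] -> R[i].
Hypothesis hg : cholomorphic g.

(** Unfolds to the preimage of [hartogs g] under [C2_of_R4], in a form whose sections are visibly
    discs. *)
Definition hartogs4 : set (M2 * M2) :=
  [set x | disc 1 x.1 /\ disc (nc (g (toC x.1))) x.2].

Lemma Cmeasurable_holo : Cmeasurable (disc 1) (fun p : M2 => g (toC p)).
Proof.
apply: Cmeasurable_continuous => w w1; have [l hl] := hg w1.
exact: cderiv_continuous hl.
Qed.

Lemma measurable_hartogs4 : measurable hartogs4.
Proof.
pose D : set (M2 * M2) := disc 1 `*` setT.
have mD : measurable D by apply: measurableX => //; exact: measurable_disc.
pose u (x : M2 * M2) : mR := nc (g (toC x.1)) - nc (toC x.2).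
have mu : measurable_fun D u.
  apply: measurable_funB.
    apply: (measurable_comp (F := disc 1) (f := fun p => nc (g (toC p))) (g := fst)).
    - exact: measurable_disc.
    - by move=> _ [x [hx _] <-].
    - by apply: measurable_nc; exact: Cmeasurable_holo.
    - exact: measurable_funTS measurable_fst.
  apply: measurable_nc; apply: (Cmeasurable_comp (B := setT) (f := toC) (h := snd)) => //.
    exact: Cmeasurable_toC.
  exact: measurable_funTS measurable_snd.
have -> : hartogs4 = D `&` u @^-1` `]0, +oo[.
  apply/seteqP; split => x; rewrite /hartogs4 /D /u /disc /= in_itv/= andbT subr_gt0.
    by move=> [? ?].
  by move=> [[? _] ?].
exact: mu mD _ (measurable_itv _).
Qed.

Lemma xsection_hartogs4 p : disc 1 p -> xsection hartogs4 p = disc (nc (g (toC p))).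
Proof.
by move=> p1; apply/seteqP; split => q; rewrite /xsection/= inE /hartogs4/=; [case|].
Qed.

Lemma xsection_hartogs4_out p : ~ disc 1 p -> xsection hartogs4 p = set0.
Proof.
by move=> p1; apply/seteqP; split => q //; rewrite /xsection/= inE /hartogs4/=; case.
Qed.

Lemma ge0_integral_hartogs4 (f : M2 * M2 -> \bar R) : measurable_fun hartogs4 f ->
  (forall x, hartogs4 x -> (0 <= f x)%E) ->
  (\int[leb4]_(x in hartogs4) f x =
   \int[leb2]_(p in disc 1) \int[leb2]_(q in disc (nc (g (toC p)))) f (p, q))%E.
Proof.
move=> mf f0; rewrite [RHS]integral_mkcond.
transitivity (\int[leb2]_x \int[leb2]_(y in xsection hartogs4 x) f (x, y))%E.
  exact: (ge0_integral_xsection _ _ measurable_hartogs4 mf f0).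
apply: eq_integral => p _; rewrite /patch; case: ifPn => [/set_mem|/negP] p1.
  by rewrite xsection_hartogs4.
by rewrite xsection_hartogs4_out ?integral_set0// => h; apply: p1; exact/mem_set.
Qed.

Lemma Cint_hartogs4 (f : M2 * M2 -> R[i]) (H : M2 -> R[i]) :
  Cintegrable leb4 hartogs4 f -> Cmeasurable (disc 1) H ->
  (forall p, disc 1 p -> Cintegrable leb2 (disc (nc (g (toC p)))) (fun q => f (p, q)) ->
     Cint leb2 (disc (nc (g (toC p)))) (fun q => f (p, q)) = H p) ->
  Cintegrable leb2 (disc 1) H /\ Cint leb4 hartogs4 f = Cint leb2 (disc 1) H.
Proof.
move=> iF mH hH; apply: (Cint_xsection measurable_hartogs4 (measurable_disc 1) xsection_hartogs4_out iF mH).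
by move=> p p1; rewrite xsection_hartogs4//; exact: hH.
Qed.

End hartogs_integral.

Section disc_measure.
Context {R : realType}.
Local Notation mR := (measurableTypeR R).
Local Notation leb2 := (@lebesgue2 R).
Local Notation A1 := (@disc_area R).

Lemma lebesgue2_disc1 : leb2 (disc 1) = A1%:E.
Proof.
have := @ge0_integral_radial R (fun=> 1%E) (measurable_cst _) (fun _ _ => lee01).
rewrite integral_cst; last exact: measurable_disc.
rewrite mul1e => ->; rewrite integral_cst//= mul1e lebesgue_measure_itv/= lte_fin ltr01.
by rewrite sube0 mule1.
Qed.

Lemma lebesgue2_disc_at c r : 0 < r -> leb2 (disc_at c r) = (r ^+ 2 * A1)%:E.
Proof.
move=> r0; have ri : 0 < r^-1 by rewrite invr_gt0.
have [_ /(_ _ (measurable_disc 1))] := scales_affine2 (- (r^-1)%:C * c) ri.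
by rewrite affine2_disc_at// exprVn invrK [X in (_ * X)%E]lebesgue2_disc1.
Qed.

End disc_measure.

(** * The kernel of the Hartogs domain *)

Section bergman_kernel.
Context {R : realType}.
Local Notation mR := (measurableTypeR R).
Local Notation M2 := (mR * mR)%type.
Local Notation leb2 := (@lebesgue2 R).
Local Notation leb4 := (@leb4 R).
Local Notation A1 := (@disc_area R).
Variable g : R[i] -> R[i].
Hypothesis hg : cholomorphic g.
Hypothesis g0 : forall z, nc z < 1 -> g z != 0.
Implicit Types (P Q : C2 R).

(* [(z, w) |-> (z, w / g z)] maps the domain onto the bidisc with Jacobian
   [(g z)^-1], so this is the transported kernel of the bidisc. *)
Definition hkernel P Q : R[i] := (A1 ^- 2)%:C *
  ((1 - Q.1 * P.1^*)^-1 ^+ 2 * (g Q.1 * (g P.1)^*) * (g Q.1 * (g P.1)^* - Q.2 * P.2^*)^-1 ^+ 2).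

Lemma nc_hkernel P Q : nc (hkernel P Q) = A1 ^- 2 * ((nc (1 - Q.1 * P.1^*))^-1 ^+ 2 *
  (nc (g Q.1) * nc (g P.1)) * (nc (g Q.1 * (g P.1)^* - Q.2 * P.2^*))^-1 ^+ 2).
Proof.
have a0 := @disc_area_gt0 R.
rewrite /hkernel ncM nc_real ger0_norm ?invr_ge0 ?exprn_ge0 ?(ltW a0)//.
by rewrite (ncM (_ * _) (_ ^+ 2)) (ncM (_ ^+ 2) (_ * _)) 2!ncX 2!ncV (ncM (g Q.1) (_^*)) nc_conj.
Qed.

Lemma hkernel_sym P Q : nc (hkernel P Q) = nc (hkernel Q P).
Proof.
have e1 : nc (1 - Q.1 * P.1^*) = nc (1 - P.1 * Q.1^*).
  by rewrite -[LHS]nc_conj conjcB cconj1 conjcM conjcK mulrC.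
have e2 : nc (g Q.1 * (g P.1)^* - Q.2 * P.2^*) = nc (g P.1 * (g Q.1)^* - P.2 * Q.2^*).
  by rewrite -[LHS]nc_conj conjcB !conjcM !conjcK [_ * g P.1]mulrC [_ * P.2]mulrC.
rewrite !nc_hkernel e1 e2; ring.
Qed.

Lemma hkernel_den_neq0 P Q : hartogs g P -> hartogs g Q -> g Q.1 * (g P.1)^* - Q.2 * P.2^* != 0.
Proof.
move=> [p1 p2] [q1 q2]; rewrite -nc_gt0.
apply: lt_le_trans (nc_lower _ _); rewrite !ncM !nc_conj subr_gt0.
by apply: ltr_pM; rewrite ?nc_ge0.
Qed.

Lemma hkernel_base_neq0 P Q : hartogs g P -> hartogs g Q -> 1 - Q.1 * P.1^* != 0.
Proof. by move=> [p1 _] [q1 _]; apply: one_sub_neq0; apply: nc_mul_conj_lt1 => //; exact: ltW. Qed.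

(** Abstracting the six ingredients of the kernel gives measurability in one variable and jointly in
    both from a single statement. *)
Lemma Cmeasurable_kernel_form d (T : measurableType d) (A : set T) (k : R[i]) (a b ga gb u v : T -> R[i]) :
  Cmeasurable A a -> Cmeasurable A b -> Cmeasurable A ga -> Cmeasurable A gb ->
  Cmeasurable A u -> Cmeasurable A v ->
  Cmeasurable A (fun x => k * ((1 - a x * (b x)^*)^-1 ^+ 2 * (ga x * (gb x)^*) *
    (ga x * (gb x)^* - u x * (v x)^*)^-1 ^+ 2)).
Proof.
move=> ma mb mga mgb mu mv.
have mG : Cmeasurable A (fun x => ga x * (gb x)^*) by apply: CmeasurableM => //; exact: Cmeasurable_conj.
apply: CmeasurableM; first exact: Cmeasurable_cst.
apply: CmeasurableM; last first.
  apply/CmeasurableX/CmeasurableV; apply: CmeasurableB => //.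
  by apply: CmeasurableM => //; exact: Cmeasurable_conj.
apply: CmeasurableM => //; apply/CmeasurableX/CmeasurableV; apply: CmeasurableB; first exact: Cmeasurable_cst.
by apply: CmeasurableM => //; exact: Cmeasurable_conj.
Qed.

Lemma Cmeasurable_hartogs1 : Cmeasurable (hartogs4 g) (fun x => (C2_of_R4 x).1).
Proof.
apply: (Cmeasurable_comp (B := setT) (f := toC) (h := fst)) => //; first exact: Cmeasurable_toC.
exact: measurable_funTS measurable_fst.
Qed.

Lemma Cmeasurable_hartogs2 : Cmeasurable (hartogs4 g) (fun x => (C2_of_R4 x).2).
Proof.
apply: (Cmeasurable_comp (B := setT) (f := toC) (h := snd)) => //; first exact: Cmeasurable_toC.
exact: measurable_funTS measurable_snd.
Qed.

Lemma Cmeasurable_hartogs_fun (f : R[i] -> R[i]) : Cmeasurable (disc 1) (fun p => f (toC p)) ->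
  Cmeasurable (hartogs4 g) (fun x => f (C2_of_R4 x).1).
Proof.
move=> mf; apply: (Cmeasurable_comp (B := disc 1) (f := fun p => f (toC p)) (h := fst)) => //.
- by move=> _ [x [hx _] <-].
- exact: measurable_funTS measurable_fst.
Qed.

Lemma measurable_hkernel P : measurable_on (hartogs g) (hkernel P).
Proof.
apply: Cmeasurable_kernel_form; try exact: Cmeasurable_cst.
- exact: Cmeasurable_hartogs1.
- exact: Cmeasurable_hartogs_fun (Cmeasurable_holo hg).
- exact: Cmeasurable_hartogs2.
Qed.

Lemma measurable_hkernel2 : measurable_fun (hartogs4 g `*` hartogs4 g)
  (fun x => nc (hkernel (C2_of_R4 x.1) (C2_of_R4 x.2))).
Proof.
have mH := measurable_hartogs4 hg.
have m1 (f : C2 R -> R[i]) : Cmeasurable (hartogs4 g) (fun x => f (C2_of_R4 x)) ->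
    Cmeasurable (hartogs4 g `*` hartogs4 g) (fun x => f (C2_of_R4 x.1)).
  move=> mf; apply: (Cmeasurable_comp (B := hartogs4 g) (f := fun x => f (C2_of_R4 x)) (h := fst)) => //.
    by move=> _ [x [hx _] <-].
  exact: measurable_funTS measurable_fst.
have m2 (f : C2 R -> R[i]) : Cmeasurable (hartogs4 g) (fun x => f (C2_of_R4 x)) ->
    Cmeasurable (hartogs4 g `*` hartogs4 g) (fun x => f (C2_of_R4 x.2)).
  move=> mf; apply: (Cmeasurable_comp (B := hartogs4 g) (f := fun x => f (C2_of_R4 x)) (h := snd)) => //.
    by move=> _ [x [_ hx] <-].
  exact: measurable_funTS measurable_snd.
apply: measurable_nc; apply: Cmeasurable_kernel_form.
- exact: (m2 fst Cmeasurable_hartogs1).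
- exact: (m1 fst Cmeasurable_hartogs1).
- exact: (m2 (fun Q => g Q.1) (Cmeasurable_hartogs_fun (Cmeasurable_holo hg))).
- exact: (m1 (fun Q => g Q.1) (Cmeasurable_hartogs_fun (Cmeasurable_holo hg))).
- exact: (m2 snd Cmeasurable_hartogs2).
- exact: (m1 snd Cmeasurable_hartogs2).
Qed.

Lemma hkernel_holomorphic P : hartogs g P -> holomorphic_on (hartogs g) (hkernel P).
Proof.
move=> hP Q hQ; have [l hl] := hg hQ.1.
have dg : differentiable ((fun Q => g Q.1) : C2 R -> R[i]^o) Q by exact: differentiable_fst hl.
have dz : differentiable ((fun Q => Q.1) : C2 R -> R[i]^o) Q by exact: (differentiable_fst (cderiv_id _)).
have dw : differentiable ((fun Q => Q.2) : C2 R -> R[i]^o) Q by exact: differentiable_snd.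
have dc (c : R[i]) : differentiable ((fun=> c) : C2 R -> R[i]^o) Q by exact: differentiable_cst.
have dM (f h : C2 R -> R[i]) : differentiable (f : C2 R -> R[i]^o) Q ->
    differentiable (h : C2 R -> R[i]^o) Q -> differentiable ((fun Q => f Q * h Q) : C2 R -> R[i]^o) Q.
  by move=> df dh; exact: (differentiableM df dh).
have dB (f h : C2 R -> R[i]) : differentiable (f : C2 R -> R[i]^o) Q ->
    differentiable (h : C2 R -> R[i]^o) Q -> differentiable ((fun Q => f Q - h Q) : C2 R -> R[i]^o) Q.
  by move=> df dh; exact: (differentiableB df dh).
have dV2 (f : C2 R -> R[i]) : differentiable (f : C2 R -> R[i]^o) Q -> f Q != 0 ->
    differentiable ((fun Q => (f Q)^-1 ^+ 2) : C2 R -> R[i]^o) Q.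
  move=> df f0; have dV := differentiableV df f0.
  exact: (dM _ _ dV dV).
have d1 := dM _ _ dg (dc (g P.1)^*).
apply: (dM _ _ (dc (A1 ^- 2)%:C)); apply: (dM _ _).
  exact: (dM _ _ (dV2 _ (dB _ _ (dc 1) (dM _ _ dz (dc P.1^*))) (hkernel_base_neq0 hP hQ)) d1).
exact: (dV2 _ (dB _ _ d1 (dM _ _ dw (dc P.2^*))) (hkernel_den_neq0 hP hQ)).
Qed.

(** For fixed [P] inside the domain, [|1 - Q.1 * P.1^*|] is at least [1 - |P.1|] and the fibre
    denominator at least a multiple of [|g Q.1|]. What remains is [1 / |g|], which is square
    integrable because the fibre has area proportional to [|g|^2]. *)
Lemma hkernel_le P : hartogs g P -> exists2 M : R, 0 <= M &
  forall Q, hartogs g Q -> nc (hkernel P Q) <= M / nc (g Q.1).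
Proof.
move=> hP; have [p1 p2] := hP; set d := nc (g P.1) - nc P.2; have d0 : 0 < d by rewrite subr_gt0.
have a0 := @disc_area_gt0 R.
exists (A1 ^- 2 * ((1 - nc P.1) ^- 2 * nc (g P.1) * d ^- 2)).
  by rewrite !mulr_ge0 ?nc_ge0 ?invr_ge0 ?exprn_ge0// ?subr_ge0 ltW.
move=> Q hQ; have [q1 q2] := hQ; have gQ : 0 < nc (g Q.1) by rewrite nc_gt0 g0.
rewrite nc_hkernel -[leRHS]mulrA ler_wpM2l ?invr_ge0 ?exprn_ge0 ?(ltW a0)//.
have e1 : (nc (1 - Q.1 * P.1^*))^-1 <= (1 - nc P.1)^-1.
  have := nc_one_sub_ge P.1 (ltW q1); rewrite -[nc (1 - Q.1 * _)]nc_conj conjcB cconj1 conjcM conjcK mulrC => h.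
  by rewrite lef_pV2 ?posrE//; lra.
have e2 : (nc (g Q.1 * (g P.1)^* - Q.2 * P.2^*))^-1 <= (nc (g Q.1) * d)^-1.
  rewrite lef_pV2 ?posrE ?mulr_gt0//; last by rewrite nc_gt0 hkernel_den_neq0.
  apply: le_trans (nc_lower _ _); rewrite !ncM !nc_conj mulrBr lerD2l lerN2.
  by rewrite ler_wpM2r ?nc_ge0// ltW.
apply: (@le_trans _ _ (((1 - nc P.1)^-1) ^+ 2 * (nc (g Q.1) * nc (g P.1)) * ((nc (g Q.1) * d)^-1) ^+ 2)).
  apply: ler_pM; rewrite ?mulr_ge0 ?exprn_ge0 ?invr_ge0 ?nc_ge0//.
    by rewrite ler_wpM2r ?mulr_ge0 ?nc_ge0// lerXn2r ?nnegrE ?invr_ge0 ?nc_ge0 ?subr_ge0// ltW.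
  by rewrite lerXn2r ?nnegrE ?invr_ge0 ?mulr_ge0 ?nc_ge0// ltW.
rewrite le_eqVlt; apply/orP; left; apply/eqP.
by field; rewrite ?gt_eqF ?subr_gt0//.
Qed.

Lemma hkernel_bergman P : hartogs g P -> bergman_space (hartogs g) (hkernel P).
Proof.
move=> hP; split; first exact: hkernel_holomorphic.
have [M M0 hM] := hkernel_le hP; have mH := measurable_hartogs4 hg.
apply: (in_L2P mH (measurable_hkernel _)).
have mnc : measurable_fun (hartogs4 g) (fun x => nc (hkernel P (C2_of_R4 x))).
  by apply: measurable_nc; exact: measurable_hkernel.
have mG : measurable_fun (hartogs4 g) (fun x => nc (g (C2_of_R4 x).1)^-1).
  apply: measurable_nc; apply: CmeasurableV.
  exact: Cmeasurable_hartogs_fun (Cmeasurable_holo hg).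
pose f (x : M2 * M2) := M ^+ 2 * nc (g (C2_of_R4 x).1)^-1 ^+ 2.
have mf : measurable_fun (hartogs4 g) (EFin \o f).
  by apply/measurable_EFinP; apply: measurable_funM => //; exact: measurable_funX.
have f0 x : (0 <= (f x)%:E)%E by rewrite lee_fin mulr_ge0// exprn_ge0// nc_ge0.
have iF : leb4.-integrable (hartogs4 g) (EFin \o f).
  apply/integrableP; split => //.
  under eq_integral do rewrite /= ger0_norm ?mulr_ge0 ?exprn_ge0 ?nc_ge0//.
  rewrite ge0_integral_hartogs4//.
  apply: (@le_lt_trans _ _ (\int[leb2]_(p in disc 1) ((M ^+ 2 * A1)%:E))%E); last first.
    rewrite integral_cst//.
    by rewrite [X in (_ * X)%E]lebesgue2_disc1 -EFinM ltry.
  have E p : disc 1 p -> (\int[leb2]_(q in disc (nc (g (toC p)))) (f (p, q))%:E = (M ^+ 2 * A1)%:E)%E.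
    move=> p1; have gp : 0 < nc (g (toC p)) by rewrite nc_gt0 g0.
    rewrite (@eq_integral _ _ _ _ _ (cst (M ^+ 2 * (nc (g (toC p)))^-1 ^+ 2)%:E)); last first.
      by move=> q _; rewrite /f ncV.
    rewrite integral_cst; last exact: measurable_disc.
    rewrite -disc_at0 [X in (_ * X)%E](lebesgue2_disc_at _ gp) -EFinM; congr EFin.
    by field; exact: lt0r_neq0.
  rewrite (@eq_integral _ _ _ _ _ (fun=> (M ^+ 2 * A1)%:E))// => p /set_mem p1.
  exact: E.
apply: (le_integrable _ _ _ iF) => //.
  by apply/measurable_EFinP; exact: measurable_funX.
move=> x hx /=; rewrite lee_fin !ger0_norm ?mulr_ge0 ?exprn_ge0 ?nc_ge0//.
rewrite /f -exprMn lerXn2r ?nnegrE ?mulr_ge0 ?nc_ge0// ncV.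
exact: hM.
Qed.

End bergman_kernel.

(** * The reproducing formula on the Hartogs domain *)

Section reproducing.
Context {R : realType}.
Local Notation mR := (measurableTypeR R).
Local Notation M2 := (mR * mR)%type.
Local Notation leb2 := (@lebesgue2 R).
Local Notation leb4 := (@leb4 R).
Local Notation A1 := (@disc_area R).
Variable g : R[i] -> R[i].
Hypothesis hg : cholomorphic g.
Hypothesis g0 : forall z, nc z < 1 -> g z != 0.
Implicit Types (P Q : C2 R).

Lemma holo_slice2 (G : C2 R -> R[i]) z w : holomorphic_on (hartogs g) G -> hartogs g ((z, w) : C2 R) ->
  exists l, cderiv (fun t => G (z, t)) w l.
Proof.
move=> hG hzw; apply: (@differentiable_slice R G (fun=> z) id w 0 1).
- exact: cderiv_cst.
- exact: cderiv_id.
- exact: hG.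
Qed.

(** In [(t, c)] the function [g t * G (t, c * g t)] is the pull-back of [G] to the bidisc, with the
    factor [g t] that makes pull-back preserve the inner product. *)
Lemma holo_slice1 (G : C2 R -> R[i]) (c : R[i]) : holomorphic_on (hartogs g) G -> nc c < 1 ->
  cholomorphic (fun t => g t * G (t, c * g t)).
Proof.
move=> hG c1 z z1; have [l hl] := hg z1.
have hz : hartogs g ((z, c * g z) : C2 R).
  by split => //=; rewrite ncM gtr_pMl// nc_gt0 g0.
have [k hk] := differentiable_slice (cderiv_id z) (cderivZ c hl) (hG _ hz).
by eexists; exact: cderivM hl hk.
Qed.

Lemma slice_in (G : C2 R -> R[i]) p : holomorphic_on (hartogs g) G -> disc 1 p ->
  forall w, nc w < nc (g (toC p)) -> exists l, cderiv (fun t => G (toC p, t)) w l.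
Proof. by move=> hG p1 w w1; apply: holo_slice2. Qed.

(** On the fibre over [ze] the formula for a disc of radius [|g ze|] evaluates [G] at the point with
    the same ratio [c = w / g z]. What results is [k ze] times the disc kernel at [z], up to a
    constant, so the formula for the unit disc evaluates [k] at [z], and [k z = G (z, w)]. *)
Lemma hkernel_reproducing (G : C2 R -> R[i]) P : bergman_space (hartogs g) G -> hartogs g P ->
  L2_inner (hartogs g) G (hkernel g P) = G P.
Proof.
move=> [hG LG] hP; case: P hP => z w hP; have [z1 w1] := hP; rewrite /= in z1 w1.
have gz : g z != 0 by exact: g0.
have mH := measurable_hartogs4 hg; have a0 := @disc_area_gt0 R.
have aC : A1%:C != 0 :> R[i] by rewrite -nc_gt0 nc_real normr_gt0 gt_eqF.
pose c := w / g z; have c1 : nc c < 1 by rewrite ncM ncV ltr_pdivrMr ?nc_gt0// mul1r.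
pose k t := (g z)^-1 * (g t * G (t, c * g t)).
have hk : cholomorphic k.
  move=> t t1; have [l hl] := holo_slice1 hG c1 t1.
  by eexists; exact: cderivZ hl.
pose s p := (1 - z * (toC p)^*)^-1 ^+ 2.
pose H (p : M2) := (A1^-1)%:C * (k (toC p) * s p).
have ms : Cmeasurable (disc 1) s by apply/CmeasurableX/CmeasurableV; exact: Cmeasurable_one_sub.
have mk : Cmeasurable (disc 1) (fun p => k (toC p)) by exact: Cmeasurable_holo.
have mHf : Cmeasurable (disc 1) H.
  by apply: CmeasurableM; [exact: Cmeasurable_cst|exact: CmeasurableM].
have iF := Cintegrable_L2 mH LG (hkernel_bergman hg g0 hP).2.
have [|iH E] := Cint_hartogs4 hg iF mHf.
  move=> p p1; set ze := toC p; set r := nc (g ze).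
  have ze1 : nc ze < 1 by exact: p1.
  have gze : g ze != 0 by exact: g0.
  have r0 : 0 < r by rewrite nc_gt0.
  have r2 : (r ^+ 2)%:C = g ze * (g ze)^* by rewrite mulc_conj.
  have gzec : (g ze)^* != 0 by rewrite -nc_gt0 nc_conj.
  have gzc : (g z)^* != 0 by rewrite -nc_gt0 nc_conj nc_gt0.
  pose x := c * g ze.
  have xr : nc x < r by rewrite ncM gtr_pMl.
  (* All of the conjugated kernel that does not vary along the fibre. *)
  pose K0 := (A1 ^- 2)%:C * (s p * (g z * (g ze)^*) * (g ze / g z) ^+ 2).
  have sp0 : 1 - z * (toC p)^* != 0.
    by apply: one_sub_neq0; apply: nc_mul_conj_lt1 => //; exact: ltW.
  have K00 : K0 != 0.
    rewrite /K0 !mulf_neq0 ?expf_neq0 ?invr_eq0//.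
    by rewrite -nc_gt0 nc_real normr_gt0 gt_eqF// invr_gt0 exprn_gt0.
  have KE (q : M2) : disc r q -> (hkernel g ((z, w) : C2 R) (ze, toC q))^* =
      K0 * ((r ^+ 2)%:C - x * (toC q)^*)^-1 ^+ 2.
    move=> q1.
    have conjV (y : R[i]) : (y^-1)^* = (y^*)^-1.
      by apply: complex_eq; rewrite ?Re_conj ?Im_conj ?ReV ?ImV ?Re_conj ?Im_conj ?nc_conj// ?mulNr ?opprK.
    have conjX (y : R[i]) : (y ^+ 2)^* = (y^*) ^+ 2 by rewrite !expr2 conjcM.
    rewrite /hkernel /fst /snd conjcM conjc_real (conjcM (_ * _) (_ ^+ 2)) (conjcM (_ ^+ 2) (_ * _)) !conjX !conjV.
    rewrite !conjcB cconj1 !conjcM !conjcK /K0 /s -/ze.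
    have -> : (r ^+ 2)%:C - x * (toC q)^* = (g ze / g z) * ((g ze)^* * g z - (toC q)^* * w).
      by rewrite r2 /x /c; field.
    rewrite [ze^* * z]mulrC; set Y := (_^* * g z - _ * w).
    rewrite (invfM (g ze / g z) Y); move: Y^-1 (1 - z * ze^*)^-1 (A1 ^- 2)%:C => Yi S a2.
    by field; rewrite ?gze ?gz.
  have mK : Cmeasurable (disc r) (fun q => (r ^+ 2)%:C - x * (toC q)^*).
    apply: CmeasurableB; first exact: Cmeasurable_cst.
    apply: CmeasurableM; first exact: Cmeasurable_cst.
    by apply: Cmeasurable_conj; exact: Cmeasurable_toC.
  have D0 (q : M2) : disc r q -> (r ^+ 2)%:C - x * (toC q)^* != 0.
    move=> q1; rewrite -nc_gt0; apply: lt_le_trans (nc_lower _ _).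
    rewrite nc_real ger0_norm ?exprn_ge0 ?(ltW r0)// ncM nc_conj subr_gt0 expr2.
    by apply: ltr_pM; rewrite ?nc_ge0.
  move=> iS.
  (* Only the product of [G] with the kernel is known to be integrable on the fibre. The inverse of
     the kernel is bounded there, since [|r^2 - x * conj q| <= 2 r^2], so it can be multiplied
     away. *)
  have iG : Cintegrable leb2 (disc r) (fun q => G (ze, toC q)).
    have := @Cintegrable_bounded_mul _ _ _ leb2 (disc r) _
      (fun q => K0^-1 * ((r ^+ 2)%:C - x * (toC q)^*) ^+ 2) (nc K0^-1 * (2 * r ^+ 2) ^+ 2) (measurable_disc r) iS.
    have mm : Cmeasurable (disc r) (fun q => K0^-1 * ((r ^+ 2)%:C - x * (toC q)^*) ^+ 2).
      by apply: CmeasurableM; [exact: Cmeasurable_cst|exact: CmeasurableX].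
    move=> /(_ mm)/(_ _)[].
      move=> q q1; rewrite ncM ncX ler_wpM2l ?nc_ge0// lerXn2r ?nnegrE ?nc_ge0 ?mulr_ge0 ?exprn_ge0 ?(ltW r0)//.
      apply: (le_trans (nc_subadd _ _)); rewrite nc_real ger0_norm ?exprn_ge0 ?(ltW r0)// ncM nc_conj.
      have : nc x * nc (toC q) <= r * r by apply: ler_pM; rewrite ?nc_ge0// ltW.
      rewrite -expr2; lra.
    move=> j1 j2; apply: (eq_Cintegrable (measurable_disc r) _ (conj j1 j2)) => q /set_mem q1.
    have Dq := D0 _ q1.
    change (G (ze, toC q) * (hkernel g ((z, w) : C2 R) (ze, toC q))^* *
      (K0^-1 * ((r ^+ 2)%:C - x * (toC q)^*) ^+ 2) = G (ze, toC q)).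
    rewrite KE// -mulrA -[RHS]mulr1; congr (_ * _).
    by rewrite mulrACA mulfV// mul1r -exprMn mulVf// expr1n.
  have := disc_reproducing_radius r0 xr (slice_in hG p1) iG => /(congr1 ( *%R K0)).
  rewrite -CintZ//; last first.
  - have [i1 i2] := iS; have iK := CintegrableZ K0^-1 (measurable_disc r) iS.
    apply: eq_Cintegrable iK; first exact: measurable_disc.
    move=> q /set_mem q1.
    change (K0^-1 * (G (ze, toC q) * (hkernel g ((z, w) : C2 R) (ze, toC q))^*) =
      G (ze, toC q) * ((r ^+ 2)%:C - x * (toC q)^*)^-1 ^+ 2).
    by rewrite KE// mulrCA mulKf.
  move=> EE; transitivity (K0 * ((A1 / r ^+ 2)%:C * G (ze, x))).
    rewrite -EE; apply: eq_Cint => q /set_mem q1.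
    change (G (ze, toC q) * (hkernel g ((z, w) : C2 R) (ze, toC q))^* =
      K0 * (G (ze, toC q) * ((r ^+ 2)%:C - x * (toC q)^*)^-1 ^+ 2)).
    by rewrite KE// mulrCA.
  have e1 : (A1 / r ^+ 2)%:C = A1%:C / (g ze * (g ze)^*) by rewrite -r2 -fmorphV -rmorphM.
  have e2 : (A1 ^- 2)%:C = A1%:C ^- 2 :> R[i] by rewrite fmorphV rmorphXn.
  have e3 : (A1^-1)%:C = A1%:C^-1 :> R[i] by rewrite fmorphV.
  rewrite /H /k /K0 -/x -/ze e1 e2 e3; move: (s p) (G _) => S G1.
  by field; rewrite ?aC ?gze ?gzec ?gz.
rewrite /L2_inner; change (Cint leb4 (hartogs4 g) (fun x => G (C2_of_R4 x) *
  (hkernel g ((z, w) : C2 R) (C2_of_R4 x))^*) = G (z, w)).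
rewrite E /H.
have ib : Cintegrable leb2 (disc 1) (fun p => k (toC p) * s p).
  have := CintegrableZ A1%:C (measurable_disc 1) iH.
  apply: eq_Cintegrable => [|p _]; first exact: measurable_disc.
  by rewrite /H fmorphV mulVKf.
have ik : Cintegrable leb2 (disc 1) (fun p => k (toC p)).
  have := @Cintegrable_bounded_mul _ _ _ leb2 (disc 1) _ (fun p => (1 - z * (toC p)^*) ^+ 2)
    (2 ^+ 2) (measurable_disc 1) ib.
  have mm : Cmeasurable (disc 1) (fun p => (1 - z * (toC p)^*) ^+ 2).
    by apply: CmeasurableX; exact: Cmeasurable_one_sub.
  move=> /(_ mm)/(_ _)[].
    move=> p p1; rewrite ncX lerXn2r ?nnegrE ?nc_ge0//.
    apply: (le_trans (nc_subadd _ _)); rewrite nc1 mulr2n lerD2l.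
    by apply: ltW; apply: nc_mul_conj_lt1 => //; exact: ltW.
  move=> j1 j2; apply: (eq_Cintegrable (measurable_disc 1) _ (conj j1 j2)) => p /set_mem p1.
  rewrite -mulrA /s exprVn mulVf ?mulr1// expf_neq0//; apply: one_sub_neq0.
  by apply: nc_mul_conj_lt1 => //; exact: ltW.
rewrite CintZ//.
rewrite (disc_reproducing hk ik z1) fmorphV mulKf// /k mulKf// /c divfK//.
Qed.

(** [f - G] is orthogonal to the kernel function at [P], and the kernel reproduces [G]. In
    particular any two projections of [f] agree on the domain, so the choice made by [xget] can be
    replaced by an explicit projection. *)
Lemma bergman_projection_kernel f G P : in_Lp (hartogs g) 2 f -> is_bergman_projection (hartogs g) f G ->
  hartogs g P -> L2_inner (hartogs g) f (hkernel g P) = G P.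
Proof.
move=> Lf [AG orth] hP; have mH := measurable_hartogs4 hg.
have AK := hkernel_bergman hg g0 hP.
rewrite -(hkernel_reproducing AG hP); apply/eqP; rewrite -subr_eq0; apply/eqP.
rewrite -(orth _ AK).
have i1 := Cintegrable_L2 mH Lf AK.2; have i2 := Cintegrable_L2 mH AG.2 AK.2.
have := CintB mH i1 i2; rewrite /L2_inner => E; apply/esym.
transitivity (Cint leb4 (hartogs4 g) (fun x => f (C2_of_R4 x) * (hkernel g P (C2_of_R4 x))^* -
  G (C2_of_R4 x) * (hkernel g P (C2_of_R4 x))^*)); last exact: E.
by apply: eq_Cint => x _; rewrite -mulrBl.
Qed.

End reproducing.

(** * Boundedness inside the critical interval *)

Section sufficiency.
Context {R : realType}.
Local Notation mR := (measurableTypeR R).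
Local Notation M2 := (mR * mR)%type.
Local Notation leb2 := (@lebesgue2 R).
Local Notation leb4 := (@leb4 R).
Local Notation A1 := (@disc_area R).
Variables (g : R[i] -> R[i]) (a : R).
Hypothesis hg : cholomorphic g.
Hypothesis g0 : forall z, nc z < 1 -> g z != 0.
Hypothesis ng : forall z, nc z < 1 -> nc (g z) = nc (1 - z) `^ a.
Implicit Types (s t e : R).

Definition schur_weight s t (x : M2 * M2) : R :=
  (1 - nc (toC x.1) ^+ 2) `^ (- s) * nc (1 - toC x.1) `^ (- t) *
  (1 - nc (toC x.2 / g (toC x.1)) ^+ 2) `^ (- s).

Let ratio_lt1 (x : M2 * M2) : hartogs4 g x -> nc (toC x.2 / g (toC x.1)) < 1.
Proof.
by move=> [x1 x2]; rewrite ncM ncV ltr_pdivrMr ?nc_gt0 ?g0// mul1r.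
Qed.

Let one_sub_sqr_gt0 (z : R[i]) : nc z < 1 -> 0 < 1 - nc z ^+ 2.
Proof. by move=> z1; rewrite subr_gt0 expr_lt1// nc_ge0. Qed.

Let nc_one_sub_gt0 (z : R[i]) : nc z < 1 -> 0 < nc (1 - z).
Proof. by move=> z1; rewrite nc_gt0; exact: one_sub_neq0. Qed.

Lemma schur_weight_gt0 s t x : hartogs4 g x -> 0 < schur_weight s t x.
Proof.
move=> hx; have [x1 x2] := hx.
by rewrite /schur_weight !mulr_gt0 ?powR_gt0 ?one_sub_sqr_gt0 ?nc_one_sub_gt0 ?ratio_lt1.
Qed.

Lemma measurable_schur_weight s t : measurable_fun (hartogs4 g) (schur_weight s t).
Proof.
have mpow (f : M2 * M2 -> R) r : measurable_fun (hartogs4 g) f ->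
    measurable_fun (hartogs4 g) (fun x => f x `^ r).
  by move=> mf; apply: (measurableT_comp (f := fun x : R => x `^ r)) => //; exact: measurable_powR.
have m1 : Cmeasurable (hartogs4 g) (fun x => toC x.1) by exact: Cmeasurable_hartogs1.
have m2 : Cmeasurable (hartogs4 g) (fun x => toC x.2) by exact: Cmeasurable_hartogs2.
have mg : Cmeasurable (hartogs4 g) (fun x => g (toC x.1)).
  exact: Cmeasurable_hartogs_fun (Cmeasurable_holo hg).
apply: measurable_funM; first apply: measurable_funM; apply: mpow.
- by apply: measurable_funB => //; apply: measurable_funX; exact: measurable_nc.
- by apply: measurable_nc; apply: CmeasurableB => //; exact: Cmeasurable_cst.
- apply: measurable_funB => //; apply: measurable_funX; apply: measurable_nc.
  by apply: CmeasurableM => //; exact: CmeasurableV.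
Qed.

Lemma schur_weight_powR s t e x : hartogs4 g x -> schur_weight s t x `^ e =
  (1 - nc (toC x.1) ^+ 2) `^ (- (s * e)) * nc (1 - toC x.1) `^ (- (t * e)) *
  (1 - nc (toC x.2 / g (toC x.1)) ^+ 2) `^ (- (s * e)).
Proof.
move=> hx; rewrite /schur_weight !powRM ?mulr_ge0 ?powR_ge0//.
by rewrite -!powRrM !mulNr.
Qed.

(** Integration along a fibre reproduces the factor in [w / g z] and leaves on the base the extra
    weight [|1 - z|^(a - t e)], that is [|1 - z|^(-2u)]. The two hypotheses on [s] and [t] say
    [0 < u] and [c + u < 1], exactly what the weighted estimate on the disc asks for. *)
Lemma schur_weight_hkernel s t e : 0 < e -> 0 < s -> a < t * e -> 2 * (s * e) + t * e < a + 2 ->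
  exists2 C : R, 0 < C & forall x, hartogs4 g x ->
  (\int[leb4]_(y in hartogs4 g)
      (nc (hkernel g (C2_of_R4 x) (C2_of_R4 y)) * schur_weight s t y `^ e)%:E <=
    (C * schur_weight s t x `^ e)%:E)%E.
Proof.
move=> e0 s0 ate ste; pose c := s * e; pose u := (t * e - a) / 2.
have c0 : 0 < c by rewrite mulr_gt0.
have u0 : 0 < u by rewrite /u; lra.
have cu1 : c + u < 1 by rewrite /u /c; lra.
have c01 : 0 < c < 1 by lra.
have [C1 C10 h1] := forelli_rudin_weighted c0 u0 cu1.
have [C2 C20 h2] := forelli_rudin_radius c01.
have a0 := @disc_area_gt0 R; have A2 : 0 < A1 ^- 2 by rewrite invr_gt0 exprn_gt0.
exists (A1 ^- 2 * C2 * C1); first by rewrite !mulr_gt0.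
move=> x hx; have [x1 x2] := hx; set z := toC x.1; set w := toC x.2.
have z1 : nc z < 1 by exact: x1.
have gz : 0 < nc (g z) by rewrite nc_gt0 g0.
have W0 : 0 < (1 - nc (w / g z) ^+ 2) `^ (- c).
  by apply: powR_gt0; apply: one_sub_sqr_gt0; exact: ratio_lt1.
pose f y := (nc (hkernel g (C2_of_R4 x) (C2_of_R4 y)) * schur_weight s t y `^ e)%:E.
have mf : measurable_fun (hartogs4 g) f.
  apply/measurable_EFinP; apply: measurable_funM.
    by apply: measurable_nc; exact: measurable_hkernel.
  apply: (measurableT_comp (f := fun x : R => x `^ e)); first exact: measurable_powR.
  exact: measurable_schur_weight.
have f0 y : (0 <= f y)%E by rewrite lee_fin mulr_ge0 ?nc_ge0 ?powR_ge0.
rewrite [leLHS](ge0_integral_hartogs4 hg mf)//.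
pose D := A1 ^- 2 * C2 / nc (g z) * (1 - nc (w / g z) ^+ 2) `^ (- c).
have a00 := ltW a0; have C2' := ltW C20; have W0' := ltW W0; have A2' := ltW A2.
have D0 : 0 <= D by rewrite !mulr_ge0// invr_ge0 nc_ge0.
pose F (p : M2) := szego z p ^- 2 * szego 1 p `^ (- (2 * u)) * (1 - sqnc p) `^ (- c).
have F0 p : 0 <= F p by rewrite !mulr_ge0 ?powR_ge0// invr_ge0 exprn_ge0// szego_ge0.
have mF : measurable_fun (disc 1) F.
  apply: measurable_funM; first apply: measurable_funM.
  - exact: measurable_szegoV.
  - exact: measurable_szego_powR.
  - by have := @measurable_sqnc_powR R 1 (- c) (disc 1); under eq_fun do rewrite mulr1.
have fibre p : disc 1 p -> (\int[leb2]_(q in disc (nc (g (toC p)))) f (p, q) <= D%:E * (F p)%:E)%E.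
  move=> p1; set ze := toC p; set r := nc (g ze).
  have ze1 : nc ze < 1 by exact: p1.
  have r0 : 0 < r by rewrite nc_gt0 g0.
  (* The point of the fibre over [ze] with the same ratio to [g] as [w]; in terms of it the fibre
     factor of the kernel is that of a disc of radius [r]. *)
  pose v := w * (g ze / g z).
  have vr : nc v = nc (w / g z) * r by rewrite /v -ncM; congr nc; ring.
  have vr1 : nc v < r by rewrite vr gtr_pMl// ratio_lt1.
  pose K := A1 ^- 2 * szego z p ^- 2 * (r ^+ 3 / nc (g z)) *
    ((1 - nc ze ^+ 2) `^ (- c) * nc (1 - ze) `^ (- (t * e))).
  have K0 : 0 <= K.
    by rewrite !mulr_ge0 ?powR_ge0 ?invr_ge0 ?exprn_ge0 ?szego_ge0 ?nc_ge0.
  have fE q : disc r q -> f (p, q) = (K * (nc ((r ^+ 2)%:C - v * (toC q)^*) ^- 2 *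
      (1 - sqnc q / r ^+ 2) `^ (- c)))%:E.
    move=> q1; rewrite /f; congr EFin; 
    have -> : nc (hkernel g (C2_of_R4 x) (C2_of_R4 (p, q))) = A1 ^- 2 * ((nc (1 - ze * z^*))^-1 ^+ 2 *
        (nc (g ze) * nc (g z)) * (nc (g ze * (g z)^* - toC q * w^*))^-1 ^+ 2).
      exact: nc_hkernel.
    have -> : schur_weight s t (p, q) `^ e = (1 - nc ze ^+ 2) `^ (- c) * nc (1 - ze) `^ (- (t * e)) *
        (1 - nc (toC q / g ze) ^+ 2) `^ (- c).
      by rewrite schur_weight_powR.
    have -> : nc (toC q / g ze) ^+ 2 = sqnc q / r ^+ 2.
      by rewrite ncM ncV exprMn exprVn.
    have -> : nc (1 - ze * z^*) = szego z p.
      by rewrite -[LHS]nc_conj conjcB cconj1 conjcM conjcK mulrC.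
    have -> : nc (g ze * (g z)^* - toC q * w^*) = (nc (g z) / r) * nc ((r ^+ 2)%:C - v * (toC q)^*).
      rewrite -[LHS]nc_conj conjcB !conjcM !conjcK /r -ncV -!ncM; congr nc.
      have gze : g ze != 0 by exact: g0.
      have gzn : g z != 0 by exact: g0.
      by rewrite -mulc_conj /v; field; rewrite ?gze ?gzn.
    have gzn : nc (g z) != 0 by rewrite gt_eqF.
    have rn : r != 0 by rewrite gt_eqF.
    rewrite /K -/r (invfM (nc (g z) / r)) -(exprVn (szego z p)) -(exprVn (nc ((r ^+ 2)%:C - v * (toC q)^*))).
    rewrite -/c; move: (nc (_ - v * _))^-1 (szego z p)^-1 (A1 ^- 2) (_ `^ _) (_ `^ _) (_ `^ _) => X S a2 y1 y2 y3.
    by field; rewrite ?rn ?gzn.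
  rewrite (@eq_integral _ _ _ _ _ (fun q => K%:E * (nc ((r ^+ 2)%:C - v * (toC q)^*) ^- 2 *
      (1 - sqnc q / r ^+ 2) `^ (- c))%:E)%E); last first.
    by move=> q /set_mem q1; rewrite fE// EFinM.
  rewrite ge0_integralZl_EFin//; last 2 first.
  - by move=> q _; rewrite lee_fin mulr_ge0 ?powR_ge0// invr_ge0 exprn_ge0// nc_ge0.
  - apply/measurable_EFinP; apply: measurable_funM.
      apply: measurable_inv_ge0; first by move=> q; rewrite exprn_ge0// nc_ge0.
      apply: measurable_funX; apply: measurable_nc; apply: CmeasurableB; first exact: Cmeasurable_cst.
      apply: CmeasurableM; first exact: Cmeasurable_cst.
      by apply: Cmeasurable_conj; exact: Cmeasurable_toC.
    exact: measurable_sqnc_powR.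
  apply: (le_trans (lee_wpmul2l _ (h2 r v r0 vr1))); first by rewrite lee_fin.
  rewrite -!EFinM lee_fin le_eqVlt; apply/orP; left; apply/eqP.
  have -> : nc v ^+ 2 / r ^+ 2 = nc (w / g z) ^+ 2.
    by rewrite vr exprMn mulfK// expf_neq0// gt_eqF.
  rewrite /F.
  have -> : szego 1 p `^ (- (2 * u)) = r * nc (1 - ze) `^ (- (t * e)).
    have -> : szego 1 p = nc (1 - ze) by rewrite /szego mul1r -[LHS]nc_conj conjcB cconj1 conjcK.
    rewrite /r ng// -powRD; first by congr powR; rewrite /u; lra.
    by rewrite (gt_eqF (nc_one_sub_gt0 ze1)) implybT.
  have sz : szego z p != 0 by rewrite gt_eqF// szego_gt0// ltW.
  rewrite /K /D /sqnc -/ze; move: (A1 ^- 2) (_ `^ _) (_ `^ _) (_ `^ _) => a2 y1 y2 y3.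
  by field; rewrite sz !gt_eqF.
apply: (@le_trans _ _ (\int[leb2]_(p in disc 1) (D%:E * (F p)%:E))%E).
  apply: ge0_le_integral => //.
  - by move=> p _; apply: integral_ge0.
  - have := ge0_measurable_xsection leb2 (measurable_hartogs4 hg) mf (fun y _ => f0 y).
    move=> /(measurable_funS measurableT (@subsetT _ (disc 1))); apply: eq_measurable_fun.
    by move=> p /set_mem p1; rewrite xsection_hartogs4.
  - by apply: emeasurable_funM => //; exact/measurable_EFinP.
rewrite ge0_integralZl_EFin//; last 2 first.
- by move=> p _; rewrite lee_fin.
- exact/measurable_EFinP.
have D0' : (0 <= D%:E)%E by rewrite lee_fin.
apply: (le_trans (lee_wpmul2l D0' (h1 z z1))).
rewrite -EFinM lee_fin le_eqVlt; apply/orP; left; apply/eqP.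
rewrite schur_weight_powR// -/z -/w -/c.
have -> : nc (1 - z) `^ (- (2 * u)) = nc (g z) * nc (1 - z) `^ (- (t * e)).
  rewrite ng// -powRD; first by congr powR; rewrite /u; lra.
  by rewrite (gt_eqF (nc_one_sub_gt0 z1)) implybT.
rewrite /D; move: (A1 ^- 2) => a2; rewrite -mulrA.
by field; rewrite gt_eqF.
Qed.

Lemma hartogs_bounded_on_Lp s t p q : 1 < p -> p^-1 + q^-1 = 1 -> 0 < s ->
  a < t * p -> 2 * (s * p) + t * p < a + 2 -> a < t * q -> 2 * (s * q) + t * q < a + 2 ->
  bergman_bounded_on_Lp (hartogs g) p.
Proof.
move=> p1 pq s0 tp1 tp2 tq1 tq2; have p0 : 0 < p by lra.
have q0 : 0 < q.
  rewrite -invr_gt0; have : p^-1 < 1 by rewrite invf_lt1.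
  lra.
have [Cp Cp0 hp] := schur_weight_hkernel p0 s0 tp1 tp2.
have [Cq Cq0 hq] := schur_weight_hkernel q0 s0 tq1 tq2.
have mH := measurable_hartogs4 hg.
exists (2 * (Cp + Cq)); first lra.
move=> f f2 fp; rewrite /bergman_projection.
(* If no projection exists, [bergman_projection] takes its default value 0 and the bound is
   trivial. *)
have [[G hG]|nG] := pselect (exists G, is_bergman_projection (hartogs g) f G); last first.
  rewrite xgetPN; last by move=> G hG; apply: nG; exists G.
  rewrite [leLHS]Lp_normE// [X in (X `^ _)%E](_ : _ = 0%E); last first.
    by apply: integral0_eq => x _; rewrite nc0 powR0// gt_eqF.
  rewrite poweR0r ?gt_eqF ?invr_gt0//.
  by rewrite mule_ge0 ?Lp_normE ?poweR_ge0// lee_fin; lra.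
have := @xgetPex _ (fun=> 0) [set G | is_bergman_projection (hartogs g) f G] (ex_intro _ G hG).
move: (xget _ _) => {hG}G hG.
(* The factor 2 is the one lost in bounding the modulus of a complex integral. *)
pose k (x : (M2 * M2) * (M2 * M2)) := 2 * nc (hkernel g (C2_of_R4 x.1) (C2_of_R4 x.2)).
pose F (x : M2 * M2) := nc (f (C2_of_R4 x)); pose G' (x : M2 * M2) := nc (G (C2_of_R4 x)).
pose psi := schur_weight s t; pose C := 2 * (Cp + Cq).
have C0 : 0 < C by rewrite /C; lra.
have mpsi : measurable_fun (hartogs4 g) psi by exact: measurable_schur_weight.
have mpsie e : measurable_fun (hartogs4 g) (fun x => psi x `^ e).
  by apply: (measurableT_comp (f := fun x : R => x `^ e)) => //; exact: measurable_powR.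
have mF : measurable_fun (hartogs4 g) F by apply: measurable_nc; exact: f2.1.
have mG : measurable_fun (hartogs4 g) G' by apply: measurable_nc; exact: hG.1.2.1.
have mk : measurable_fun (hartogs4 g `*` hartogs4 g) k.
  by apply: measurable_funM => //; exact: measurable_hkernel2.
have mk1 x : hartogs4 g x -> measurable_fun (hartogs4 g) (fun y => nc (hkernel g (C2_of_R4 x) (C2_of_R4 y))).
  by move=> hx; apply: measurable_nc; exact: measurable_hkernel.
have scale e Ce : Ce <= Cp + Cq -> 0 < Ce ->
    (forall x, hartogs4 g x -> (\int[leb4]_(y in hartogs4 g)
      (nc (hkernel g (C2_of_R4 x) (C2_of_R4 y)) * psi y `^ e)%:E <= (Ce * psi x `^ e)%:E)%E) ->
    forall x, hartogs4 g x -> (\int[leb4]_(y in hartogs4 g)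
      (2 * nc (hkernel g (C2_of_R4 x) (C2_of_R4 y)) * psi y `^ e)%:E <= (C * psi x `^ e)%:E)%E.
  move=> CeC Ce0 h x hx.
  under eq_integral do rewrite -mulrA EFinM.
  rewrite ge0_integralZl_EFin//; last 2 first.
  - by move=> y _; rewrite lee_fin mulr_ge0 ?nc_ge0 ?powR_ge0.
  - by apply/measurable_EFinP; apply: measurable_funM => //; exact: mk1.
  have t0 : (0 <= 2%:E :> \bar R)%E by rewrite lee_fin.
  apply: (le_trans (lee_wpmul2l t0 (h x hx))).
  by rewrite -EFinM lee_fin /C mulrA ler_wpM2r ?powR_ge0//; lra.
have H1 := scale q Cq (_ : _ <= _) Cq0 hq.
have H2 := scale p Cp (_ : _ <= _) Cp0 hp.
have main : (\int[leb4]_(x in hartogs4 g) (G' x `^ p)%:E <=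
    (C `^ p)%:E * \int[leb4]_(x in hartogs4 g) (F x `^ p)%:E)%E.
  apply: (@schur_test _ _ _ leb4 p q C (hartogs4 g) k psi F G' p1 pq C0 mH mk mpsi mF mG).
  - by move=> x; rewrite mulr_ge0// nc_ge0.
  - by move=> x hx; exact: schur_weight_gt0.
  - by move=> x; exact: nc_ge0.
  - by move=> x; exact: nc_ge0.
  - by apply: H1; lra.
  (* The modulus of the kernel is symmetric, so the same estimate with exponent [p] covers
     integration in the first variable. *)
  - move=> y hy; apply: le_trans (H2 _ y hy); last lra.
    rewrite le_eqVlt; apply/orP; left; apply/eqP; apply: eq_integral => x _.
    by rewrite /k hkernel_sym.
  - move=> x hx; have hP : hartogs g (C2_of_R4 x) by exact: hx.
    rewrite /G' -(bergman_projection_kernel hg g0 f2 hG hP).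
    have iF := Cintegrable_L2 mH f2 (hkernel_bergman hg g0 hP).2.
    apply: (le_trans (nc_Cint_lee mH iF)); rewrite -ge0_integralZl_EFin//; last 2 first.
    - by move=> y _; rewrite lee_fin nc_ge0.
    - by apply/measurable_EFinP; apply: measurable_nc; exact: Cintegrable_measurable iF.
    rewrite le_eqVlt; apply/orP; left; apply/eqP; apply: eq_integral => y _.
    by rewrite -EFinM ncM nc_conj /k /F; congr EFin; ring.
rewrite !Lp_normE//.
have ip : 0 < p^-1 by rewrite invr_gt0.
have I0 (u : M2 * M2 -> R) : (0 <= \int[leb4]_(x in hartogs4 g) (u x `^ p)%:E)%E.
  by apply: integral_ge0 => x _; rewrite lee_fin powR_ge0.
have := @gt0_ler_poweR _ p^-1 (ltW ip) _ _ _ _ main.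
rewrite !in_itv/= !leey !andbT I0 mule_ge0 ?I0 ?lee_fin ?powR_ge0// => /(_ isT isT) /le_trans; apply.
rewrite poweRM ?lee_fin ?powR_ge0 ?I0// poweR_EFin -powRrM mulfV ?gt_eqF// powRr1 ?(ltW C0)//.
Qed.

End sufficiency.

(** * Test functions and their projections *)

Section bumps.
Context {R : realType}.
Local Notation mR := (measurableTypeR R).
Local Notation M2 := (mR * mR)%type.
Local Notation leb2 := (@lebesgue2 R).
Local Notation leb4 := (@leb4 R).
Local Notation A1 := (@disc_area R).
Variables (g : R[i] -> R[i]) (a : R).
Hypothesis hg : cholomorphic g.
Hypothesis g0 : forall z, nc z < 1 -> g z != 0.
Hypothesis ng : forall z, nc z < 1 -> nc (g z) = nc (1 - z) `^ a.

Lemma Cint_support d (T : measurableType d) (mu : {measure set T -> \bar R}) (A B : set T) (f : T -> R[i]) :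
  B `<=` A -> (forall x, A x -> ~ B x -> f x = 0) -> Cint mu A f = Cint mu B f.
Proof.
move=> BA f0; have E (u : R[i] -> R) : u 0 = 0 ->
    \int[mu]_(x in A) u (f x) = \int[mu]_(x in B) u (f x).
  move=> u0; rewrite /Rintegral -[in RHS](setIidr BA) integral_mkcondr; congr fine.
  apply: eq_integral => x /set_mem Ax; rewrite /patch; case: ifPn => // /negP nB.
  by rewrite f0 ?u0// => /mem_set.
by rewrite /Cint !E.
Qed.

(** Constant along fibres up to the factor [1 / g], and normalised by [r ^ 2], so that pairing with
    a holomorphic function depends on the centre [x] but not on [r]. *)
Definition bump (x : R[i]) (r : R) (Q : C2 R) : R[i] :=
  if nc (Q.1 - x) < r then (r ^- 2)%:C / g Q.1 else 0.

Lemma bumpE x r (y : M2 * M2) : bump x r (C2_of_R4 y) =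
  (r ^- 2 * \1_(disc_at x r) y.1)%:C / g (toC y.1).
Proof.
rewrite /bump indicE; case: ifPn => [|/negP] h; first by rewrite mem_set// mulr1.
by rewrite memNset// mulr0 mul0r.
Qed.

Lemma measurable_bump x r : measurable_on (hartogs g) (bump x r).
Proof.
suff : Cmeasurable (hartogs4 g) (fun y => (r ^- 2 * \1_(disc_at x r) y.1)%:C / g (toC y.1)).
  by apply: Cmeasurable_eq => y _; rewrite bumpE.
apply: CmeasurableM.
  apply: Cmeasurable_real; apply: measurable_funM => //.
  have mi : measurable_fun setT (\1_(disc_at x r) : M2 -> R).
    by apply: measurable_indic; exact: measurable_disc_at.
  have mfst : measurable_fun (hartogs4 g) (fst : M2 * M2 -> M2) by exact: measurable_funTS measurable_fst.
  exact: (measurableT_comp mi mfst).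
by apply: CmeasurableV; exact: Cmeasurable_hartogs_fun (Cmeasurable_holo hg).
Qed.

(** The integrand is constant on fibres; the fibre area [A1 |g|^2] times [|g|^(-e)] is the weight,
    by the formula for [|g|]. *)
Lemma integral_hartogs_base (m : M2 -> R[i]) (e : R) : 0 < e -> Cmeasurable (disc 1) m ->
  (\int[leb4]_(y in hartogs4 g) (nc (m y.1 / g (toC y.1)) `^ e)%:E =
   A1%:E * \int[leb2]_(p in disc 1) (nc (m p) `^ e * nc (1 - toC p) `^ (a * (2 - e)))%:E)%E.
Proof.
move=> e0 mm; have a0 := ltW (@disc_area_gt0 R).
have mpow d (T : measurableType d) (A : set T) (f : T -> R) c : measurable_fun A f ->
    measurable_fun A (fun x => f x `^ c).
  by move=> mf; apply: (measurableT_comp (f := fun x : R => x `^ c)) => //; exact: measurable_powR.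
have mf : measurable_fun (hartogs4 g) (fun y => (nc (m y.1 / g (toC y.1)) `^ e)%:E).
  apply/measurable_EFinP; apply: (mpow _ _ _ _ e).
  apply: (measurable_comp (F := disc 1) (f := fun p => nc (m p / g (toC p))) (g := fst)).
  - exact: measurable_disc.
  - by move=> _ [x [hx _] <-].
  - apply: measurable_nc; apply: CmeasurableM => //; apply: CmeasurableV.
    exact: Cmeasurable_holo.
  - exact: measurable_funTS measurable_fst.
rewrite ge0_integral_hartogs4//; last by move=> y _; rewrite lee_fin powR_ge0.
rewrite -ge0_integralZl_EFin//; last 2 first.
- by move=> p _; rewrite lee_fin mulr_ge0 ?powR_ge0.
- apply/measurable_EFinP; apply: measurable_funM; apply: (mpow _ _ _ _ _).
    exact: measurable_nc.
  apply: measurable_nc; apply: CmeasurableB; first exact: Cmeasurable_cst.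
  exact: Cmeasurable_toC.
apply: eq_integral => p /set_mem p1; have p1' : nc (toC p) < 1 by exact: p1.
have gp : 0 < nc (g (toC p)) by rewrite nc_gt0 g0.
have np : 0 < nc (1 - toC p) by rewrite nc_gt0 one_sub_neq0.
rewrite (@eq_integral _ _ _ _ _ (cst (nc (m p / g (toC p)) `^ e)%:E))//.
rewrite integral_cst; last exact: measurable_disc.
rewrite -disc_at0 [X in (_ * X)%E](lebesgue2_disc_at _ gp) -!EFinM; congr EFin.
rewrite ncM ncV powRM ?nc_ge0 ?invr_ge0 ?nc_ge0// mulrA mulrC; congr (_ * _).
rewrite -mulrA; congr (_ * _).
rewrite -[(nc (g _))^-1]powR_inv1 ?nc_ge0// -powRrM mulN1r -powR_mulrn ?nc_ge0// -powRD; last first.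
  by rewrite (gt_eqF gp) implybT.
by rewrite ng// -powRrM; congr powR; rewrite -[2%:R]/(2 : R); ring.
Qed.

(** The mean value property is used twice. On a fibre it gives [G] at the centre times the area
    [A1 |g|^2]; the conjugate of [1 / g] in the bump cancels the conjugate factor of [|g|^2], and
    the holomorphic [g t * G (t, 0)] is left for the mean over the disc around [x]. *)
Lemma bump_inner (G : C2 R -> R[i]) x r : 0 < r -> nc x + r <= 1 -> holomorphic_on (hartogs g) G ->
  Cintegrable leb4 (hartogs4 g) (fun y => G (C2_of_R4 y) * (bump x r (C2_of_R4 y))^*) ->
  Cint leb4 (hartogs4 g) (fun y => G (C2_of_R4 y) * (bump x r (C2_of_R4 y))^*) =
  (A1 ^+ 2)%:C * (g x * G (x, 0)).
Proof.
move=> r0 xr hG iF; have a0 := @disc_area_gt0 R.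
have sub : disc_at x r `<=` disc 1.
  move=> p hp; have {}hp : nc (toC p - x) < r by exact: hp.
  suff : nc (toC p) < 1 by [].
  by have := nc_triangle (toC p - x) x; rewrite subrK; lra.
pose k t := g t * G (t, 0).
have hk : cholomorphic k.
  move=> t t1; have n0 : nc (0 : R[i]) < 1 by rewrite nc0.
  have [l hl] := holo_slice1 hg g0 hG n0 t1; exists l; move: hl.
  by congr cderiv; apply/funext => u; rewrite /k mul0r.
pose H (p : M2) := (A1 * (r ^- 2 * \1_(disc_at x r) p))%:C * k (toC p).
have mH : Cmeasurable (disc 1) H.
  apply: CmeasurableM; last exact: Cmeasurable_holo.
  apply: Cmeasurable_real; apply: measurable_funM => //; apply: measurable_funM => //.
  by apply: measurable_indic; exact: measurable_disc_at.
have [|iH ->] := Cint_hartogs4 hg iF mH.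
  move=> p p1; set ze := toC p; set rho := nc (g ze).
  have gz : g ze != 0 by exact: g0.
  have rho0 : 0 < rho by rewrite nc_gt0.
  move=> iS; set b := r ^- 2 * \1_(disc_at x r) p.
  have bE (q : M2) : bump x r (C2_of_R4 (p, q)) = b%:C / g ze by rewrite bumpE.
  have [b0|b0] := eqVneq b 0.
    rewrite /H -/b b0 mulr0 mul0r (@eq_Cint _ _ _ _ _ _ (fun=> 0)) => [|q _]; last by rewrite bE b0 mul0r cconj0 mulr0.
    by apply: complex_eq; rewrite /= Rintegral_cst ?mul0r//; exact: measurable_disc.
  have bn : (b%:C / g ze)^* != 0.
    by rewrite -nc_gt0 nc_conj nc_gt0 mulf_neq0 ?invr_eq0// -nc_gt0 nc_real normr_gt0.
  have iG : Cintegrable leb2 (disc_at 0 rho) (fun q => G (ze, toC q)).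
    rewrite disc_at0; have := CintegrableZ ((b%:C / g ze)^*)^-1 (measurable_disc rho) iS.
    apply: eq_Cintegrable => [|q _]; first exact: measurable_disc.
    change (((b%:C / g ze)^*)^-1 * (G (ze, toC q) * (bump x r (C2_of_R4 (p, q)))^*) = G (ze, toC q)).
    by rewrite bE mulrCA mulVf// mulr1.
  have hS w : nc (w - 0) < rho -> exists l, cderiv (fun t => G (ze, t)) w l.
    by rewrite subr0; exact: slice_in.
  have := disc_at_mean rho0 hS iG; rewrite disc_at0 => E.
  transitivity ((b%:C / g ze)^* * Cint leb2 (disc rho) (fun q => G (ze, toC q))).
    rewrite disc_at0 in iG; rewrite -(CintZ _ (measurable_disc rho) iG).
    apply: eq_Cint => q _.
    change (G (ze, toC q) * (bump x r (C2_of_R4 (p, q)))^* = (b%:C / g ze)^* * G (ze, toC q)).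
    by rewrite bE mulrC.
  rewrite E /H -/b /k -/ze conjcM conjc_real.
  have -> : (g ze)^-1^* = ((g ze)^*)^-1.
    by apply: complex_eq; rewrite ?Re_conj ?Im_conj ?ReV ?ImV ?Re_conj ?Im_conj ?nc_conj// ?mulNr ?opprK.
  have gc : (g ze)^* != 0 by rewrite -nc_gt0 nc_conj.
  have -> : (rho ^+ 2 * A1)%:C = (g ze * (g ze)^*) * A1%:C by rewrite mulc_conj -rmorphM.
  have -> : (A1 * b)%:C = A1%:C * b%:C :> R[i] by exact: rmorphM.
  move: (G (ze, 0)) => G1; set A1C : R[i] := A1%:C; set bC : R[i] := b%:C.
  by field; rewrite ?gc ?gz.
have mD := measurable_disc_at x r.
have HD p : disc_at x r p -> H p = (A1 * r ^- 2)%:C * k (toC p).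
  by move=> hp; rewrite /H indicE mem_set// mulr1.
rewrite (Cint_support _ sub); last first.
  by move=> p _ np; rewrite /H indicE memNset// !mulr0 mul0r.
have iHD : Cintegrable leb2 (disc_at x r) H.
  case: iH => i1 i2; split; [move: i1|move: i2]; apply: integrableS => //; exact: measurable_disc.
have cn : (A1 * r ^- 2)%:C != 0 :> R[i].
  by rewrite -nc_gt0 nc_real normr_gt0 gt_eqF// mulr_gt0// invr_gt0 exprn_gt0.
have ik : Cintegrable leb2 (disc_at x r) (fun p => k (toC p)).
  have := CintegrableZ (A1 * r ^- 2)%:C^-1 mD iHD; apply: eq_Cintegrable => // p /set_mem hp.
  by rewrite HD// mulKf.
rewrite (@eq_Cint _ _ _ _ _ _ (fun p => (A1 * r ^- 2)%:C * k (toC p))); last first.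
  by move=> p /set_mem; exact: HD.
rewrite CintZ// disc_at_mean//; last first.
  move=> w wx; apply: hk; have := nc_triangle (w - x) x; rewrite subrK; lra.
have E : A1 ^+ 2 = A1 * r ^- 2 * (r ^+ 2 * A1).
  by field; rewrite gt_eqF.
have -> : (A1 ^+ 2)%:C = (A1 * r ^- 2)%:C * (r ^+ 2 * A1)%:C :> R[i] by rewrite E; exact: rmorphM.
by rewrite -mulrA.
Qed.

Lemma hkernel_center x Q : nc x < 1 -> hkernel g ((x, 0) : C2 R) Q =
  (A1 ^- 2)%:C * ((1 - Q.1 * x^*)^-1 ^+ 2 / (g Q.1 * (g x)^*)).
Proof.
move=> x1; rewrite /hkernel /fst /snd cconj0 mulr0 subr0 -mulrA; congr (_ * (_ * _)).
(* [Q] is arbitrary, so [g Q.1] may vanish; both sides are then 0, since [0^-1 = 0]. *)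
move: (g Q.1 * _) => y; have [->|y0] := eqVneq y 0; first by rewrite invr0 mul0r.
by rewrite expr2 mulrA mulfV// mul1r.
Qed.

Variables (x : nat -> R[i]) (r : nat -> R).
Hypothesis r0 : forall i, 0 < r i.
Hypothesis xr : forall i, nc (x i) + r i <= 1.

Let x1 i : nc (x i) < 1.
Proof. by have := xr i; have := r0 i; lra. Qed.

Let center i : hartogs g ((x i, 0) : C2 R).
Proof.
split; first exact: x1.
suff : nc (0 : R[i]) < nc (g (x i)) by [].
by rewrite nc0 nc_gt0 g0.
Qed.

Definition bumps N (Q : C2 R) := \sum_(i <- iota 0 N) bump (x i) (r i) Q.
Definition bumps_proj N (Q : C2 R) := (\sum_(i <- iota 0 N) (1 - Q.1 * (x i)^*)^-1 ^+ 2) / g Q.1.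

Lemma bumps_projE N Q : bumps_proj N Q =
  \sum_(i <- iota 0 N) (A1 ^+ 2)%:C * (g (x i))^* * hkernel g ((x i, 0) : C2 R) Q.
Proof.
rewrite /bumps_proj mulr_suml; apply: eq_bigr => i _; rewrite hkernel_center//.
have gc : (g (x i))^* != 0 by rewrite -nc_gt0 nc_conj nc_gt0 g0.
have a0 : A1 != 0 by rewrite gt_eqF// disc_area_gt0.
have aC : (A1 ^+ 2)%:C != 0 :> R[i].
  by rewrite -nc_gt0 nc_real normr_gt0 expf_neq0.
have -> : (A1 ^- 2)%:C = ((A1 ^+ 2)%:C)^-1 :> R[i] by exact: fmorphV.
rewrite invfM; move: (_^-1 ^+ 2) (g Q.1)^-1 ((A1 ^+ 2)%:C) aC => S i1 a2 aC.
by field; rewrite ?gc ?aC.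
Qed.

(** Against any [h] of the Bergman space, a bump and the corresponding multiple of the kernel at its
    centre give the same number [A1 ^+ 2 * (g (x i) * h (x i, 0))]. Hence the difference is
    orthogonal, and a finite sum of kernels is in the space. *)
Lemma bumps_projection N : (forall i, in_Lp (hartogs g) 2 (bump (x i) (r i))) ->
  is_bergman_projection (hartogs g) (bumps N) (bumps_proj N).
Proof.
move=> L2; have mH := measurable_hartogs4 hg.
pose c i := (A1 ^+ 2)%:C * (g (x i))^*.
have AK i := hkernel_bergman hg g0 (center i).
have LPsi M : bergman_space (hartogs g) (fun Q => \sum_(i <- iota 0 M) c i * hkernel g ((x i, 0) : C2 R) Q).
  elim: M => [|M [ih1 ih2]].
    under eq_fun do rewrite big_nil; split; first by move=> Q _; exact: differentiable_cst.
    apply: in_L2P => //.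
    have := integrable0 leb4 (hartogs4 g); apply: eq_integrable => // y _.
    change ((0%:E : \bar R) = (nc (0 : R[i]) ^+ 2)%:E).
    by rewrite nc0 expr0n.
  have E : (fun Q => \sum_(i <- iota 0 M.+1) c i * hkernel g ((x i, 0) : C2 R) Q) =
      (fun Q => \sum_(i <- iota 0 M) c i * hkernel g ((x i, 0) : C2 R) Q + c M * hkernel g ((x M, 0) : C2 R) Q).
    by apply/funext => Q; rewrite -addn1 iotaD big_cat/= big_seq1.
  rewrite E; split; last exact: in_L2D mH ih2 (in_L2Z (c M) mH (AK M).2).
  move=> Q hQ; have d1 := ih1 Q hQ.
  have d2 : differentiable (hkernel g ((x M, 0) : C2 R) : C2 R -> R[i]^o) Q by exact: (AK M).1.
  have dc : differentiable ((fun=> c M) : C2 R -> R[i]^o) Q by exact: differentiable_cst.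
  exact: (differentiableD d1 (differentiableM dc d2)).
have PsiE : bumps_proj N = (fun Q => \sum_(i <- iota 0 N) c i * hkernel g ((x i, 0) : C2 R) Q).
  by apply/funext => Q; rewrite bumps_projE.
split; first by rewrite PsiE.
move=> h Ah; rewrite /L2_inner PsiE.
have ib i := Cintegrable_L2 mH Ah.2 (L2 i).
have ik i := Cintegrable_L2 mH Ah.2 (AK i).2.
have ick i : Cintegrable leb4 (hartogs4 g) (fun y => (c i)^* * (h (C2_of_R4 y) *
    (hkernel g ((x i, 0) : C2 R) (C2_of_R4 y))^*)) by apply: CintegrableZ.
have [s1 e1] := Cint_sum (iota 0 N) mH ib.
have [s2 e2] := Cint_sum (iota 0 N) mH ick.
(* The evaluation formulas have [h] as the left factor, so orthogonality is proved in this order and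
   conjugated afterwards. *)
have e : Cint leb4 (hartogs4 g) (fun y => (\sum_(i <- iota 0 N) h (C2_of_R4 y) * (bump (x i) (r i) (C2_of_R4 y))^*) -
    \sum_(i <- iota 0 N) (c i)^* * (h (C2_of_R4 y) * (hkernel g ((x i, 0) : C2 R) (C2_of_R4 y))^*)) = 0.
  rewrite CintB// e1 e2; apply/eqP; rewrite subr_eq0; apply/eqP; apply: eq_bigr => i _.
  rewrite bump_inner//; last exact: Ah.1.
  rewrite CintZ//.
  have := hkernel_reproducing hg g0 Ah (center i); rewrite /L2_inner => E.
  rewrite [X in _ = _ * X]E /c conjcM conjc_real conjcK mulrA//.
have /(congr1 conjc) := e; rewrite cconj0 -Cint_conj//; last exact: CintegrableB.
move=> E; rewrite -[RHS]E; apply: eq_Cint => y _.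
have cs (u : nat -> R[i]) : (\sum_(i <- iota 0 N) u i)^* = \sum_(i <- iota 0 N) (u i)^*.
  by elim: (iota 0 N) => [|i l ih]; rewrite ?big_nil ?cconj0// !big_cons -ih; apply: complex_eq; rewrite ?Re_conj ?ReD ?Re_conj// ?Im_conj ?ImD ?Im_conj ?opprD.
rewrite conjcB !cs /bumps mulrBl; congr (_ - _).
  by rewrite mulr_suml; apply: eq_bigr => i _; rewrite conjcM conjcK mulrC.
by rewrite mulr_suml; apply: eq_bigr => i _; rewrite conjcM conjcK (conjcM (h _)) conjcK; ring.
Qed.

End bumps.

(** * Norms of sums of test functions on a tower of discs *)

Section bump_norms.
Context {R : realType}.
Local Notation mR := (measurableTypeR R).
Local Notation M2 := (mR * mR)%type.
Local Notation leb2 := (@lebesgue2 R).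
Local Notation leb4 := (@leb4 R).
Local Notation A1 := (@disc_area R).
Variables (g : R[i] -> R[i]) (a : R).
Hypothesis hg : cholomorphic g.
Hypothesis g0 : forall z, nc z < 1 -> g z != 0.
Hypothesis ng : forall z, nc z < 1 -> nc (g z) = nc (1 - z) `^ a.

Lemma measurable_base_weight (b : R) (A : set M2) : measurable_fun A (fun p => nc (1 - toC p) `^ b).
Proof.
apply: (measurableT_comp (f := fun x : R => x `^ b)); first exact: measurable_powR.
apply: measurable_nc; apply: CmeasurableB; first exact: Cmeasurable_cst.
exact: Cmeasurable_toC.
Qed.

Lemma bump_norm_le x r e B : 0 < e -> 0 < r -> nc x + r <= 1 ->
  (forall z, nc (z - x) < r -> nc (1 - z) `^ (a * (2 - e)) <= B) ->
  (\int[leb4]_(y in hartogs4 g) (nc (bump g x r (C2_of_R4 y)) `^ e)%:E <=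
   (A1 * ((r ^- 2) `^ e * B * (r ^+ 2 * A1)))%:E)%E.
Proof.
move=> e0 r0 xr hB; have a0 := ltW (@disc_area_gt0 R).
have sub : disc_at x r `<=` disc 1.
  move=> p hp; have {}hp : nc (toC p - x) < r by exact: hp.
  suff : nc (toC p) < 1 by [].
  by have := nc_triangle (toC p - x) x; rewrite subrK; lra.
have mD := measurable_disc_at x r.
pose m (p : M2) : R[i] := (r ^- 2 * \1_(disc_at x r) p)%:C.
have mm : Cmeasurable (disc 1) m.
  by apply: Cmeasurable_real; apply: measurable_funM => //; exact: measurable_indic.
under eq_integral do rewrite bumpE.
rewrite [leLHS](integral_hartogs_base hg g0 ng e0 mm) EFinM.
apply: lee_wpmul2l; first by rewrite lee_fin.
pose F (p : M2) := (nc (m p) `^ e * nc (1 - toC p) `^ (a * (2 - e)))%:E.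
have -> : (\int[leb2]_(p in disc 1) F p = \int[leb2]_(p in disc_at x r) F p)%E.
  rewrite -[in RHS](setIidr sub) integral_mkcondr.
  apply: eq_integral => p _; rewrite /patch; case: ifPn => // /negP nD.
  rewrite /F /m indicE memNset; last by move=> h; apply: nD; exact/mem_set.
  by rewrite mulr0 nc0 powR0 ?mul0r// gt_eqF.
have K0 : 0 <= (r ^- 2) `^ e * B.
  rewrite mulr_ge0 ?powR_ge0//; apply: le_trans (hB x _); first exact: powR_ge0.
  by rewrite subrr nc0.
apply: (@le_trans _ _ (\int[leb2]_(p in disc_at x r) cst ((r ^- 2) `^ e * B)%:E p)%E).
  apply: ge0_le_integral => //.
  - by move=> p _; rewrite lee_fin mulr_ge0 ?powR_ge0.
  - apply/measurable_EFinP; apply: measurable_funM; last exact: measurable_base_weight.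
    apply: (measurableT_comp (f := fun x : R => x `^ e)); first exact: measurable_powR.
    by apply: measurable_nc; exact: CmeasurableS (measurable_disc 1) sub mm.
  move=> p hp; rewrite lee_fin /m indicE mem_set// mulr1 nc_real ger0_norm ?invr_ge0 ?exprn_ge0 ?(ltW r0)//.
  by apply: ler_wpM2l; [exact: powR_ge0|exact: hB].
by rewrite integral_cst// [X in (_ * X)%E](lebesgue2_disc_at _ r0) -EFinM.
Qed.

(** The distance from 1 to the centre of disc [i], whose radius is half of that. Points of this disc
    are then at distance between one and three radii from 1, and the ratio 4 makes these ranges
    disjoint for different discs. *)
Definition tower (i : nat) : R := 4^-1 ^+ i.+1.
Definition tower_center i : R[i] := (1 - tower i)%:C.
Definition tower_radius i : R := tower i / 2.

Lemma tower_gt0 i : 0 < tower i.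
Proof. by rewrite exprn_gt0// invr_gt0. Qed.

Lemma tower_le i : tower i <= 4^-1.
Proof.
elim: i => [|i ih]; first by rewrite /tower expr1.
have : tower i.+1 = 4^-1 * tower i by rewrite /tower exprS.
by have := tower_gt0 i; lra.
Qed.

Lemma tower_lt i j : (i < j)%N -> tower j <= tower i / 4.
Proof.
elim: j => // j ih; rewrite ltnS leq_eqVlt => /orP[/eqP <-|/ih h].
  by rewrite /tower exprS mulrC.
have : tower j.+1 = 4^-1 * tower j by rewrite /tower exprS.
by have := tower_gt0 j; have := tower_gt0 i; lra.
Qed.

Lemma tower_radius_gt0 i : 0 < tower_radius i.
Proof. by rewrite divr_gt0// tower_gt0. Qed.

Lemma tower_center_radius i : nc (tower_center i) + tower_radius i <= 1.
Proof.
rewrite nc_real /tower_radius ger0_norm; have := tower_gt0 i; have := tower_le i; lra.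
Qed.

Lemma tower_disc z i : nc (z - tower_center i) < tower_radius i ->
  tower_radius i <= nc (1 - z) <= 3 * tower_radius i.
Proof.
move=> h; have t0 := tower_gt0 i.
have e1 : nc (tower i)%:C = tower i by rewrite nc_real ger0_norm// ltW.
have E : 1 - z = (tower i)%:C - (z - tower_center i).
  by rewrite /tower_center rmorphB rmorph1; ring.
rewrite E; have := nc_lower (tower i)%:C (z - tower_center i).
have := nc_subadd (tower i)%:C (z - tower_center i); rewrite e1 /tower_radius in h *; lra.
Qed.

Lemma tower_disjoint z i j : nc (z - tower_center i) < tower_radius i ->
  nc (z - tower_center j) < tower_radius j -> i = j.
Proof.
move=> /tower_disc h1 /tower_disc h2.
have aux k l : (k < l)%N -> tower_radius k <= nc (1 - z) <= 3 * tower_radius k ->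
    tower_radius l <= nc (1 - z) <= 3 * tower_radius l -> False.
  move=> /tower_lt kl; rewrite /tower_radius; have := tower_gt0 l; lra.
by have [ij|ij|//] := ltngtP i j; exfalso; [exact: aux ij h1 h2|exact: aux ij h2 h1].
Qed.

Local Notation bump_ i := (bump g (tower_center i) (tower_radius i)).
Local Notation bumps_ := (bumps g tower_center tower_radius).

Lemma bumpsS N Q : bumps_ N.+1 Q = bumps_ N Q + bump_ N Q.
Proof. by rewrite /bumps -addn1 iotaD big_cat/= big_seq1. Qed.

Lemma bumps_eq0 N Q : nc (Q.1 - tower_center N) < tower_radius N -> bumps_ N Q = 0.
Proof.
move=> h; rewrite /bumps big_seq big1// => i; rewrite mem_iota => /andP[_ iN].
rewrite /bump; case: ifPn => // hi.
by move: iN; rewrite (tower_disjoint hi h) add0n ltnn.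
Qed.

Lemma measurable_bumps N : measurable_on (hartogs g) (bumps_ N).
Proof.
exact: (@Cmeasurable_sum _ _ _ (hartogs4 g) _ (iota 0 N) (fun i y => bump_ i (C2_of_R4 y))
  (fun i => measurable_bump hg _ _)).
Qed.

(** The supports are disjoint, so at each point at most one summand is nonzero and the powers [e]
    add up. *)
Lemma bumps_norm_le N e M : 0 < e -> (forall i, (i < N)%N ->
    (\int[leb4]_(y in hartogs4 g) (nc (bump_ i (C2_of_R4 y)) `^ e)%:E <= M%:E)%E) ->
  (\int[leb4]_(y in hartogs4 g) (nc (bumps_ N (C2_of_R4 y)) `^ e)%:E <= (N%:R * M)%:E)%E.
Proof.
move=> e0; have mH := measurable_hartogs4 hg.
have mpow (f : C2 R -> R[i]) : measurable_on (hartogs g) f ->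
    measurable_fun (hartogs4 g) (fun y => (nc (f (C2_of_R4 y)) `^ e)%:E).
  move=> mf; apply/measurable_EFinP; apply: (measurableT_comp (f := fun x : R => x `^ e)); first exact: measurable_powR.
  exact: measurable_nc.
elim: N => [|N ih] hM.
  rewrite mul0r [leLHS]integral0_eq// => y _.
  by rewrite /bumps big_nil nc0 powR0// gt_eqF.
rewrite (@eq_integral _ _ _ _ _ (fun y => (nc (bumps_ N (C2_of_R4 y)) `^ e)%:E + (nc (bump_ N (C2_of_R4 y)) `^ e)%:E)%E); last first.
  move=> y _; rewrite bumpsS -EFinD; congr EFin.
  have [h|h] := ltP (nc ((C2_of_R4 y).1 - tower_center N)) (tower_radius N).
    by rewrite bumps_eq0// add0r nc0 powR0 ?add0r// gt_eqF.
  have -> : bump_ N (C2_of_R4 y) = 0 by rewrite /bump ltNge h.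
  by rewrite addr0 nc0 powR0 ?addr0// gt_eqF.
rewrite ge0_integralD//; try (by move=> y _; rewrite lee_fin powR_ge0); last 2 first.
- by apply: mpow; exact: measurable_bumps.
- by apply: mpow; exact: measurable_bump.
rewrite -natr1 mulrDl mul1r EFinD; apply: leeD; last exact: hM.
by apply: ih => i iN; apply: hM; exact: ltnW.
Qed.

Lemma bump_L2 i : in_Lp (hartogs g) 2 (bump_ i).
Proof.
split; first exact: measurable_bump.
rewrite Lp_norm_ltyP//; apply: le_lt_trans (bump_norm_le (B := 1) _ _ _ _) (ltry _) => //.
- exact: tower_radius_gt0.
- exact: tower_center_radius.
- by move=> z _; rewrite subrr mulr0 powRr0.
Qed.

Lemma bumps_Lp N e M : 0 < e -> (forall i, (i < N)%N ->
    (\int[leb4]_(y in hartogs4 g) (nc (bump_ i (C2_of_R4 y)) `^ e)%:E <= M%:E)%E) ->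
  in_Lp (hartogs g) e (bumps_ N).
Proof.
move=> e0 hM; split; first exact: measurable_bumps.
by rewrite Lp_norm_ltyP//; exact: le_lt_trans (bumps_norm_le e0 hM) (ltry _).
Qed.

Lemma bumps_L2 N : in_Lp (hartogs g) 2 (bumps_ N).
Proof.
have mH := measurable_hartogs4 hg; elim: N => [|N ih].
  by apply: (@bumps_Lp _ _ 0).
have -> : bumps_ N.+1 = (fun Q => bumps_ N Q + bump_ N Q) by apply/funext => Q; exact: bumpsS.
exact: in_L2D mH ih (bump_L2 N).
Qed.

(* Boundedness transferred to the disc: the projection of the [N]-th test
   function is [bumps_proj N]. *)
Lemma bounded_bumps p : 0 < p -> bergman_bounded_on_Lp (hartogs g) p -> exists2 C : R, 0 < C &
  forall N M, (forall i, (i < N)%N ->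
    (\int[leb4]_(y in hartogs4 g) (nc (bump_ i (C2_of_R4 y)) `^ p)%:E <= M%:E)%E) ->
  (A1%:E * \int[leb2]_(w in disc 1) (nc (\sum_(i <- iota 0 N) (1 - toC w * (tower_center i)^*)^-1 ^+ 2) `^ p *
     nc (1 - toC w) `^ (a * (2 - p)))%:E <= (C * (N%:R * M))%:E)%E.
Proof.
move=> p0 [C C0 hC]; exists (C `^ p); first exact: powR_gt0.
move=> N M hM; have mH := measurable_hartogs4 hg.
have f2 := bumps_L2 N; have fp := bumps_Lp p0 hM.
have := hC _ f2 fp; rewrite !Lp_normE//.
have hG := bumps_projection hg g0 tower_radius_gt0 tower_center_radius N bump_L2.
have := @xgetPex _ (fun=> 0) [set G | is_bergman_projection (hartogs g) (bumps_ N) G] (ex_intro _ _ hG).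
rewrite /bergman_projection; move: (xget _ _) => G hG'.
set I1 := (\int[_]_(x in _) _)%E; set I2 := (\int[_]_(x in _) _)%E => h.
have I10 : (0 <= I1)%E by apply: integral_ge0 => x _; rewrite lee_fin powR_ge0.
have I20 : (0 <= I2)%E by apply: integral_ge0 => x _; rewrite lee_fin powR_ge0.
have {}h : (I1 <= (C `^ p)%:E * I2)%E.
  move: I1 I2 h I10 I20 => J1 J2 h J10 J20.
  have := @gt0_ler_poweR _ p (ltW p0) _ _ _ _ h.
  rewrite !in_itv/= !leey !andbT poweR_ge0 mule_ge0 ?poweR_ge0 ?lee_fin ?(ltW C0)// => /(_ isT isT).
  rewrite poweRM ?poweR_ge0 ?lee_fin ?(ltW C0)// -!poweRrM mulVf ?gt_eqF// !poweRe1// poweR_EFin//.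
pose S (w : M2) := \sum_(i <- iota 0 N) (1 - toC w * (tower_center i)^*)^-1 ^+ 2.
have mS : Cmeasurable (disc 1) S.
  apply: Cmeasurable_sum => i; apply/CmeasurableX/CmeasurableV/CmeasurableB; first exact: Cmeasurable_cst.
  by apply: CmeasurableM; [exact: Cmeasurable_toC|exact: Cmeasurable_cst].
rewrite -(integral_hartogs_base hg g0 ng p0 mS).
apply: (@le_trans _ _ I1).
  (* The chosen projection and [bumps_proj] agree on the domain because the kernel determines
     both. *)
  rewrite le_eqVlt; apply/orP; left; apply/eqP; apply: eq_integral => y /set_mem hy.
  have hP : hartogs g (C2_of_R4 y) by exact: hy.
  rewrite -(bergman_projection_kernel hg g0 f2 hG' hP).
  by rewrite (bergman_projection_kernel hg g0 f2 hG hP).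
apply: (le_trans h); rewrite EFinM; apply: lee_wpmul2l; first by rewrite lee_fin powR_ge0.
exact: bumps_norm_le.
Qed.

End bump_norms.

(** * Unboundedness outside the critical interval *)

Section necessity.
Context {R : realType}.
Local Notation mR := (measurableTypeR R).
Local Notation M2 := (mR * mR)%type.
Local Notation leb2 := (@lebesgue2 R).
Local Notation leb4 := (@leb4 R).
Local Notation A1 := (@disc_area R).
Variables (g : R[i] -> R[i]) (a : R).
Hypothesis hg : cholomorphic g.
Hypothesis g0 : forall z, nc z < 1 -> g z != 0.
Hypothesis ng : forall z, nc z < 1 -> nc (g z) = nc (1 - z) `^ a.

Lemma tower_center_le i : nc (tower_center i : R[i]) <= 1.
Proof. by have := @tower_center_radius R i; have := @tower_radius_gt0 R i; lra. Qed.

Lemma tower_radius3_le i : 3 * tower_radius i <= 1 :> R.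
Proof. by rewrite /tower_radius; have := @tower_le R i; lra. Qed.

(** Divergence in quantitative form: on a disc of the tower the weight is at least [(3 r)^(-2)] and
    the area is [A1 r^2], so each of [K] disjoint discs contributes at least [A1 / 9]. *)
Lemma integral_base_weight_ge (b : R) K : 2 <= b ->
  ((K%:R * (A1 / 9))%:E <= \int[leb2]_(p in disc 1) (nc (1 - toC p) `^ (- b))%:E)%E.
Proof.
move=> b2; have a0 := @disc_area_gt0 R.
pose D i := disc_at (tower_center i : R[i]) (tower_radius i).
have mD i : measurable (D i) by exact: measurable_disc_at.
have sub i : D i `<=` disc 1.
  move=> p hp; have {}hp : nc (toC p - tower_center i) < tower_radius i by exact: hp.
  suff : nc (toC p) < 1 by [].
  have := nc_triangle (toC p - tower_center i) (tower_center i); rewrite subrK.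
  by have := @tower_center_radius R i; lra.
pose h i (p : M2) : R := (9 * tower_radius i ^+ 2)^-1 * \1_(D i) p.
have h0 i p : 0 <= h i p.
  by rewrite mulr_ge0// invr_ge0 mulr_ge0// exprn_ge0// ltW// tower_radius_gt0.
have mh i : measurable_fun (disc 1) (h i) by apply: measurable_funM => //; exact: measurable_indic.
have ih i : (\int[leb2]_(p in disc 1) (h i p)%:E = (A1 / 9)%:E)%E.
  under eq_integral do rewrite EFinM.
  have r0 := @tower_radius_gt0 R i.
  rewrite ge0_integralZl_EFin//; last 2 first.
  - by apply/measurable_EFinP; exact: measurable_indic.
  - by rewrite invr_ge0 mulr_ge0// exprn_ge0// ltW.
  rewrite integral_indic//.
  rewrite (setIidl (@sub i)) [X in (_ * X)%E](lebesgue2_disc_at _ r0) -EFinM; congr EFin.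
  by field; rewrite gt_eqF.
pose f k (p : M2) : R := \sum_(i <- iota 0 k) h i p.
have fS k p : f k.+1 p = f k p + h k p by rewrite /f -addn1 iotaD big_cat/= big_seq1.
have f0 k p : 0 <= f k p by apply: sumr_ge0.
have mf k : measurable_fun (disc 1) (f k).
  by apply: measurable_sum.
have If k : (\int[leb2]_(p in disc 1) (f k p)%:E = (k%:R * (A1 / 9))%:E)%E.
  elim: k => [|k ihk].
    by rewrite mul0r integral0_eq// => p _; rewrite /f big_nil.
  under eq_integral do rewrite fS EFinD.
  rewrite ge0_integralD//; try (by move=> p _; rewrite lee_fin); try exact/measurable_EFinP.
  by rewrite ihk ih -EFinD -[k.+1%:R]natr1 mulrDl mul1r.
rewrite -If; apply: ge0_le_integral => //.
- by move=> p _; rewrite lee_fin.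
- exact/measurable_EFinP.
- by apply/measurable_EFinP; exact: measurable_base_weight.
move=> p p1; rewrite lee_fin.
have fz k : D k p -> f k p = 0.
  move=> Dk; rewrite /f big_seq big1// => i; rewrite mem_iota => /andP[_ ik].
  rewrite /h indicE; case: (boolP (p \in D i)) => [/set_mem Di|]; last by rewrite mulr0.
  by move: ik; rewrite (tower_disjoint Di Dk) add0n ltnn.
elim: K => [|k ihk]; first by rewrite /f big_nil powR_ge0.
rewrite fS; have [Dk|nDk] := pselect (D k p); last first.
  by rewrite /h indicE memNset// mulr0 addr0.
rewrite fz// add0r /h indicE mem_set// mulr1.
have /andP[t1 t2] := tower_disc Dk; have r0 := @tower_radius_gt0 R k; have r3 := tower_radius3_le k.
have n0 : 0 < nc (1 - toC p) by lra.
have [l l2] : exists l : R, l = 2 by exists 2.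
have t3 : 0 < 3 * (tower_radius k : R) by rewrite mulr_gt0.
have -> : (9 * tower_radius k ^+ 2)^-1 = (3 * tower_radius k) `^ (- l).
  rewrite powRN l2 (powR_mulrn 2 (ltW t3)); congr (_^-1); ring.
apply: (@le_trans _ _ (nc (1 - toC p) `^ (- l))).
  by apply: powR_antitone => //; lra.
by apply: ger_powR; lra.
Qed.

Lemma not_bounded_large p : 2 < p -> 2 <= a * (p - 2) -> ~ bergman_bounded_on_Lp (hartogs g) p.
Proof.
move=> p2 ap /(bounded_bumps hg g0 ng (lt_trans (ltr0Sn _ 1) p2))[C C0 hC].
have a0 := @disc_area_gt0 R; have p0 : 0 < p by lra.
have r0 := @tower_radius_gt0 R 0.
pose B : R := tower_radius 0 `^ (a * (2 - p)).
have e1 : a * (2 - p) = - (a * (p - 2)) by ring.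
have hB z : nc (z - tower_center 0) < tower_radius 0 -> nc (1 - z) `^ (a * (2 - p)) <= B.
  by move=> /tower_disc/andP[h _]; rewrite /B e1; apply: powR_antitone => //; lra.
have := bump_norm_le hg g0 ng p0 r0 (tower_center_radius 0) hB.
set M := A1 * _ => hM.
have hM' i : (i < 1)%N ->
    (\int[leb4]_(y in hartogs4 g) (nc (bump g (tower_center i) (tower_radius i) (C2_of_R4 y)) `^ p)%:E <= M%:E)%E.
  by rewrite ltnS leqn0 => /eqP ->; exact: hM.
have H := hC 1%N M hM'.
(* On the unit disc the single summand [(1 - w * conj x)^(-2)] has modulus at least 1/4, as the base
   has modulus at most 2. *)
have q0 : 0 < 4^-1 `^ p :> R by rewrite powR_gt0// invr_gt0.
have low K : K%:R * (A1 * (4^-1 `^ p * (A1 / 9))) <= C * (1%:R * M).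
  rewrite -lee_fin; apply: le_trans H; rewrite mulrCA EFinM.
  apply: lee_wpmul2l; first by rewrite lee_fin ltW.
  have mw b : measurable_fun (disc 1) (fun w : M2 => (nc (1 - toC w) `^ b)%:E).
    by apply/measurable_EFinP; exact: measurable_base_weight.
  apply: (@le_trans _ _ (\int[leb2]_(w in disc 1) ((4^-1 `^ p)%:E * (nc (1 - toC w) `^ (a * (2 - p)))%:E))%E).
    rewrite ge0_integralZl_EFin//; try (by move=> w _; rewrite lee_fin powR_ge0); try exact: ltW.
    rewrite mulrCA EFinM; apply: lee_wpmul2l; first by rewrite lee_fin ltW.
    by rewrite e1; exact: integral_base_weight_ge.
  apply: ge0_le_integral => //.
  - by move=> w _; rewrite mule_ge0// lee_fin powR_ge0.
  - by apply: emeasurable_funM.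
  - apply/measurable_EFinP; apply: measurable_funM; last exact: measurable_base_weight.
    apply: (measurableT_comp (f := fun x : R => x `^ p)); first exact: measurable_powR.
    apply: measurable_nc; apply: Cmeasurable_sum => i; apply/CmeasurableX/CmeasurableV/CmeasurableB; first exact: Cmeasurable_cst.
    by apply: CmeasurableM; [exact: Cmeasurable_toC|exact: Cmeasurable_cst].
  move=> w w1; rewrite -EFinM lee_fin ler_wpM2r ?powR_ge0// big_seq1.
  have w1' : nc (toC w) < 1 by exact: w1.
  apply: ge0_ler_powR; rewrite ?nnegrE ?invr_ge0 ?nc_ge0//; first exact: ltW.
  rewrite ncX ncV; set u := nc (1 - _).
  have u0 : 0 < u.
    rewrite nc_gt0; apply: one_sub_neq0; rewrite ncM nc_conj.
    by apply: le_lt_trans w1'; rewrite ler_piMr ?nc_ge0// tower_center_le.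
  have u2 : u <= 2.
    apply: (le_trans (nc_subadd _ _)); rewrite nc1 ncM nc_conj.
    have : nc (toC w) * nc (tower_center 0 : R[i]) <= 1 * 1.
      by apply: ler_pM; rewrite ?nc_ge0// ?tower_center_le// ltW.
    lra.
  have -> : 4^-1 = 2^-1 ^+ 2 :> R by rewrite exprVn -natrX.
  by rewrite lerXn2r ?nnegrE ?invr_ge0// ?(ltW u0)// lef_pV2 ?posrE.
set c := A1 * _ in low.
have c0 : 0 < c by rewrite !mulr_gt0 ?invr_gt0.
have CM0 : 0 <= C * (1%:R * M) by have := low 0%N; rewrite mul0r.
have := archi_boundP (divr_ge0 CM0 (ltW c0)); rewrite ltr_pdivrMr// => h.
by have := low (Num.bound (C * (1%:R * M) / c)); rewrite leNgt h.
Qed.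

(** Under this hypothesis the weight on disc [i] is at most [(3 r)^(2p - 2)], which balances
    [r^(-2p)] from the normalisation and [r^2] from the area, so every bump obeys one bound [M].
    Near the origin the summands of the projection cannot cancel, and comparing [N^p] with [N]
    contradicts boundedness. *)
Lemma not_bounded_small p : 1 < p -> 2 * p - 2 <= a * (2 - p) -> ~ bergman_bounded_on_Lp (hartogs g) p.
Proof.
move=> p1 ap; have p0 : 0 < p by lra.
move=> /(bounded_bumps hg g0 ng p0)[C C0 hC]; have a0 := @disc_area_gt0 R.
pose M := A1 * (3 `^ (2 * p - 2) * A1).
have hM i : (\int[leb4]_(y in hartogs4 g)
    (nc (bump g (tower_center i) (tower_radius i) (C2_of_R4 y)) `^ p)%:E <= M%:E)%E.
  have r0 := @tower_radius_gt0 R i; set r := tower_radius i in r0 *.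
  have r3 : 3 * r <= 1 by exact: tower_radius3_le.
  have hB z : nc (z - tower_center i) < r -> nc (1 - z) `^ (a * (2 - p)) <= (3 * r) `^ (2 * p - 2).
    move=> /tower_disc/andP[h1 h2]; have b0 : 0 <= a * (2 - p) by lra.
    apply: (@le_trans _ _ ((3 * r) `^ (a * (2 - p)))).
      apply: ge0_ler_powR => //; rewrite nnegrE ?nc_ge0//; lra.
    by apply: ger_powR => //; lra.
  apply: le_trans (bump_norm_le hg g0 ng p0 r0 (tower_center_radius i) hB) _.
  rewrite lee_fin le_eqVlt; apply/orP; left; apply/eqP; congr (_ * _).
  have r0' := ltW r0.
  have E1 : (r ^- 2) `^ p = r `^ (- (2 * p)).
    by rewrite -powR_mulrn// -powRN -powRrM mulNr.
  have E2 : (3 * r) `^ (2 * p - 2) = 3 `^ (2 * p - 2) * r `^ (2 * p - 2) by rewrite powRM.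
  have E3 : r `^ (- (2 * p)) * r `^ (2 * p - 2) * r ^+ 2 = 1.
    rewrite -powR_mulrn// -!powRD ?(gt_eqF r0) ?implybT//.
    by rewrite (_ : _ + _ = 0) ?powRr0// -[2%:R]/(2 : R); ring.
  rewrite E1 E2; transitivity ((r `^ (- (2 * p)) * r `^ (2 * p - 2) * r ^+ 2) * (3 `^ (2 * p - 2) * A1)).
    by move: (r `^ _) (r `^ _) (3 `^ _) => u1 u2 u3; ring.
  by rewrite E3 mul1r.
(* Lower bound for the weight on the disc of radius 1/8, where [|1 - w| >= 7/8]. *)
pose kap : R := (7 / 8) `^ (a * (2 - p)).
have k0 : 0 < kap by rewrite powR_gt0//; lra.
have d8 : 0 < 8^-1 :> R by rewrite invr_gt0.
have low N : A1 * ((N%:R / 2) `^ p * kap * (8^-1 ^+ 2 * A1)) <= C * (N%:R * M).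
  rewrite -lee_fin; apply: le_trans (hC N M (fun i _ => hM i)); rewrite EFinM.
  apply: lee_wpmul2l; first by rewrite lee_fin ltW.
  pose F (w : M2) := (nc (\sum_(i <- iota 0 N) (1 - toC w * (tower_center i)^*)^-1 ^+ 2) `^ p *
     nc (1 - toC w) `^ (a * (2 - p)))%:E.
  have mF (A : set M2) : measurable_fun A F.
    apply/measurable_EFinP; apply: measurable_funM; last exact: measurable_base_weight.
    apply: (measurableT_comp (f := fun x : R => x `^ p)); first exact: measurable_powR.
    apply: measurable_nc; apply: Cmeasurable_sum => i; apply/CmeasurableX/CmeasurableV/CmeasurableB; first exact: Cmeasurable_cst.
    by apply: CmeasurableM; [exact: Cmeasurable_toC|exact: Cmeasurable_cst].
  have F0 w : (0 <= F w)%E by rewrite lee_fin mulr_ge0 ?powR_ge0.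
  pose D8 : set M2 := disc_at 0 8^-1.
  have sub : D8 `<=` disc 1.
    move=> w hw; have {}hw : nc (toC w - 0) < 8^-1 by exact: hw.
    suff : nc (toC w) < 1 by [].
    by rewrite subr0 in hw; lra.
  have mD : measurable D8 by exact: measurable_disc_at.
  apply: (@le_trans _ _ (\int[leb2]_(w in D8) F w)%E); last first.
    apply: ge0_subset_integral => //; exact: measurable_disc.
  apply: (@le_trans _ _ (\int[leb2]_(w in D8) cst ((N%:R / 2) `^ p * kap)%:E w)%E).
    by rewrite integral_cst// [X in (_ * X)%E](lebesgue2_disc_at _ d8) -EFinM.
  apply: ge0_le_integral => //.
  - by move=> w _; rewrite lee_fin mulr_ge0 ?powR_ge0// ltW.
  move=> w hw; have {}hw : nc (toC w) < 8^-1 by rewrite -(subr0 (toC w)); exact: hw.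
  rewrite lee_fin; apply: ler_pM; rewrite ?powR_ge0 ?(ltW k0)//; last first.
    have n7 : 7 / 8 <= nc (1 - toC w).
      by apply: le_trans (nc_lower _ _); rewrite nc1; lra.
    apply: ge0_ler_powR; rewrite ?nnegrE ?nc_ge0//; lra.
  apply: ge0_ler_powR; rewrite ?nnegrE ?nc_ge0 ?divr_ge0//; first exact: ltW.
  apply: le_trans (Re_le_nc _); apply: le_trans (ler_norm _).
  (* With [|y| <= 1/8], [|1 - (1 - y)^(-2)|] is at most [(1/8) (17/8) (8/7)^2 = 17/49 <= 1/2]. Real
     parts at least 1/2 exclude cancellation. *)
  have term i : 2^-1 <= Re ((1 - toC w * (tower_center i)^*)^-1 ^+ 2).
    set y := toC w * _; have y8 : nc y <= 8^-1.
      rewrite ncM nc_conj; apply: le_trans (ltW hw).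
      by rewrite ler_piMr ?nc_ge0// tower_center_le.
    have u7 : 7 / 8 <= nc (1 - y) by apply: le_trans (nc_lower _ _); rewrite nc1; lra.
    have u0 : 1 - y != 0 by rewrite -nc_gt0; lra.
    have E : 1 - (1 - y)^-1 ^+ 2 = - (y * (2 - y) * ((1 - y)^-1) ^+ 2) by field.
    have n2 : nc (2 - y) <= 17 / 8.
      apply: (le_trans (nc_subadd _ _)); have -> : nc (2 : R[i]) = 2.
        by rewrite -[2 : R[i]]/((1 + 1)%R : R[i]) -(rmorph1 (real_complex R)) -rmorphD nc_real ger0_norm.
      lra.
    have nE : nc (1 - (1 - y)^-1 ^+ 2) <= 2^-1.
      rewrite E ncN (ncM (y * _) (_ ^+ 2)) ncM ncX ncV.
      have i7 : (nc (1 - y))^-1 <= 8 / 7.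
        by rewrite -[8 / 7]invrK lef_pV2 ?posrE ?invr_gt0 ?divr_gt0 ?invf_div//; lra.
      have i7' : (nc (1 - y))^-1 ^+ 2 <= (8 / 7) ^+ 2.
        by rewrite lerXn2r ?nnegrE ?invr_ge0 ?nc_ge0 ?divr_ge0.
      apply: (@le_trans _ _ (8^-1 * (17 / 8) * (8 / 7) ^+ 2)); last lra.
      apply: ler_pM => //; rewrite ?mulr_ge0 ?exprn_ge0 ?invr_ge0 ?nc_ge0//.
      by apply: ler_pM; rewrite ?nc_ge0.
    have := Re_le_nc (1 - (1 - y)^-1 ^+ 2); rewrite ReD ReN => /(le_trans (ler_norm _)).
    have -> : Re (1 : R[i]) = 1 by [].
    lra.
  elim: N {mF F0 F} => [|N ih]; first by rewrite mul0r big_nil.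
  rewrite -addn1 iotaD big_cat/= big_seq1 ReD addn1 -[N.+1%:R]natr1 mulrDl mul1r.
  by apply: lerD; [exact: ih|exact: term].
pose c := A1 * (2^-1 `^ p * kap * (8^-1 ^+ 2 * A1)).
have c0 : 0 < c by rewrite !mulr_gt0 ?powR_gt0 ?invr_gt0 ?exprn_gt0.
have M0 : 0 < M by rewrite !mulr_gt0 ?powR_gt0.
have up N : (0 < N)%N -> N%:R `^ (p - 1) <= C * M / c.
  move=> N0; have Np : 0 < N%:R :> R by rewrite ltr0n.
  rewrite ler_pdivlMr// -(ler_pM2l Np) (_ : N%:R * (C * M) = C * (N%:R * M)); last by ring.
  apply: le_trans (low N); rewrite le_eqVlt; apply/orP; left; apply/eqP.
  have e : N%:R `^ p = N%:R * N%:R `^ (p - 1) :> R.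
    by rewrite -[X in X * _](powRr1 (ltW Np)) -powRD ?(gt_eqF Np) ?implybT// addrC subrK.
  rewrite powRM ?invr_ge0// e /c; move: (_ `^ _) (_ `^ _) => y1 y2; ring.
have pp : 0 < p - 1 by lra.
(* Chosen so that [y^(p - 1)] exceeds the bound [C * M / c] by 1; any integer above [y] then
   violates [up]. *)
pose y := (C * M / c + 1) `^ (p - 1)^-1.
have K0 : 0 < C * M / c by rewrite divr_gt0// mulr_gt0.
have y0 : 0 <= y by exact: powR_ge0.
have hy := archi_boundP y0.
have N0 : (0 < Num.bound y)%N by rewrite -(ltr_nat R); exact: le_lt_trans y0 hy.
have := up _ N0; apply/negP; rewrite -ltNge.
have := gt0_ltr_powR pp (_ : y \in Num.nneg) (_ : (Num.bound y)%:R \in Num.nneg) hy.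
rewrite !nnegrE y0 ler0n => /(_ isT isT); apply: lt_trans.
by rewrite /y -powRrM mulVf ?gt_eqF// powRr1; lra.
Qed.

End necessity.

(** * The profile [(1 - z)^a] and the choice of exponents *)

Section choice_of_profile.
Context {R : realType}.

Lemma Re_one_sub_gt0 (z : R[i]) : nc z < 1 -> 0 < Re (1 - z).
Proof.
move=> z1; have := Re_le_nc z; rewrite ReD ReN => /(le_trans (ler_norm _)).
by rewrite /= -/(Re z); lra.
Qed.

Lemma cholomorphic_profile a : cholomorphic (fun z : R[i] => cpow a (1 - z)).
Proof.
move=> z z1; have [l hl] := cderiv_cpow a (Re_one_sub_gt0 z1).
have d := cderivB (cderiv_cst 1 z) (cderiv_id z).
by eexists; exact: (cderiv_comp (f := fun z => 1 - z) d hl).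
Qed.

Lemma nc_profile a (z : R[i]) : nc z < 1 -> nc (cpow a (1 - z)) = nc (1 - z) `^ a.
Proof. by move=> z1; rewrite nc_cpow// one_sub_neq0. Qed.

End choice_of_profile.

Theorem theorem1p5 (R : realType) (p0 q0 : R) (hp0 : 2 < p0)
    (hq0 : p0^-1 + q0^-1 = 1) :
  exists Omega0 : set (C2 R),
    [/\ is_domain Omega0,
        bounded_set Omega0 &
        forall p : R, 1 < p ->
          (bergman_bounded_on_Lp Omega0 p <-> q0 < p < p0)].
Proof.
pose a := 2 / (p0 - 2); have d0 : 0 < p0 - 2 by lra.
have a0 : 0 < a by rewrite divr_gt0.
have ap0 : a * (p0 - 2) = 2 by rewrite /a divfK// gt_eqF.
have k0 : 0 < p0^-1 by rewrite invr_gt0; lra.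
have kp0 : p0^-1 * p0 = 1 by rewrite mulVf// gt_eqF//; lra.
have k2 : p0^-1 < 2^-1 by rewrite ltf_pV2 ?posrE//; lra.
have q00 : 0 < q0 by rewrite -invr_gt0; lra.
have q0k : q0^-1 * q0 = 1 by rewrite mulVf// gt_eqF.
(* The critical value of the minimum [m] of [1/p] and [1/q] below: [(1 + a) m = a / 2] exactly at
   [m = 1/p0]. *)
have ak : (1 + a) * p0^-1 = a / 2.
  have E : 1 + a = a * p0 / 2 by lra.
  by rewrite E; field; rewrite gt_eqF//; lra.
pose g (z : R[i]) := cpow a (1 - z).
have hg : cholomorphic g by exact: cholomorphic_profile.
have g0 z : nc z < 1 -> g z != 0 by move=> _; exact: cpow_neq0.
have ng z : nc z < 1 -> nc (g z) = nc (1 - z) `^ a by exact: nc_profile.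
have gB z : nc z < 1 -> nc (g z) <= 2 `^ a.
  move=> z1; rewrite ng//; apply: ge0_ler_powR; rewrite ?nnegrE ?nc_ge0 ?(ltW a0)//.
  by apply: (le_trans (nc_subadd _ _)); rewrite nc1; lra.
exists (hartogs g); split.
- exact: hartogs_domain hg g0.
- exact: hartogs_bounded gB.
move=> p p1; split => [hp|/andP[qp pp]].
  apply/andP; split; rewrite ltNge; apply/negP => h.
    apply: (not_bounded_small hg g0 ng p1 _ hp).
    have q0p : q0 * (p0 - 1) = p0.
      have : (p0^-1 + q0^-1) * (p0 * q0) = p0 * q0 by rewrite hq0 mul1r.
      have -> : (p0^-1 + q0^-1) * (p0 * q0) = p0^-1 * p0 * q0 + q0^-1 * q0 * p0 by ring.
      by rewrite kp0 q0k; lra.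
    have hh : p * (p0 - 1) <= p0 by rewrite -[leRHS]q0p ler_wpM2r//; lra.
    (* Since [a * p0 = 2 + 2 * a], the hypothesis of the small-exponent case has the sign of
       [p0 - p (p0 - 1)], and [q0 (p0 - 1) = p0] places its zero at [q0]. *)
    have E : a * (2 - p) - (2 * p - 2) = (p0 - p * (p0 - 1)) * a.
      have e2 : a * p0 = 2 + 2 * a by lra.
      have -> : (p0 - p * (p0 - 1)) * a = a * p0 - p * (a * p0) + p * a by ring.
      by rewrite e2; ring.
    by rewrite -subr_ge0 E mulr_ge0 ?(ltW a0)// subr_ge0.
  have p2 : 2 < p by lra.
  apply: (not_bounded_large hg g0 ng p2 _ hp).
  by rewrite -ap0 ler_wpM2l ?(ltW a0)//; lra.
pose q := p / (p - 1); have pm : 0 < p - 1 by lra.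
have p00 : 0 < p by lra.
have q01 : 0 < q by rewrite divr_gt0.
have pq : p^-1 + q^-1 = 1 by rewrite /q invf_div; field; rewrite !gt_eqF.
(* Divided by the exponent, the Schur conditions are linear in its inverse. Both [1/p] and [1/q] lie
   in [[m, 1 - m]], so the worst cases are the two ends. *)
pose m := Num.min p^-1 q^-1.
have mp : m <= p^-1 by rewrite /m ge_min lexx.
have mq : m <= q^-1 by rewrite /m ge_min lexx orbT.
have km : p0^-1 < m.
  rewrite /m lt_min; apply/andP; split; first by rewrite ltf_pV2 ?posrE//; lra.
  have : p^-1 < q0^-1 by rewrite ltf_pV2 ?posrE.
  by lra.
have am : a / 2 < (1 + a) * m by rewrite -ak ltr_pM2l//; lra.
(* The requirements are [a (1 - m) < t] and [2 s + t < (a + 2) m]. With this [t], the first and the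
   inequality [t < (a + 2) m] both reduce to [a / 2 < (1 + a) m]; then [s] uses half of the
   remaining room. *)
pose t := a / 2 + m; pose s := ((2 + a) * m - t) / 4.
have s0 : 0 < s by rewrite /s /t; lra.
have cond i : m <= i -> i <= 1 - m -> a * i < t /\ 2 * s + t < (a + 2) * i.
  move=> mi im; split.
    by have := ler_wpM2l (ltW a0) im; rewrite /t; lra.
  have a2 : 0 <= a + 2 by lra.
  by have := ler_wpM2l a2 mi; rewrite /s /t; lra.
have [||cp1 cp2] := cond p^-1 => //; first lra.
have [||cq1 cq2] := cond q^-1 => //; first lra.
have fin e : 0 < e -> a * e^-1 < t -> 2 * s + t < (a + 2) * e^-1 ->
    a < t * e /\ 2 * (s * e) + t * e < a + 2.
  move=> e0 h1 h2; rewrite -ltr_pdivrMr//; split => //.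
  by rewrite mulrA -mulrDl -ltr_pdivlMr.
have [f1 f2] := fin _ p00 cp1 cp2; have [f3 f4] := fin _ q01 cq1 cq2.
exact: (hartogs_bounded_on_Lp hg g0 ng p1 pq s0 f1 f2 f3 f4).
Qed.
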